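(* Let $a\in[0,1]$, $c_3=30$, $c_4=157$, let $\mathcal A$ be a monotone graph property and let $m=n^{\alpha}$ with a constant $\alpha>10/3$. Let $p_-=1-\exp(-mp^2(1-p)^{n-2})$ and $$p_+=\begin{cases}1-\exp(-mp^2(1-p)^{n-2})+c_3\sqrt[3]{mp^3}, & \text{if } \Omega(n^{-1}m^{-1/3})=p=o(n^{-1}m^{-1/4});\\[2pt] 1-\exp(-mp^2(1-p)^{n-2})+c_3\sqrt[3]{mp^3}+c_4\sqrt[6]{mp^4}, & \text{if } \Omega(n^{-1}m^{-1/4})=p=O(m^{-1/2}\ln^{1/2}n).\end{cases}$$ If $\Pr\{G(n,p_-)\in\mathcal A\}\to a$ and $\Pr\{G(n,p_+)\in\mathcal A\}\to a$, then $\Pr\{\mathcal G(n,m,p)\in\mathcal A\}\to a$.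
   Context: $G(n,p)$ denotes the binomial random graph on an $n$-element vertex set, each edge present independently with probability $p$. The random intersection graph $\mathcal G(n,m,p)$: vertex set $\mathcal V$, $|\mathcal V|=n$, object set $\mathcal W$, $|\mathcal W|=m$; each vertex $v$ receives $W(v)\subseteq\mathcal W$ with the events $w\in W(v)$ independent of probability $p$ for all $(v,w)$; $v_1\ne v_2$ are adjacent iff $W(v_1)\cap W(v_2)\ne\emptyset$. A graph property (isomorphism-closed family of graphs on the vertex set) is monotone if it is closed under adding edges or closed under deleting edges. Limits are as $n\to\infty$. *)

(* Defs.v *)
From HB Require Import structures.
From Stdlib Require Import Reals.
From mathcomp Require Import all_boot perm.
Set Implicit Arguments.
Unset Strict Implicit.
Unset Printing Implicit Defensive.

Definition graph (n : nat) := {set {set 'I_n}}.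
Definition simple (n : nat) (g : graph n) : bool := [forall e in g, #|e| == 2].

Definition relabel (n : nat) (s : {perm 'I_n}) (g : graph n) : graph n :=
  [set s @: (e : {set 'I_n}) | e in g].

Definition graph_property (n : nat) (A : pred (graph n)) : Prop :=
  forall (s : {perm 'I_n}) (g : graph n), simple g -> A (relabel s g) = A g.

Definition monotone_up (n : nat) (A : pred (graph n)) : Prop :=
  forall g h : graph n, simple g -> simple h -> g \subset h -> A g -> A h.
Definition monotone_down (n : nat) (A : pred (graph n)) : Prop :=
  forall g h : graph n, simple g -> simple h -> g \subset h -> A h -> A g.

Local Open Scope R_scope.

Definition Rsum (T : finType) (P : pred T) (F : T -> R) : R :=
  \big[Rplus/0]_(x | P x) F x.

Definition clamp01 (x : R) : R := Rmax 0 (Rmin 1 x).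

Definition prob_Gnp (n : nat) (p : R) (A : pred (graph n)) : R :=
  let q := clamp01 p in
  Rsum (fun g : graph n => simple g && A g)
       (fun g => q ^ #|g| * (1 - q) ^ ('C(n, 2) - #|g|)%N).

Definition int_graph (n m : nat) (W : {ffun 'I_n -> {set 'I_m}}) : graph n :=
  [set e : {set 'I_n} | [exists u : 'I_n, exists v : 'I_n,
     [&& u != v, W u :&: W v != set0 & e == [set u; v]]]].

Definition prob_Gnmp (n m : nat) (p : R) (A : pred (graph n)) : R :=
  Rsum (fun W : {ffun 'I_n -> {set 'I_m}} => A (int_graph W))
       (fun W => \big[Rmult/1]_(v : 'I_n) (p ^ #|W v| * (1 - p) ^ (m - #|W v|)%N)).

Definition rt (k x : R) : R := if Rlt_dec 0 x then Rpower x (/ k) else 0.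

Definition bigOmega (f g : nat -> R) : Prop :=
  exists c, 0 < c /\ exists N, forall n, (N <= n)%nat -> c * g n <= f n.
Definition littleo (f g : nat -> R) : Prop :=
  forall eps, 0 < eps -> exists N, forall n, (N <= n)%nat -> Rabs (f n) <= eps * g n.
Definition bigO (f g : nat -> R) : Prop :=
  exists C, exists N, forall n, (N <= n)%nat -> Rabs (f n) <= C * g n.

Section Formulas.
Variables (m : nat -> nat) (p : nat -> R).
Definition mR n := INR (m n).

Definition pminus (n : nat) : R :=
  1 - exp (- (mR n * p n ^ 2 * (1 - p n) ^ (n - 2)%N)).
Definition pplus1 (n : nat) : R :=
  pminus n + 30 * rt 3 (mR n * p n ^ 3).
Definition pplus2 (n : nat) : R :=
  pminus n + 30 * rt 3 (mR n * p n ^ 3) + 157 * rt 6 (mR n * p n ^ 4).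

Definition regime1 : Prop :=
  bigOmega p (fun n => / (INR n * rt 3 (mR n))) /\
  littleo p (fun n => / (INR n * rt 4 (mR n))).
Definition regime2 : Prop :=
  bigOmega p (fun n => / (INR n * rt 4 (mR n))) /\
  bigO p (fun n => / sqrt (mR n) * sqrt (ln (INR n))).
End Formulas.

(* Main.v *)
(** Call the set of vertices that choose an object its type. Since n p -> 0, the
    number of objects of nonempty type is nearly Poisson: the binomial law is
    pointwise at most 1 + o(1) times the Poisson law, so at the cost of a factor
    1 + o(1) the types may be taken to be present independently. Keeping only the
    types of size 2 gives exactly G(n, p_-), whence the lower bound.

    For the upper bound no object is chosen by five vertices (four in the first
    regime), and the random families of triples and of quadruples have to be
    embedded as cliques of G(n, 30 (m p^3)^(1/3)) and G(n, 157 (m p^4)^(1/6)).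
    Each clique is tested in turn and accepted, when all its edges are present,
    with a probability chosen so that it is accepted exactly as often as the
    random family requires. This probability never has to exceed 1/2: given the
    past, the clique is present with probability at least 2^(-10) times its
    unconditional one, because a rejected clique that the new one would complete
    costs only a factor 2, there are at most 9 of these by sparsity of the family,
    and the other rejected cliques need further absent edges.

    If in the first regime m p^2 > 4 ln n, then G(n, p_-) is already complete
    with high probability. Decreasing properties follow by complementation. *)
Require Import Defs.
From HB Require Import structures.
From Stdlib Require Import Reals.
From mathcomp Require Import all_boot perm.
From mathcomp Require Import all_order all_algebra.
From mathcomp Require Import ring lra zify.
From mathcomp Require Import Rstruct.
Set Implicit Arguments.
Unset Strict Implicit.
Unset Printing Implicit Defensive.
Import Order.TTheory GRing.Theory Num.Theory.

(** * Product Bernoulli measures *)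

Section BernoulliSets.
Local Open Scope ring_scope.
Variables (R : realFieldType) (T : finType).
Implicit Types (pr : T -> R) (f g : {set T} -> R) (A G Z : {set T}).

(** The condition [10 / 3 < alpha] is what makes the random families sparse. When m p^2 is at most
    of order ln n, the rates m p^3 of triples and m p^4 of quadruples lie below n^(-5/3) and
    n^(-10/3) by a power of n, so a subfamily F on w vertices is unlikely once 3 w <= 5 |F|,
    respectively 3 w <= 10 |F|; the same condition gives m (n p)^5 -> 0. In powers of [sigma], which
    is n^(1/6), all these exponents are integers. The obstacle in the embedding is that rejections
    are decreasing events, so positive correlation works against the next clique. What is needed is
    a lower bound for its conditional probability, valid for every history of a good family. The cap
    1/2 makes such a bound possible, since a rejection then never excludes a clique outright, and
    the bound in turn restores the cap at the next step. The loss 2^10, doubled for the cap, asks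
    for 2048 q <= r^3 or 2048 q <= r^6, where q is the rate of the family and r the edge probability
    offered; both 30^3 and 157^6 exceed 2048. *)

Definition bern pr G : R := \prod_t (if t \in G then pr t else 1 - pr t).
Definition Ex pr f : R := \sum_(G : {set T}) bern pr G * f G.

(** With the probability of [t] set to 0 the remaining elements still have a law on all of
    [{set T}], so conditioning on [t] needs no subtype. *)
Definition pr_off (t : T) pr : T -> R := fun u => if u == t then 0 else pr u.

Lemma eq_Ex pr pr' f g : pr =1 pr' -> f =1 g -> Ex pr f = Ex pr' g.
Proof.
move=> eq_pr eq_f; apply: eq_bigr => G _; rewrite eq_f; congr (_ * _).
by apply: eq_bigr => t _; rewrite eq_pr.
Qed.

Lemma Ex_cond t pr f :
  Ex pr f = pr t * Ex (pr_off t pr) (fun G => f (t |: G)) +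
            (1 - pr t) * Ex (pr_off t pr) f.
Proof.
pose rest (G : {set T}) : R := \prod_(u | u != t) (if u \in G then pr u else 1 - pr u).
have bernE G : bern pr G = (if t \in G then pr t else 1 - pr t) * rest G.
  by rewrite /bern (bigD1 t).
have bern0E G : bern (pr_off t pr) G = (if t \in G then 0 else 1) * rest G.
  rewrite /bern (bigD1 t) //= /pr_off eqxx subr0; congr (_ * _).
  by apply: eq_bigr => u /negPf ->.
have restU G : rest (t |: G) = rest G.
  by apply: eq_bigr => u ut; rewrite !inE (negPf ut).
have restD G : rest (G :\ t) = rest G.
  by apply: eq_bigr => u ut; rewrite !inE ut.
have Ex0 g : Ex (pr_off t pr) g = \sum_(G : {set T} | t \notin G) rest G * g G.
  rewrite /Ex (bigID (fun G : {set T} => t \in G)) /= big1 ?add0r.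
    by apply: eq_bigr => G /negPf tG; rewrite bern0E tG mul1r.
  by move=> G tG; rewrite bern0E tG !mul0r.
rewrite !Ex0 /Ex (bigID (fun G : {set T} => t \in G)) /=; congr (_ + _).
  rewrite (reindex_onto (fun G => t |: G) (fun G => G :\ t)) /=; last first.
    by move=> G tG; rewrite setD1K.
  rewrite big_distrr /=; apply: eq_big => G.
    rewrite setU11 /=; apply/eqP/idP => [<-|tG]; first by rewrite !inE eqxx.
    by rewrite setU1K.
  by move=> _; rewrite bernE setU11 restU mulrA.
rewrite big_distrr /=; apply: eq_bigr => G /negPf tG.
by rewrite bernE tG mulrA.
Qed.

(** The elements of [s] are exposed one at a time, [A] holding those already found present. This
    turns comparisons of expectations into inductions on [s]. *)
Fixpoint Eseq pr (s : seq T) f (A : {set T}) : R :=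
  if s is t :: s' then pr t * Eseq pr s' f (t |: A) + (1 - pr t) * Eseq pr s' f A
  else f A.

Lemma Ex_0 pr f : (forall t, pr t = 0) -> Ex pr f = f set0.
Proof.
move=> pr0; rewrite /Ex (bigD1 set0) //= big1 ?addr0.
  by rewrite /bern big1 ?mul1r // => t _; rewrite inE pr0 subr0.
move=> G /set0Pn [t tG].
by rewrite /bern (bigD1 t) //= tG pr0 !mul0r.
Qed.

Lemma Ex_on_seq pr (s : seq T) f A : uniq s ->
  Ex (fun t => if t \in s then pr t else 0) (fun G => f (A :|: G)) = Eseq pr s f A.
Proof.
elim: s A => [|t s IHs] A /=; first by move=> _; rewrite Ex_0 ?setU0.
case/andP=> ts us; rewrite (Ex_cond t) inE eqxx /= -!IHs //.
have offE : pr_off t (fun u => if u \in t :: s then pr u else 0) =1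
   (fun u => if u \in s then pr u else 0).
  move=> u; rewrite /pr_off inE.
  by have [->|] := eqVneq u t; first by rewrite (negPf ts).
congr (_ * _ + _ * _); apply: eq_Ex => // G.
by rewrite [t |: A]setUC -setUA.
Qed.

Lemma Ex_enum pr f : Ex pr f = Eseq pr (enum T) f set0.
Proof.
rewrite -Ex_on_seq ?enum_uniq //; apply: eq_Ex => [t|G]; last by rewrite set0U.
by rewrite mem_enum.
Qed.

Lemma Eseq_sum pr s f A : uniq s ->
  Eseq pr s f A = Ex (fun t => if t \in s then pr t else 0) (fun G => f (A :|: G)).
Proof. by move=> us; rewrite Ex_on_seq. Qed.

Lemma Ex_add pr f g : Ex pr (fun G => f G + g G) = Ex pr f + Ex pr g.
Proof. by rewrite /Ex -big_split; apply: eq_bigr => G _; rewrite mulrDr. Qed.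

Lemma Ex_scale pr c f : Ex pr (fun G => c * f G) = c * Ex pr f.
Proof. by rewrite /Ex big_distrr; apply: eq_bigr => G _; rewrite /= mulrCA. Qed.

Lemma Ex_bigsum (I : finType) (P : pred I) pr (F : I -> {set T} -> R) :
  Ex pr (fun G => \sum_(i | P i) F i G) = \sum_(i | P i) Ex pr (F i).
Proof.
by rewrite /Ex exchange_big; apply: eq_bigr => G _; rewrite big_distrr.
Qed.

Lemma Ex_const pr c : Ex pr (fun=> c) = c.
Proof.
have -> : Ex pr (fun=> c) = Ex pr (fun=> 1) * c.
  by rewrite mulrC -Ex_scale; apply: eq_Ex => // G; rewrite mulr1.
rewrite /Ex (eq_bigr (bern pr)) => [|G _]; last by rewrite mulr1.
rewrite -bigA_distr big1 ?mul1r // => t _; exact: subrKC.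
Qed.

Definition isprob pr := forall t, 0 <= pr t <= 1.

Lemma bern_ge0 pr G : isprob pr -> 0 <= bern pr G.
Proof.
move=> prP; apply: prodr_ge0 => t _; have /andP [p0 p1] := prP t.
by case: ifP => _ //; rewrite subr_ge0.
Qed.

Lemma le_Ex pr f g : isprob pr -> (forall G, f G <= g G) -> Ex pr f <= Ex pr g.
Proof.
by move=> prP fg; apply: ler_sum => G _; rewrite ler_wpM2l ?bern_ge0.
Qed.

Lemma Ex_ge0 pr f : isprob pr -> (forall G, 0 <= f G) -> 0 <= Ex pr f.
Proof. by move=> prP f0; rewrite -[leLHS](Ex_const pr); apply: le_Ex. Qed.

Definition incr f := forall G G' : {set T}, G \subset G' -> f G <= f G'.

Lemma Eseq_incr pr s f : isprob pr -> incr f -> incr (Eseq pr s f).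
Proof.
move=> prP fi; elim: s => [//|t s IHs] A B AB /=.
have /andP [p0 p1] := prP t.
by rewrite lerD // ler_wpM2l ?subr_ge0 // IHs // setUS.
Qed.

Lemma Ex_mono pr pr' f : isprob pr -> isprob pr' -> (forall t, pr t <= pr' t) ->
  incr f -> Ex pr f <= Ex pr' f.
Proof.
move=> prP prP' le_pr fi; rewrite !Ex_enum.
elim: (enum T) set0 => [//|t s IHs] A /=.
have le1 := IHs (t |: A); have le2 := IHs A.
have le3 := Eseq_incr s prP' fi (subsetUr [set t] A).
have /andP [p0 p1] := prP t; have le4 := le_pr t.
apply: (@le_trans _ _ (pr t * Eseq pr' s f (t |: A) + (1 - pr t) * Eseq pr' s f A)).
  by rewrite lerD // ler_wpM2l // subr_ge0.
move: (Eseq pr' s f _) (Eseq pr' s f _) le3 => x y xy.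
rewrite -subr_ge0.
have -> : pr' t * x + (1 - pr' t) * y - (pr t * x + (1 - pr t) * y) =
  (pr' t - pr t) * (x - y) by ring.
by rewrite mulr_ge0 ?subr_ge0.
Qed.

Lemma Eseq_linear pr s c d f g A :
  Eseq pr s (fun G => c * f G + d * g G) A = c * Eseq pr s f A + d * Eseq pr s g A.
Proof. by elim: s A => [//|t s IHs] A /=; rewrite !IHs; ring. Qed.

Lemma eq_Eseq pr s f g A : f =1 g -> Eseq pr s f A = Eseq pr s g A.
Proof. by move=> fg; elim: s A => [|t s IHs] A /=; rewrite ?IHs // fg. Qed.

Lemma Ex_union pr1 pr2 f :
  Ex pr1 (fun G1 => Ex pr2 (fun G2 => f (G1 :|: G2))) =
  Ex (fun t => 1 - (1 - pr1 t) * (1 - pr2 t)) f.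
Proof.
rewrite !Ex_enum.
have -> : Eseq pr1 (enum T) (fun G1 => Ex pr2 (fun G2 => f (G1 :|: G2))) set0 =
   Eseq pr1 (enum T) (fun G1 => Eseq pr2 (enum T) (fun G2 => f (G1 :|: G2)) set0) set0.
  by apply: eq_Eseq => G; rewrite Ex_enum.
have gen s A B :
  Eseq pr1 s (fun G1 => Eseq pr2 s (fun G2 => f (G1 :|: G2)) B) A =
  Eseq (fun t => 1 - (1 - pr1 t) * (1 - pr2 t)) s f (A :|: B).
  elim: s A B => [//|t s IHs] A B /=.
  rewrite !Eseq_linear !IHs.
  have -> : A :|: (t |: B) = t |: (A :|: B) by rewrite setUCA.
  have -> : t |: A :|: (t |: B) = t |: (A :|: B) by rewrite setUACA setUid.
  by rewrite -[t |: A :|: B]setUA; ring.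
by rewrite gen setU0.
Qed.

(** Given [Z \subset G], the elements outside [Z] keep their law, so [G] may be replaced by
    [G :|: Z]. This is how conditioning on present edges is expressed below. *)
Lemma Ex_subset pr Z g :
  Ex pr (fun G => (Z \subset G)%:R * g G) =
  (\prod_(t in Z) pr t) * Ex pr (fun G => g (G :|: Z)).
Proof.
have [k] := ubnP #|Z|; elim: k Z g => [//|k IHk] Z g /ltnSE leZ.
have [->|/set0Pn [t tZ]] := eqVneq Z set0.
  rewrite big_set0 mul1r; apply: eq_Ex => // G.
  by rewrite sub0set mul1r setU0.
pose Z' := Z :\ t.
have tZ' : t \notin Z' by rewrite !inE eqxx.
have ZE : Z = t |: Z' by rewrite setD1K.
have Z'k : (#|Z'| < k)%N by apply: leq_trans leZ; rewrite (cardsD1 t Z) tZ.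
have step h : Ex pr (fun G => (t \in G)%:R * h G) = pr t * Ex pr (fun G => h (t |: G)).
  rewrite (Ex_cond t) [Ex pr _ in RHS](Ex_cond t).
  have -> : Ex (pr_off t pr) (fun G => (t \in G)%:R * h G) = 0.
    rewrite /Ex big1 // => G _; case: (boolP (t \in G)) => tG; last by rewrite mul0r mulr0.
    by rewrite /bern (bigD1 t) //= tG /pr_off eqxx !mul0r.
  have -> : Ex (pr_off t pr) (fun G => h (t |: (t |: G))) =
            Ex (pr_off t pr) (fun G => h (t |: G)).
    by apply: eq_Ex => // G; rewrite setUA setUid.
  have -> : Ex (pr_off t pr) (fun G => (t \in t |: G)%:R * h (t |: G)) =
            Ex (pr_off t pr) (fun G => h (t |: G)).
    by apply: eq_Ex => // G; rewrite setU11 mul1r.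
  ring.
transitivity (Ex pr (fun G => (t \in G)%:R * ((Z' \subset G)%:R * g G))).
  by apply: eq_Ex => // G; rewrite {1}ZE subUset sub1set mulrA -natrM mulnb.
rewrite step.
transitivity (pr t * Ex pr (fun G => (Z' \subset G)%:R * g (t |: G))).
  congr (_ * _); apply: eq_Ex => // G; congr ((nat_of_bool _)%:R * _).
  apply/idP/idP => [/subsetP sub|sub]; last first.
    by apply: subset_trans sub (subsetU1 _ _).
  apply/subsetP => u uZ'; have := sub _ uZ'; rewrite in_setU1 => /orP [/eqP ut|//].
  by rewrite ut (negPf tZ') in uZ'.
rewrite IHk // [\prod_(t0 in Z) _](big_setD1 t) //= -/Z' mulrA; congr (_ * _).
by apply: eq_Ex => // G; rewrite setUCA -ZE.
Qed.
End BernoulliSets.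

(** * Sequential coupling of a random family with its union *)

Section Coupling.
Local Open Scope ring_scope.
Variables (R : realFieldType) (T I : finType).
Variables (pr : T -> R) (prP : isprob pr) (K : I -> {set T}).

Definition Kcup (Y : {set I}) : {set T} := \bigcup_(i in Y) K i.

(* Likelihood of a history: the indices in [Y] were accepted, and each other
   index [i] was rejected, an event of probability [1 - theta i] when all its
   edges are present and 1 otherwise ([theta i = 0] if [i] is still untested). *)
Definition hist (Y : {set I}) (theta : I -> R) (G : {set T}) : R :=
  (Kcup Y \subset G)%:R * \prod_i (1 - theta i * (K i \subset G)%:R).

Definition upd (theta : I -> R) j t : I -> R := fun i => if i == j then t else theta i.

Lemma Kcup_setU1 j Y : Kcup (j |: Y) = K j :|: Kcup Y.
Proof. by rewrite /Kcup bigcup_setU big_set1. Qed.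

Lemma hist_ge0 Y theta G : (forall i, 0 <= theta i <= 1 / 2) -> 0 <= hist Y theta G.
Proof.
move=> th; rewrite mulr_ge0 ?ler0n // prodr_ge0 // => i _.
have /andP [t0 t1] := th i.
by case: (K i \subset G) => /=; lra.
Qed.

Lemma hist_accept Y theta j G :
  hist (j |: Y) theta G = (K j \subset G)%:R * hist Y theta G.
Proof. by rewrite /hist Kcup_setU1 subUset -mulnb natrM mulrA. Qed.

Lemma hist_reject Y theta j t G : theta j = 0 ->
  hist Y (upd theta j t) G = (1 - t * (K j \subset G)%:R) * hist Y theta G.
Proof.
move=> thj; rewrite /hist (bigD1 j) //= [in RHS](bigD1 j) //= thj mul0r subr0 mul1r.
rewrite /upd eqxx mulrCA; congr (_ * (_ * _)).
by apply: eq_bigr => i /negPf ->.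
Qed.

(* The acceptance probability of [j], given its edges, is chosen along the way as
   [pi j * E[w] / E[w 1_(K j)]], where [w] is the likelihood of the past: the
   hypothesis says that it is at most 1/2. *)
Lemma coupling (Good : pred {set I}) (pi : I -> R) (F : {set T} -> R) :
  isprob pi ->
  (forall H H' : {set I}, H \subset H' -> Good H' -> Good H) ->
  (forall G, 0 <= F G) -> incr F ->
  (forall (Y : {set I}) (theta : I -> R) j, j \notin Y -> Good (j |: Y) -> 0 < pi j ->
    (forall i, 0 <= theta i <= 1 / 2) ->
    (forall i, i \in j |: Y -> theta i = 0) -> (forall i, pi i = 0 -> theta i = 0) ->
    2 * pi j * Ex pr (hist Y theta) <=
      Ex pr (fun G => (K j \subset G)%:R * hist Y theta G)) ->
  Ex pi (fun H => (Good H)%:R * F (Kcup H)) <= Ex pr F.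
Proof.
move=> piP Gdown F0 Fi key; rewrite Ex_enum.
pose V := fun s Y => Eseq pi s (fun H => (Good H)%:R * F (Kcup H)) Y.
(* The invariant compares integrals against the likelihood rather than conditional expectations, so
   a history of likelihood 0 satisfies it trivially. [V s Y] is the expected target once [Y] is
   accepted and [s] is still untested. *)
have gen : forall (s : seq I) (Y : {set I}) theta, uniq s -> (forall i, i \in s -> i \notin Y) ->
    (forall i, 0 <= theta i <= 1 / 2) -> (forall i, pi i = 0 -> theta i = 0) ->
    (forall i, (i \in s) || (i \in Y) -> theta i = 0) ->
    Ex pr (hist Y theta) * V s Y <= Ex pr (fun G => hist Y theta G * F G).
  elim=> [|j s IHs] Y theta.
    move=> _ _ th _ _; rewrite /V /= mulrC -Ex_scale; apply: le_Ex => // G.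
    rewrite mulrC /hist; case: (boolP (Kcup Y \subset G)) => [sub|_]; last by rewrite !mul0r.
    rewrite ler_wpM2l ?mul1r //; first by have := hist_ge0 Y G th; rewrite /hist sub mul1r.
    case: (Good Y); rewrite ?mul1r ?mul0r ?F0 //; exact: Fi.
  case/andP=> js us sY th th0 thY.
  have jY : j \notin Y by apply: sY; rewrite mem_head.
  have thj : theta j = 0 by apply: thY; rewrite mem_head.
  have /andP [pj0 pj1] := piP j.
  set w := hist Y theta; set w1 := hist (j |: Y) theta.
  have W0 : 0 <= Ex pr w by apply: Ex_ge0 => // G; apply: hist_ge0.
  have W10 : 0 <= Ex pr w1 by apply: Ex_ge0 => // G; apply: hist_ge0.
  have VE : V (j :: s) Y = pi j * V s (j |: Y) + (1 - pi j) * V s Y by [].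
  have IHrej t : 0 <= t <= 1 / 2 -> (pi j = 0 -> t = 0) ->
      Ex pr (hist Y (upd theta j t)) * V s Y <=
      Ex pr (fun G => hist Y (upd theta j t) G * F G).
    move=> t01 t0; apply: IHs => // i; rewrite /upd.
    - by move=> is_; apply: sY; rewrite inE is_ orbT.
    - by case: eqP.
    - by case: eqP => [-> //|_]; apply: th0.
    - case: eqVneq => [->|_]; first by rewrite (negPf js) (negPf jY).
      by case/orP => h; apply: thY; rewrite ?inE h ?orbT.
  have Vge0 Y' : 0 <= V s Y'.
    rewrite /V Eseq_sum //; apply: Ex_ge0; last by move=> G; rewrite mulr_ge0 ?ler0n.
    by move=> i; case: ifP => _; rewrite ?lexx ?ler01.
  have upd0 : forall G, hist Y (upd theta j 0) G = hist Y theta G.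
    by move=> G; rewrite hist_reject // mul0r subr0 mul1r.
  have skip : Ex pr w * V s Y <= Ex pr (fun G => w G * F G).
    have := IHrej 0; rewrite lexx divr_ge0 ?ler0n // => /(_ isT (fun=> erefl)).
    by rewrite (eq_Ex (frefl _) upd0) (eq_Ex (frefl _) (fun G => congr1 ( *%R^~ _) (upd0 G))).
  (* An index whose acceptance contributes nothing is left untested: the likelihood is unchanged and
     the target only drops by the factor [1 - pi j]. This covers [pi j = 0] and families that would
     stop being good. *)
  have skip1 : pi j * V s (j |: Y) = 0 -> Ex pr w * V (j :: s) Y <= Ex pr (fun G => w G * F G).
    move=> zero; apply: le_trans skip; rewrite ler_wpM2l // VE zero add0r.
    by rewrite ler_piMl ?Vge0 // lerBlDr lerDl.
  have [pi0|pi_n0] := eqVneq (pi j) 0; first by apply: skip1; rewrite pi0 mul0r.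
  have pi_gt0 : 0 < pi j by rewrite lt_neqAle eq_sym pi_n0.
  have [good|bad] := boolP (Good (j |: Y)); last first.
    apply: skip1; rewrite [V _ _](_ : _ = 0) ?mulr0 // /V Eseq_sum // /Ex big1 // => H _.
    rewrite [Good _](_ : _ = false) ?mul0r ?mulr0 //; apply: contraNF bad.
    by apply: Gdown; rewrite subsetUl.
  have le1 : 2 * pi j * Ex pr w <= Ex pr w1.
    rewrite [Ex pr w1](eq_Ex (frefl _) (hist_accept Y theta j)); apply: key => // i.
    rewrite in_setU1 => /orP [/eqP -> //|iY]; apply: thY; by rewrite iY orbT.
  have [w0|wn0] := eqVneq (Ex pr w) 0.
    by rewrite w0 mul0r Ex_ge0 // => G; rewrite mulr_ge0 ?hist_ge0.
  have Wp : 0 < Ex pr w by rewrite lt_neqAle eq_sym wn0.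
  have W1p : 0 < Ex pr w1 by apply: lt_le_trans le1; rewrite !mulr_gt0.
  pose t := pi j * Ex pr w / Ex pr w1.
  have t0 : 0 <= t by rewrite divr_ge0 ?mulr_ge0.
  have t1 : t <= 1 / 2 by rewrite ler_pdivrMr //; lra.
  have tE : t * Ex pr w1 = pi j * Ex pr w by rewrite divfK // gt_eqF.
  have acc : Ex pr w1 * V s (j |: Y) <= Ex pr (fun G => w1 G * F G).
    apply: IHs => // i.
    - move=> is_; rewrite in_setU1 negb_or sY ?inE ?is_ ?orbT // andbT.
      by apply: contraNneq js => <-.
    - case/orP => [is_|]; first by apply: thY; rewrite inE is_ orbT.
      by rewrite in_setU1 => /orP [/eqP -> //|iY]; apply: thY; rewrite iY orbT.
  have rej : Ex pr (hist Y (upd theta j t)) * V s Y <=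
      Ex pr (fun G => hist Y (upd theta j t) G * F G).
    by apply: IHrej; rewrite ?t0 // => p0; rewrite p0 eqxx in pi_n0.
  have rejE G : hist Y (upd theta j t) G = w G + - t * w1 G.
    by rewrite hist_reject // /w1 hist_accept -/w; ring.
  have rejFE G : hist Y (upd theta j t) G * F G = w G * F G + - t * (w1 G * F G).
    by rewrite rejE; ring.
  rewrite (eq_Ex (frefl _) rejE) (eq_Ex (frefl _) rejFE) !Ex_add !Ex_scale in rej.
  rewrite VE.
  (* [t] times the acceptance bound is added to the rejection bound: on the right the terms in [w1]
     cancel, on the left [t * Ex pr w1] is [pi j * Ex pr w]. *)
  have := ler_wpM2l t0 acc.
  have -> : t * (Ex pr w1 * V s (j |: Y)) = pi j * Ex pr w * V s (j |: Y).
    by rewrite mulrA tE.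
  move: rej.
  have -> : (Ex pr w + - t * Ex pr w1) * V s Y = (1 - pi j) * Ex pr w * V s Y.
    by rewrite mulNr tE; ring.
  have -> : Ex pr w * (pi j * V s (j |: Y) + (1 - pi j) * V s Y) =
    (1 - pi j) * Ex pr w * V s Y + pi j * Ex pr w * V s (j |: Y) by ring.
  lra.
have := gen (enum I) set0 (fun=> 0); rewrite enum_uniq => /(_ isT).
have h1 G : hist set0 (fun=> 0) G = 1.
  rewrite /hist /Kcup big_set0 sub0set mul1r big1 // => i _; by rewrite mul0r subr0.
rewrite (eq_Ex (frefl _) h1) Ex_const mul1r.
rewrite [Ex pr (fun G => hist _ _ G * _)](eq_Ex (g := F) (frefl _)); last first.
  by move=> G; rewrite h1 mul1r.
rewrite mul1r -/(V (enum I) set0); apply=> // i; first by rewrite inE.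
by rewrite lexx invr_ge0 ler0n.
Qed.

Lemma prod_reject_indep (X : {set T}) (theta : I -> R) (P : pred I) G :
  (forall i, P i -> theta i != 0 -> [disjoint K i & X]) ->
  \prod_(i | P i) (1 - theta i * (K i \subset G :|: X)%:R) =
  \prod_(i | P i) (1 - theta i * (K i \subset G)%:R).
Proof.
move=> dis; apply: eq_bigr => i Pi.
have [->|tn0] := eqVneq (theta i) 0; first by rewrite !mul0r.
congr (1 - _ * (nat_of_bool _)%:R); apply/idP/idP => [/subsetP sub|sub]; last first.
  by apply: subset_trans sub (subsetUl _ _).
apply/subsetP => e eK; have := sub _ eK; rewrite inE => /orP [//|eX].
by have := disjointFr (dis _ Pi tn0) eK; rewrite eX.
Qed.

(* Rejections by indices avoiding the new edges [K j :\: Kcup Y] are independent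
   of them; each of the at most [t] indices in [S0] costs a factor 2, and the
   others are handled by a union bound, using that conditioning on further edges
   only lowers the likelihood of the remaining rejections. *)
Lemma accept_lower (p : R) t (S0 Y : {set I}) (theta : I -> R) j :
  0 < p -> p <= 1 -> (forall i, forall e, e \in K i -> pr e = p) ->
  (forall i, 0 <= theta i <= 1 / 2) -> (#|S0| <= t)%N ->
  \sum_(i | [&& i \notin S0, theta i != 0 & ~~ [disjoint K i & K j :\: Kcup Y]])
     p ^+ #|K i :\: (Kcup Y :|: K j)| <= 1 ->
  p ^+ #|K j| / 2 ^+ t / 2 * Ex pr (hist Y theta) <=
  Ex pr (fun G => (K j \subset G)%:R * hist Y theta G).
Proof.
move=> p0 p1 prK th S0t Q1.
set X := K j :\: Kcup Y; set Rr := Kcup Y.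
pose touch i := (theta i != 0) && ~~ [disjoint K i & X].
pose f i (G : {set T}) : R := 1 - theta i * (K i \subset G)%:R.
have f01 i G : 0 <= f i G <= 1.
  have /andP [a b] := th i; rewrite /f.
  by case: (K i \subset G); rewrite /= ?mulr1 ?mulr0; lra.
pose g G := \prod_(i | ~~ touch i) f i G.
have g0 G : 0 <= g G by apply: prodr_ge0 => i _; case/andP: (f01 i G).
have gdecr G G' : g (G :|: G') <= g G.
  apply: ler_prod => i _; case/andP: (f01 i (G :|: G')) => -> _ /=.
  rewrite /f lerB // ler_wpM2l //; first by case/andP: (th i).
  rewrite ler_nat; case: (boolP (K i \subset G)) => // sub.
  by rewrite (subset_trans sub (subsetUl _ _)).
have gX G : g (G :|: X) = g G.
  apply: prod_reject_indep => i; rewrite /touch negb_and negbK.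
  by move=> /orP [/eqP ->|/negPn //]; rewrite eqxx.
have histE (G : {set T}) : hist Y theta G = (Rr \subset G)%:R * (\prod_(i | touch i) f i G * g G).
  by rewrite /hist (bigID touch).
pose N1b := [pred i | touch i & i \notin S0].
(* Each factor in [S0] is at least 1/2. For the others the product is at least 1 minus the sum, and
   every [theta] is at most 1/2. *)
have low (G : {set T}) : (1 - 1 / 2 * \sum_(i | N1b i) (K i \subset G)%:R) / 2 ^+ t <=
             \prod_(i | touch i) f i G.
  rewrite [leRHS](bigID [pred i | i \in S0]) /=.
  have lowA : (1 / 2) ^+ t <= \prod_(i | touch i && (i \in S0)) f i G.
    apply: (@le_trans _ _ (\prod_(i | touch i && (i \in S0)) (1 / 2))).
      rewrite prodr_const; apply: ler_wiXn2l; try lra.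
      apply: leq_trans S0t; apply: subset_leq_card; apply/subsetP => i.
      by rewrite unfold_in => /andP [].
    apply: ler_prod => i _; have /andP [a b] := th i; apply/andP; split; first lra.
    by rewrite /f; case: (K i \subset G); rewrite /= ?mulr1 ?mulr0; lra.
  have lowB : 1 - 1 / 2 * \sum_(i | N1b i) (K i \subset G)%:R <=
              \prod_(i | touch i && (i \notin S0)) f i G.
    rewrite big_distrr /=.
    suff : (1 - \sum_(i | N1b i) 1 / 2 * (K i \subset G)%:R <=
       \prod_(i | touch i && (i \notin S0)) f i G) &&
       (0 <= \prod_(i | touch i && (i \notin S0)) f i G <= 1) by case/andP.
    rewrite /N1b /=.
    elim/big_rec2: _ => [|i x y _ /andP [le1 /andP [y0 y1]]].
      by rewrite subr0 lexx ler01.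
    have /andP [a b] := th i; have /andP [c d] := f01 i G.
    rewrite mulr_ge0 // ?mulr_ile1 // !andbT /f.
    by case: (K i \subset G); rewrite /= ?mulr1 ?mulr0; nra.
  have p2 : 0 <= \prod_(i | touch i && (i \in S0)) f i G.
    by apply: prodr_ge0 => i _; case/andP: (f01 i G).
  have [neg|pos] := lerP (1 - 1 / 2 * (\sum_(i | N1b i) (K i \subset G)%:R)) (0 : R).
    apply: (@le_trans _ _ 0); first by rewrite pmulr_lle0 ?invr_gt0 ?exprn_gt0 ?ltr0n.
    rewrite mulr_ge0 // prodr_ge0 // => i _; by case/andP: (f01 i G).
  rewrite mulrC; apply: ler_pM => //; rewrite ?invr_ge0 ?exprn_ge0 //; first exact: ltW.
  by apply: le_trans lowA; rewrite mul1r exprVn.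
pose RX := Rr :|: X.
have RXE : RX = Rr :|: K j.
  by apply/setP => e; rewrite !inE; case: (e \in Rr).
have MX : Ex pr (fun G => (RX \subset G)%:R * g G) = p ^+ #|X| * Ex pr (fun G => (Rr \subset G)%:R * g G).
  transitivity (Ex pr (fun G => (X \subset G)%:R * ((Rr \subset G)%:R * g G))).
    by apply: eq_Ex => // G; rewrite subUset andbC -mulnb natrM mulrA.
  rewrite Ex_subset; congr (_ * _).
    rewrite (eq_bigr (fun=> p)) ?prodr_const // => e; rewrite inE => /andP [_]; exact: prK.
  apply: eq_Ex => // G; rewrite gX; congr ((nat_of_bool _)%:R * _).
  apply/idP/idP => [/subsetP sub|sub]; last by apply: subset_trans sub (subsetUl _ _).
  apply/subsetP => e eR; have := sub _ eR; rewrite !inE eR /=; by rewrite orbF.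
have MN i : Ex pr (fun G => (RX \subset G)%:R * ((K i \subset G)%:R * g G)) <=
    p ^+ #|K i :\: RX| * Ex pr (fun G => (RX \subset G)%:R * g G).
  have -> : Ex pr (fun G => (RX \subset G)%:R * ((K i \subset G)%:R * g G)) =
    Ex pr (fun G => (K i :\: RX \subset G)%:R * ((RX \subset G)%:R * g G)).
    apply: eq_Ex => // G; rewrite !mulrA -!natrM !mulnb; congr ((nat_of_bool _)%:R * _).
    apply/andP/andP => [] [s1 s2]; split=> //.
      by apply: subset_trans s2; rewrite subsetDl.
    apply/subsetP => e eK; have [eRX|neRX] := boolP (e \in RX).
      exact: (subsetP s2).
    by apply: (subsetP s1); rewrite inE neRX.
  rewrite Ex_subset.
  have -> : \prod_(e in K i :\: RX) pr e = p ^+ #|K i :\: RX|.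
    rewrite (eq_bigr (fun=> p)) ?prodr_const // => e; rewrite inE => /andP [_]; exact: prK.
  apply: ler_wpM2l; first by rewrite exprn_ge0 // ltW.
  apply: le_Ex => // G.
  have -> : (RX \subset G :|: (K i :\: RX)) = (RX \subset G).
    apply/idP/idP => [/subsetP sub|sub]; last by apply: subset_trans sub (subsetUl _ _).
    apply/subsetP => e eR; have := sub _ eR.
    by rewrite in_setU in_setD eR /= orbF.
  by rewrite ler_wpM2l.
set M := Ex pr (fun G => (RX \subset G)%:R * g G) in MN MX.
have M0 : 0 <= M by apply: Ex_ge0 => // G; rewrite mulr_ge0.
apply: (@le_trans _ _ (M / 2 ^+ t / 2)).
  rewrite MX.
  apply: (@le_trans _ _ (p ^+ #|K j| / 2 ^+ t / 2 * Ex pr (fun G => (Rr \subset G)%:R * g G))).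
    apply: ler_wpM2l; first by rewrite !divr_ge0 ?exprn_ge0 ?ler0n // ltW.
    apply: le_Ex => // G; rewrite histE ler_wpM2l // ler_piMl //.
    apply: (@le_trans _ _ (\prod_(i | touch i) 1)); last by rewrite big1.
    by apply: ler_prod => i _; apply: f01.
  have E0 : 0 <= Ex pr (fun G => (Rr \subset G)%:R * g G) by apply: Ex_ge0 => // G; rewrite mulr_ge0.
  have le_pow : p ^+ #|K j| <= p ^+ #|X|.
    by apply: ler_wiXn2l; rewrite ?(ltW p0) // subset_leq_card // subsetDl.
  have -> (x y z : R) : x * y / z / 2 = x / z / 2 * y by ring.
  rewrite ler_wpM2r // !ler_wpM2r ?invr_ge0 ?exprn_ge0 ?ler0n //.
have -> : Ex pr (fun G => (K j \subset G)%:R * hist Y theta G) =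
  Ex pr (fun G => (RX \subset G)%:R * (\prod_(i | touch i) f i G * g G)).
  apply: eq_Ex => // G; rewrite histE mulrA -natrM mulnb RXE subUset andbC.
  by [].
apply: (@le_trans _ _ (Ex pr (fun G => (2 ^+ t)^-1 * ((RX \subset G)%:R * g G +
   - (1 / 2) * \sum_(i | N1b i) (RX \subset G)%:R * ((K i \subset G)%:R * g G))))); last first.
  apply: le_Ex => // G.
  have := ler_wpM2r (g0 G) (low G).
  move=> /(ler_wpM2l (ler0n R (RX \subset G))); apply: le_trans.
  rewrite -big_distrr -big_distrl /=.
  by rewrite le_eqVlt; apply/orP; left; apply/eqP; ring.
rewrite Ex_scale Ex_add Ex_scale Ex_bigsum -/M.
(* The bound 1 on the sum of powers of [p] keeps the union bound below [M], so at least half of [M]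
   survives; this is the last factor 2 of the conclusion. *)
have sumle : \sum_(i | N1b i) Ex pr (fun G => (RX \subset G)%:R * ((K i \subset G)%:R * g G)) <= M.
  apply: (@le_trans _ _ (\sum_(i | N1b i) p ^+ #|K i :\: RX| * M)).
    by apply: ler_sum => i _.
  rewrite -big_distrl /= ler_piMl //; apply: le_trans Q1.
  rewrite le_eqVlt; apply/orP; left; apply/eqP; apply: eq_big => i.
    by rewrite /N1b /touch /= andbC.
  by rewrite RXE.
rewrite mulrAC mulrC ler_wpM2l ?invr_ge0 ?exprn_ge0 ?ler0n //.
lra.
Qed.
End Coupling.

(** * Triples and quadruples as cliques *)

Section Cliques.
Variable V : finType.
Implicit Types (S e j k l C : {set V}) (F H Y : {set {set V}}).

Definition cliq S : {set {set V}} := [set e : {set V} | (e \subset S) && (#|e| == 2)].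
Lemma in_cliq S e : (e \in cliq S) = (e \subset S) && (#|e| == 2).
Proof. by rewrite inE. Qed.

Definition span F : {set V} := \bigcup_(S in F) S.

(** The size 9 is that of the largest configuration examined: [j] and two witnesses for each of four
    closers. The rate of a set will be below n^(-d/3), so the subfamilies excluded here have small
    expected number. *)
Definition sparse (d : nat) H : bool :=
  [forall F : {set {set V}}, (F \subset H) && (0 < #|F| <= 9) ==> (d * #|F| < 3 * #|span F|)].
Definition low_degree (D : nat) H : bool :=
  [forall a : V, #|[set S in H | a \in S]| < D].
Definition goodH s d D H : bool :=
  [&& [forall S in H, #|S| == s], sparse d H & low_degree D H].

Lemma goodH_down s d D H H' : H \subset H' -> goodH s d D H' -> goodH s d D H.
Proof.
move=> sub /and3P [/forall_inP sz /forallP sp /forallP dg]; apply/and3P; split.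
- by apply/forall_inP => S SH; apply: sz; apply: (subsetP sub).
- apply/forallP => F; apply/implyP => /andP [FH F9].
  by apply: (implyP (sp F)); rewrite F9 (subset_trans FH sub).
- apply/forallP => a; apply: leq_ltn_trans (dg a).
  by apply: subset_leq_card; apply/subsetP => S; rewrite !inE => /andP [/(subsetP sub) -> ->].
Qed.

Definition missing (Rr : {set {set V}}) (e : {set V}) (c : V) : {set V} :=
  [set a in e | [set a; c] \notin Rr].

(** Vertices already joined to both ends of some new edge [e] of [j]. A rejected triple made of [e]
    and such a vertex is completed by [j] with no further edge, so it escapes the union bound and
    has to be counted. *)
Definition closers (Rr : {set {set V}}) j : {set V} :=
  [set c | (c \notin j) && [exists e in cliq j :\: Rr, missing Rr e c == set0]].

Lemma KcupP Y e : reflect (exists2 S, S \in Y & e \in cliq S) (e \in Kcup cliq Y).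
Proof. exact: bigcupP. Qed.

Lemma pair_cliq S a b : a != b -> ([set a; b] \in cliq S) = (a \in S) && (b \in S).
Proof. by move=> ab; rewrite inE subUset !sub1set cards2 ab eqxx andbT. Qed.

(** The edges from [c] to the two ends [a], [b] of the new edge come from accepted sets [k] and [l].
    If these coincided, they would already contain the edge. The two common vertices in the last
    bound are [b], which is in [j], and [c], which is in [k]. *)
Lemma closers_wit Y j c : c \in closers (Kcup cliq Y) j ->
  exists k l, [/\ k \in Y, l \in Y & k != l] /\
    [/\ c \in k, c \in l, ~~ [disjoint k & j], ~~ [disjoint l & j] & 2 <= #|l :&: (j :|: k)|].
Proof.
rewrite /closers inE => /andP [cj /exists_inP [e /setDP [ej eR] /eqP m0]].
move: (ej); rewrite in_cliq => /andP [esj /cards2P [a [b [ab eE]]]].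
have adj x : x \in e -> exists2 S, S \in Y & (x \in S) && (c \in S).
  move=> xe; have : [set x; c] \in Kcup cliq Y.
    apply: contraT => nR; have : x \in missing (Kcup cliq Y) e c by rewrite /missing inE xe.
    by rewrite m0 inE.
  case/KcupP => S SY; rewrite pair_cliq; first by move=> xcS; exists S.
  by apply: contraNneq cj => <-; apply: (subsetP esj).
have ae : a \in e by rewrite eE !inE eqxx.
have be : b \in e by rewrite eE !inE eqxx orbT.
have [k kY /andP [ak ck]] := adj a ae; have [l lY /andP [bl cl]] := adj b be.
exists k, l; split; first split=> //.
  apply: contraNneq eR => kl; apply/KcupP; exists k => //.
  by rewrite eE pair_cliq // ak kl bl.
split=> //; first by apply/pred0Pn; exists a; rewrite /= ak (subsetP esj).
  by apply/pred0Pn; exists b; rewrite /= bl (subsetP esj).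
have bc : b != c by apply: contraNneq cj => <-; apply: (subsetP esj).
have <- : #|[set b; c]| = 2 by rewrite cards2 bc.
apply: subset_leq_card; rewrite subUset !sub1set !inE bl cl ck orbT.
by rewrite (subsetP esj).
Qed.

Lemma sparseP d H F : sparse d H -> F \subset H -> 0 < #|F| -> #|F| <= 9 ->
  d * #|F| < 3 * #|span F|.
Proof. by move=> /forallP /(_ F) /implyP sp FH F0 F9; apply: sp; rewrite FH F0. Qed.

(** A closer would give three quadruples on at most 4 + 3 + 2 = 9 vertices, against 10 * 3 < 3 *
    9. *)
Lemma closers4 Y j D : j \notin Y -> goodH 4 10 D (j |: Y) ->
  closers (Kcup cliq Y) j = set0.
Proof.
move=> jY /and3P [/forall_inP sz sp _]; apply/eqP; apply: contraT => /set0Pn [c].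
case/closers_wit => k [l [[kY lY kl] [ck cl kj lj l2]]].
have sz4 S : S \in j |: Y -> #|S| = 4 by move=> /sz /eqP.
have jk : j != k by apply: contraNneq jY => ->.
have jl : j != l by apply: contraNneq jY => ->.
have : sparse 10 (j |: Y) := sp; move/sparseP => /(_ [set j; k; l]).
have F3 : #|[set j; k; l]| = 3.
  by rewrite setUC cardsU1 !inE negb_or !(eq_sym l) jl kl cards2 jk.
rewrite F3 !subUset !sub1set !inE eqxx kY lY !orbT => /(_ isT isT isT).
have -> : span [set j; k; l] = (j :|: k) :|: l.
  by rewrite /span !bigcup_setU !big_set1.
have jk1 : 0 < #|j :&: k|.
  by move: kj; rewrite disjoint_sym -setI_eq0 card_gt0.
have := cardsUI (j :|: k) l; have := cardsUI j k.
rewrite [(j :|: k) :&: l]setIC.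
have -> : #|j| = 4 by apply: sz4; exact: setU11.
have -> : #|k| = 4 by apply: sz4; exact: setU1r.
have -> : #|l| = 4 by apply: sz4; exact: setU1r.
by move: l2 jk1; clear; lia.
Qed.

Lemma card_bigcup_le (J : finType) (P : pred J) (B : J -> {set V}) :
  #|\bigcup_(i | P i) B i| <= \sum_(i | P i) #|B i|.
Proof.
elim/big_rec2: _ => [|i x U _ le]; first by rewrite cards0.
by apply: leq_trans (leq_card_setU _ _) _; rewrite leq_add2l.
Qed.

(** Four closers [C] with two witnesses each give f <= 8 triples [F']. Each of them meets [j] and
    has at most two vertices outside it, so with [I] the sum of the |S ∩ C| the span of [j |: F']
    has at most 7 + 2 f - I vertices. Sparsity demands 5 (f + 1) < 3 (7 + 2 f - I), that is 3 I < f
    + 16. But I >= f, as each triple meets [C], and I >= 8, as each closer lies in two triples. *)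
Lemma closers3 Y j D : j \notin Y -> goodH 3 5 D (j |: Y) ->
  #|closers (Kcup cliq Y) j| <= 3.
Proof.
move=> jY /and3P [/forall_inP sz sp _]; rewrite leqNgt; apply/negP => c4.
have sz3 S : S \in j |: Y -> #|S| = 3 by move=> /sz /eqP.
have [C CC C4] : exists2 C : {set V}, C \subset closers (Kcup cliq Y) j & #|C| = 4.
  have : 0 < #|[set C : {set V} | C \subset closers (Kcup cliq Y) j & #|C| == 4]|.
    by rewrite cards_draws bin_gt0.
  by rewrite card_gt0 => /set0Pn [C]; rewrite inE => /andP [CC /eqP]; exists C.
pose wit c (kl : {set V} * {set V}) := [&& kl.1 \in Y, kl.2 \in Y, kl.1 != kl.2,
  c \in kl.1, c \in kl.2, ~~ [disjoint kl.1 & j] & ~~ [disjoint kl.2 & j]].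
pose w c := odflt (set0, set0) [pick kl | wit c kl].
have wP c : c \in C -> wit c (w c).
  move=> /(subsetP CC) /closers_wit [k [l [[kY lY kl] [ck cl kj lj _]]]].
  rewrite /w; case: pickP => // /(_ (k, l)); rewrite /wit /=.
  by rewrite kY lY kl ck cl kj lj.
pose F' := [set (w c).1 | c in C] :|: [set (w c).2 | c in C].
have FP S : S \in F' -> [/\ S \in Y, 0 < #|S :&: C| & 0 < #|S :&: j|].
  rewrite !inE => /orP [] /imsetP [c cC ->]; case/and5P: (wP c cC) => kY lY _ ck /and3P [cl kj lj];
  by split=> //; rewrite card_gt0 ?setI_eq0 //; apply/pred0Pn; exists c; rewrite /= ?ck ?cl.
have jF : j \notin F' by apply: contraNN jY => /FP [].
have F8 : #|F'| <= 8.
  apply: leq_trans (leq_card_setU _ _) _; rewrite -[8]/(4 + 4) -C4.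
  by apply: leq_add; apply: leq_imset_card.
have Cj : C :&: j = set0.
  apply/eqP; rewrite -subset0; apply/subsetP => c; rewrite inE => /andP [cC].
  by have := subsetP CC _ cC; rewrite inE => /andP [/negPf ->].
have := sparseP (F := j |: F') sp.
rewrite cardsU1 jF /= !ltnS F8 => /(_ _ isT isT).
have -> : j |: F' \subset j |: Y.
  by apply: setUS; apply/subsetP => S /FP [].
move=> /(_ isT); apply/negP; rewrite -leqNgt.
pose W := \bigcup_(S in F') (S :\: (j :|: C)).
have spanle : #|span (j |: F')| <= 3 + 4 + \sum_(S in F') #|S :\: (j :|: C)|.
  have sub : span (j |: F') \subset (j :|: C) :|: W.
    rewrite /span bigcup_setU big_set1 -setUA subUset subsetUl /=.
    apply/bigcupsP => S SF; apply/subsetP => x xS.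
    rewrite setUA in_setU; case: (boolP (x \in j :|: C)) => //= xn.
    by apply/bigcupP; exists S => //; rewrite inE xn.
  apply: leq_trans (subset_leq_card sub) _.
  apply: leq_trans (leq_card_setU _ _) _; apply: leq_add; last exact: card_bigcup_le.
  by apply: leq_trans (leq_card_setU _ _) _; rewrite C4 sz3 ?setU11.
have each S : S \in F' -> #|S :\: (j :|: C)| + #|S :&: C| <= 2 /\ 0 < #|S :&: C|.
  move=> SF; have [SY SC Sj] := FP S SF; split=> //.
  have S3 : #|S| = 3 by apply: sz3; exact: setU1r.
  have := cardsID (j :|: C) S; rewrite setIUr.
  have := cardsUI (S :&: j) (S :&: C).
  have -> : S :&: j :&: (S :&: C) = set0 by rewrite setIACA [j :&: C]setIC Cj setI0.
  rewrite cards0; lia.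
pose I := \sum_(S in F') #|S :&: C|.
have I8 : 8 <= I.
  have -> : I = \sum_(c in C) #|[set S in F' | c \in S]|.
    rewrite /I (eq_bigr (fun S : {set V} => \sum_(c in C) (c \in S))); last first.
      by move=> S _; rewrite setIC -sum1_card -big_mkcondr /=; apply: eq_bigl => c; rewrite inE.
    rewrite exchange_big /=; apply: eq_bigr => c _.
    rewrite -sum1dep_card big_mkcondr /=; apply: eq_bigr => S _; by case: (c \in S).
  rewrite -[8]/(4 * 2) -C4 -sum_nat_const; apply: leq_sum => c cC.
  case/and5P: (wP c cC) => kY lY kl ck /and3P [cl kj lj].
  have <- : #|[set (w c).1; (w c).2]| = 2 by rewrite cards2 kl.
  apply: subset_leq_card; rewrite subUset !sub1set !inE ck cl !andbT.
  by apply/andP; split; apply/orP; [left|right]; apply: imset_f.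
have IT : #|F'| <= I by rewrite -sum1_card; apply: leq_sum => S /each [].
have I2 : \sum_(S in F') #|S :\: (j :|: C)| + I <= #|F'| * 2.
  by rewrite -sum_nat_const -big_split; apply: leq_sum => S /each [].
move: I8 IT I2 spanle; clearbody I; move: #|F'| #|span _| (\sum_(S in F') _) => x y z; lia.
Qed.
End Cliques.
Arguments cliq {V} S.

(** * Union bounds and product inequalities *)

Section SumBounds.
Local Open Scope ring_scope.
Variable R : realFieldType.

Lemma sum_le_cover (I J : finType) (P : pred I) (X : pred J) (Q : J -> pred I) (F : I -> R) :
  (forall i, 0 <= F i) -> (forall i, P i -> exists2 e, X e & Q e i) ->
  \sum_(i | P i) F i <= \sum_(e | X e) \sum_(i | P i && Q e i) F i.
Proof.
move=> F0 cov; rewrite (exchange_big_dep P) /=; last by move=> e i _ /andP [].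
apply: ler_sum => i Pi; have [e Xe Qei] := cov _ Pi.
by rewrite (bigD1 e) ?Xe ?Pi //= lerDl sumr_ge0.
Qed.

Lemma sum_le_inj (I J : finType) (P : pred I) (Q : pred J) (g : I -> J) (h : J -> R) :
  (forall x, 0 <= h x) -> (forall i, P i -> Q (g i)) ->
  (forall i i', P i -> P i' -> g i = g i' -> i = i') ->
  \sum_(i | P i) h (g i) <= \sum_(x | Q x) h x.
Proof.
move=> h0 PQ inj.
have -> : \sum_(i | P i) h (g i) = \sum_(x in [set g i | i in P]) h x.
  by rewrite big_imset // => i i' Pi Pi'; apply: inj.
rewrite big_mkcond [leRHS]big_mkcond; apply: ler_sum => x _.
case: ifP => [/imsetP [i Pi ->]|_]; first by rewrite PQ.
by case: ifP.
Qed.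

Lemma prod_1D_le (I : finType) (x : I -> R) :
  (forall c, 0 <= x c) -> \sum_c x c < 1 -> \prod_c (1 + x c) <= (1 - \sum_c x c)^-1.
Proof.
move=> x0.
suff : [/\ 0 <= \sum_c x c, 0 <= \prod_c (1 + x c) &
    (\sum_c x c < 1 -> \prod_c (1 + x c) * (1 - \sum_c x c) <= 1)].
  by move=> [_ _ le1] lt1; rewrite -div1r ler_pdivlMr ?subr_gt0 //; apply: le1.
elim/big_rec2: _ => [|c y z _ [y0 z0 IH]]; first by split=> // _; rewrite subr0 mulr1.
have xc := x0 c; split=> [||lt1]; rewrite ?addr_ge0 ?mulr_ge0 ?addr_ge0 ?ler01 //.
have le1 : z * (1 - y) <= 1 by apply: IH; lra.
apply: le_trans le1; rewrite -subr_ge0.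
have -> : z * (1 - y) - (1 + x c) * z * (1 - (x c + y)) = z * (x c * (x c + y)) by ring.
by rewrite !mulr_ge0 ?addr_ge0.
Qed.
End SumBounds.

(** * The probability of a clique given the past *)

Section CliqueKey.
Local Open Scope ring_scope.
Variables (R : realFieldType) (V : finType).
Implicit Types (e i j k C : {set V}) (Y : {set {set V}}).

Lemma card_cliq j : #|cliq j| = 'C(#|j|, 2).
Proof. by rewrite -cards_draws. Qed.

(** Different vertices outside [j] account for different missing edges: in [[set a; c]] the end [a]
    lies in [j] and [c] does not, so the edge determines both. *)
Lemma missing_le (Rr : {set {set V}}) e i j : e \subset i -> e \subset j ->
  (\sum_(c in i :\: j) #|missing Rr e c| <= #|cliq i :\: (Rr :|: cliq j)|)%N.
Proof.
move=> ei ej.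
pose P := [set x : V * V | (x.1 \in i :\: j) && (x.2 \in missing Rr e x.1)].
have -> : (\sum_(c in i :\: j) #|missing Rr e c| = #|P|)%N.
  rewrite -[RHS]sum1_card (eq_bigl (fun x => (x.1 \in i :\: j) && (x.2 \in missing Rr e x.1))).
    rewrite -(pair_big_dep _ (fun c a => a \in missing Rr e c) (fun _ _ => 1%N)) /=.
    by apply: eq_bigr => c _; rewrite sum1_card.
  by move=> x; rewrite inE.
rewrite -(card_in_imset (f := fun x : V * V => [set x.2; x.1])).
  apply: subset_leq_card; apply/subsetP => _ /imsetP [[c a] + ->] /=.
  rewrite inE /= => /andP [/setDP [ci cj]]; rewrite inE => /andP [ae nR].
  have ac : a != c by apply: contraNneq cj => <-; apply: (subsetP ej).
  by rewrite in_setD in_setU negb_or nR !pair_cliq // (negPf cj) andbF ci (subsetP ei).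
move=> [c a] [c' a']; rewrite !inE /= => /andP [/andP [cj _] /andP [ae _]].
move=> /andP [/andP [cj' _] /andP [ae' _]] E.
have aj := subsetP ej _ ae; have aj' := subsetP ej _ ae'.
have : c \in [set a'; c'] by rewrite -E !inE eqxx orbT.
have : a \in [set a'; c'] by rewrite -E !inE eqxx.
rewrite !inE => /orP [/eqP ->|/eqP ac']; last by rewrite -ac' aj in cj'.
by case/orP => [/eqP ca'|/eqP -> //]; rewrite ca' aj' in cj.
Qed.

(** A rejected clique [i] through a new edge [e] is determined by its trace on [j] beyond [e], at
    most 4 choices, and by its vertices outside [j], at least one since [theta j = 0]. An outer
    vertex that is no closer lacks at least one edge to [e], and lacks both unless it shares an
    accepted set with an end of [e]; low degree allows at most 8 D such exceptions. With weights x_c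
    of sum at most n p^2 + 8 D p <= 1/25, the cliques through [e] contribute at most 4 (prod (1 +
    x_c) - 1) <= 1/6, and there are at most six edges [e]. *)
Lemma hist_clique_lower (pr : {set V} -> R) (p : R) s d D Y j (theta : {set V} -> R) :
  isprob pr -> 0 < p -> p <= 1 -> (forall e, #|e| = 2 -> pr e = p) ->
  (s <= 4)%N -> j \notin Y -> goodH s d D (j |: Y) ->
  (s = 3 /\ (#|closers (Kcup cliq Y) j| <= 3)%N) \/ closers (Kcup cliq Y) j = set0 ->
  (forall i, 0 <= theta i <= 1 / 2) -> (forall i, theta i != 0 -> #|i| = s) -> theta j = 0 ->
  #|V|%:R * p ^+ 2 + 8 * D%:R * p <= 1 / 25 ->
  p ^+ 'C(s, 2) / 2 ^+ 9 / 2 * Ex pr (hist cliq Y theta) <=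
  Ex pr (fun G => (cliq j \subset G)%:R * hist cliq Y theta G).
Proof.
move=> prP p0 p1 prp s4 jY good clos th ths thj small.
have p0' := ltW p0.
set Rr := Kcup cliq Y in clos *.
case/and3P: (good) => /forall_inP sz _ /forallP deg.
have js : #|j| = s by apply/eqP/sz; rewrite setU11.
rewrite -js -card_cliq.
set X := cliq j :\: Rr; set C0 := closers Rr j in clos *.
pose S0 := [set i : {set V} | [&& #|i| == s, ~~ [disjoint i & C0] &
                                 [exists e in X, e \subset i]]].
have C0j c : c \in C0 -> c \notin j by rewrite inE => /andP [].
(* For triples, a member of [S0] is an edge of [j] together with a closer, 3 * 3 choices; for
   quadruples there is no closer. *)
have S09 : (#|S0| <= 9)%N.
  case: clos => [[s3 C03]|C00]; last first.
    rewrite [S0](_ : _ = set0) ?cards0 //; apply/setP => i.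
    by rewrite !inE C00 -setI_eq0 setI0 eqxx andbF.
  rewrite -[9%N]/(3 * 3)%N.
  have c3 : #|cliq j| = 3 by rewrite card_cliq js s3.
  apply: (@leq_trans #|setX C0 (cliq j)|); last first.
    by rewrite cardsX c3 leq_mul2r.
  apply: leq_trans (leq_imset_card (fun x : V * {set V} => x.1 |: x.2) _).
  apply: subset_leq_card; apply/subsetP => i; rewrite inE => /and3P [/eqP is_ /pred0Pn [c /andP [/= ci cC]]].
  case/exists_inP => e /setDP [ej _] ei.
  apply/imsetP; exists (c, e); first by rewrite inE /= cC ej.
  move: ej; rewrite in_cliq => /andP [ej /eqP e2] /=.
  have ce : c \notin e by apply: contra (C0j _ cC); apply: (subsetP ej).
  apply/esym/eqP; rewrite eqEcard subUset sub1set ci ei cardsU1 ce e2 is_ s3.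
  by [].
apply: (@accept_lower _ _ _ pr prP _ p 9 S0) => //.
  by move=> i e; rewrite in_cliq => /andP [_ /eqP]; apply: prp.
rewrite -/Rr -/X.
pose Pe e i := [&& #|i| == s, e \subset i, i != j & [disjoint i & C0]].
set P := (P in \sum_(i | P i) _).
have cov i : P i -> exists2 e, e \in X & Pe e i.
  move=> /and3P [iS ti /pred0Pn [e /andP [/= eK eX]]].
  have ei : e \subset i by move: eK; rewrite in_cliq => /andP [].
  have is_ := ths _ ti.
  exists e => //; rewrite /Pe is_ eqxx ei /=.
  apply/andP; split; first by apply: contraNneq ti => ->; rewrite thj.
  move: iS; rewrite inE is_ eqxx /= negb_and negbK => /orP [//|/exists_inP []].
  by exists e.
apply: le_trans (sum_le_cover _ cov) _; first by move=> i; rewrite exprn_ge0.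
have X6 : (#|X| <= 6)%N.
  apply: leq_trans (subset_leq_card (subsetDl _ _)) _; rewrite card_cliq js.
  have : (s \in [:: 0; 1; 2; 3; 4]%N) by rewrite !inE; lia.
  by rewrite !inE => /orP [/eqP ->//|/orP [/eqP ->//|/orP [/eqP ->//|/orP [/eqP ->//|/eqP -> //]]]].
suff each e : e \in X -> \sum_(i | P i && Pe e i) p ^+ #|cliq i :\: (Rr :|: cliq j)| <= 1 / 6.
  apply: (@le_trans _ _ (\sum_(e in X) (1 / 6))); [exact: ler_sum|rewrite sumr_const].
  have : (#|X|%:R : R) <= 6 by rewrite ler_nat.
  by rewrite -mulr_natl; lra.
move=> eX; have /setDP [ej eR] := eX.
move: (ej); rewrite in_cliq => /andP [esj /eqP e2].
pose x c : R := if (c \notin j) && (c \notin C0) then p ^+ #|missing Rr e c| else 0.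
have x0 c : 0 <= x c by rewrite /x; case: ifP => // _; rewrite exprn_ge0.
pose h (BC : {set V} * {set V}) := \prod_(c in BC.2) x c.
pose g i := ((i :&: j) :\: e, i :\: j).
apply: (@le_trans _ _ (\sum_(i | P i && Pe e i) h (g i))).
  apply: ler_sum => i /andP [_ /and4P [_ ei _ iC]].
  have -> : h (g i) = p ^+ (\sum_(c in i :\: j) #|missing Rr e c|).
    rewrite -prodrXr; apply: eq_bigr => c; rewrite inE => /andP [cj ci].
    by rewrite /x cj (disjointFr iC ci).
  by apply: ler_wiXn2l => //; apply: missing_le.
apply: (@le_trans _ _ (\sum_(BC | (BC.1 \in powerset (j :\: e)) && (BC.2 != set0)) h BC)).
  apply: sum_le_inj => [BC|i /andP [_ /and4P [/eqP is_ ei ij _]]|i i'].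
  - by apply: prodr_ge0.
  - rewrite inE setSD ?subsetIr //= -subset0 subDset setU0.
    by apply: contra ij => sub; rewrite eqEcard sub is_ js leqnn.
  - move=> /andP [_ /and4P [_ ei _ _]] /andP [_ /and4P [_ ei' _ _]] [E1 E2].
    apply/setP => c; have := congr1 (fun A : {set V} => c \in A) E1.
    have := congr1 (fun A : {set V} => c \in A) E2; rewrite !inE.
    have := subsetP esj c; have := subsetP ei c; have := subsetP ei' c.
    by case: (c \in e) (c \in j) (c \in i) (c \in i') => [] [] [] [] //= a b d';
       rewrite ?(a isT) ?(b isT) ?(d' isT) //; move: (a isT) (b isT).
rewrite -(pair_big_dep (fun B => B \in powerset (j :\: e)) (fun _ C => C != set0) (fun _ C => \prod_(c in C) x c)) /=.
rewrite sumr_const card_powerset.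
have je : (2 ^ #|j :\: e| <= 4)%N.
  rewrite -[4%N]/(2 ^ 2)%N leq_exp2l //; have := cardsID e j.
  by rewrite setIC (setIidPl esj) e2 js => E; rewrite -(leq_add2l 2) E.
pose A : {set V} := \bigcup_(S in Y | ~~ [disjoint S & e]) S.
(* Two ends of [e], fewer than [D] accepted sets at each, at most four vertices in a set. *)
have A8 : (#|A| <= 8 * D)%N.
  apply: leq_trans (card_bigcup_le _ _) _.
  apply: (@leq_trans (\sum_(S in Y | ~~ [disjoint S & e]) 4)%N).
    by apply: leq_sum => S /andP [SY _]; rewrite (eqP (sz _ (setU1r _ SY))).
  rewrite sum_nat_const.
  have -> : (8 * D = 2 * D * 4)%N by rewrite mulnAC.
  rewrite leq_mul2r /= -e2 -sum1_card.
  apply: (@leq_trans #|\bigcup_(a in e) [set S in j |: Y | a \in S]|).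
    apply: subset_leq_card; apply/subsetP => S /andP [SY /pred0Pn [a /andP [/= aS ae]]].
    by apply/bigcupP; exists a => //; rewrite !inE SY orbT.
  apply: leq_trans (card_bigcup_le _ _) _; rewrite big_distrl /=.
  by apply: leq_sum => a _; rewrite mul1n ltnW.
have xle c : x c <= p ^+ 2 + (c \in A)%:R * p.
  rewrite /x; case: ifP => [/andP [cj cC]|_]; last by rewrite addr_ge0 ?exprn_ge0 ?mulr_ge0.
  have m0 : missing Rr e c != set0.
    apply: contra cC => m0; rewrite inE cj; apply/exists_inP; by exists e.
  have msub : missing Rr e c \subset e by apply/subsetP => a; rewrite inE => /andP [].
  have [cA|cA] := boolP (c \in A).
    rewrite mul1r (@le_trans _ _ p) ?lerDr ?exprn_ge0 //.
    by rewrite -[leRHS]expr1; apply: ler_wiXn2l => //; rewrite card_gt0.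
  rewrite mul0r addr0 (_ : missing Rr e c = e) ?e2 //.
  apply/setP => a; rewrite inE andbC; case: (boolP (a \in e)) => ae; last by rewrite andbF.
  rewrite andbT; apply: contra cA => /KcupP [S SY].
  have ac : a != c by apply: contraNneq cj => <-; apply: (subsetP esj).
  rewrite pair_cliq // => /andP [aS cS]; apply/bigcupP; exists S => //.
  by rewrite SY; apply/pred0Pn; exists a; rewrite /= aS.
have xi : \sum_c x c <= 1 / 25.
  apply: le_trans small; apply: (@le_trans _ _ (\sum_c (p ^+ 2 + (c \in A)%:R * p))).
    by apply: ler_sum => c _; apply: xle.
  rewrite big_split /= sumr_const -big_distrl /= lerD //; first by rewrite mulr_natl.
  rewrite ler_wpM2r // -natr_sum -natrM ler_nat; apply: leq_trans A8.
  by rewrite -sum1_card [leqRHS]big_mkcond; apply: leq_sum => c _; case: (c \in A).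
have prod1 : \prod_c (1 + x c) - 1 <= 1 / 24.
  have lt1 : \sum_c x c < 1 by lra.
  have := prod_1D_le x0 lt1.
  have : (1 - \sum_c x c)^-1 <= 25 / 24.
    by rewrite -div1r ler_pdivrMr ?subr_gt0 //; lra.
  lra.
have -> : \sum_(C | C != set0) \prod_(c in C) x c = \prod_c (1 + x c) - 1.
  have -> : \prod_c (1 + x c) = \sum_(C : {set V}) \prod_(c in C) x c.
    rewrite (eq_bigr (fun c => x c + 1)); last by move=> c _; rewrite addrC.
    rewrite bigA_distr; apply: eq_bigr => C _; by rewrite -big_mkcond.
  by rewrite [in RHS](bigD1 set0) /= ?big_set0 1?addrC ?addrK // addrC addrK.
have p1' : 0 <= \prod_c (1 + x c) - 1.
  rewrite subr_ge0; elim/big_rec: _ => // c y _ y1.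
  by apply: (le_trans y1); rewrite ler_peMl ?lerDl // (le_trans ler01 y1).
apply: (@le_trans _ _ ((\prod_c (1 + x c) - 1) *+ 4)); first by rewrite ler_wpMn2l.
rewrite -mulr_natl; lra.
Qed.
End CliqueKey.

Lemma leq_expn2r m n k : m <= n -> m ^ k <= n ^ k.
Proof. by case: k => [//|k] mn; rewrite leq_exp2r. Qed.

Lemma ffact_leq_exp n k : n ^_ k <= n ^ k.
Proof.
elim: k n => [|k IHk] n //; rewrite ffactnS expnS leq_mul //.
by apply: leq_trans (IHk _) _; rewrite leq_expn2r ?leq_pred.
Qed.

Lemma bin_leq_exp n k : 'C(n, k) <= n ^ k.
Proof.
by apply: leq_trans (ffact_leq_exp n k); rewrite -bin_ffact leq_pmulr // fact_gt0.
Qed.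

Lemma exp_leq_ffact n k : (n - k) ^ k <= n ^_ k.
Proof.
elim: k n => [|k IHk] n //; rewrite ffactnS expnS leq_mul ?leq_subr //.
by apply: leq_trans (IHk n.-1); apply: leq_expn2r; lia.
Qed.

(** * Moment bounds for sparsity and degrees *)

Section FirstMoment.
Local Open Scope ring_scope.
Variables (R : realFieldType).

Lemma Ex_contains (I : finType) (pi : I -> R) (F : {set I}) :
  Ex pi (fun H => (F \subset H)%:R) = \prod_(i in F) pi i.
Proof.
rewrite (eq_Ex (pr' := pi) (g := fun H => (F \subset H)%:R * 1)) //.
  by rewrite Ex_subset Ex_const mulr1.
by move=> H; rewrite mulr1.
Qed.

Section Vertices.
Variables (V : finType) (pi : {set V} -> R) (q : R) (s : nat).
Hypotheses (piP : isprob pi) (q0 : 0 <= q)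
  (pi0 : forall S : {set V}, #|S| != s -> pi S = 0) (piq : forall S, pi S <= q).

Lemma prod_pi_le (F : {set {set V}}) :
  \prod_(S in F) pi S <= if [forall S in F, #|S| == s] then q ^+ #|F| else 0.
Proof.
case: ifP => [_|/negbT].
  rewrite -prodr_const; apply: ler_prod => S _; case/andP: (piP S) => -> _; exact: piq.
rewrite negb_forall => /existsP [S]; rewrite negb_imply => /andP [SF Ss].
by rewrite (bigD1 S) //= pi0 // mul0r.
Qed.

(** Markov's inequality for the number of 7-element stars at a vertex: the mean degree is at most
    sigma^2 and the threshold about sigma^3 / 2, so the sigma^6 vertices together cost 2^7 *
    sigma^(6 + 14 - 21) = 128 / sigma. Seven is the least order with a negative exponent. [D - 7]
    leaves room for bounding a falling factorial below by a power. *)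
Lemma low_degree_prob (sigma : R) (D : nat) : 1 <= sigma -> #|V|%:R = sigma ^+ 6 ->
  #|V|%:R ^+ s.-1 * q <= sigma ^+ 2 -> sigma ^+ 3 / 2 <= (D - 7)%:R -> (0 < s)%N ->
  Ex pi (fun H => (~~ low_degree D H)%:R) <= 128 / sigma.
Proof.
move=> s1 Vs qs Ds s0.
have sg0 : 0 < sigma by apply: lt_le_trans s1.
have D7 : 0 < (D - 7)%:R :> R by apply: lt_le_trans Ds; rewrite divr_gt0 ?exprn_gt0.
have CD0 : 0 < 'C(D, 7)%:R :> R.
  by rewrite ltr0n bin_gt0; rewrite ltr0n subn_gt0 in D7; apply: ltnW.
pose stars a := [set F : {set {set V}} | (#|F| == 7) && [forall S in F, a \in S]].
apply: (@le_trans _ _ (Ex pi (fun H => \sum_a ('C(D, 7)%:R^-1 * \sum_(F in stars a) (F \subset H)%:R)))).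
  apply: le_Ex => // H; rewrite /low_degree.
  have term0 a : 0 <= 'C(D, 7)%:R^-1 * \sum_(F in stars a) (F \subset H)%:R :> R.
    by rewrite mulr_ge0 ?invr_ge0 ?ler0n // sumr_ge0.
  case: forallP => [_|/forallP]; first by rewrite sumr_ge0.
  rewrite negb_forall => /existsP [a]; rewrite -leqNgt => dega.
  rewrite (bigD1 a) //=; apply: (@le_trans _ _ ('C(D, 7)%:R^-1 * \sum_(F in stars a) (F \subset H)%:R)); last first.
    by rewrite lerDl sumr_ge0.
  rewrite mulrC ler_pdivlMr // mul1r.
  have -> : \sum_(F in stars a) (F \subset H)%:R =
      #|[set F : {set {set V}} | F \subset [set S in H | a \in S] & #|F| == 7]|%:R :> R.
    rewrite -sum1_card natr_sum [RHS]big_mkcond [LHS]big_mkcond; apply: eq_bigr => F _.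
    have -> : (F \in [set F : {set {set V}} | F \subset [set S in H | a \in S] & #|F| == 7]) =
              (F \in stars a) && (F \subset H).
      rewrite !inE; apply/andP/andP => [[/subsetP sub F7]|[/andP [F7 /forall_inP Fa] /subsetP sub]].
        rewrite F7; split.
          by apply/forall_inP => S /sub; rewrite inE => /andP [].
        by apply/subsetP => S /sub; rewrite inE => /andP [].
      by split=> //; apply/subsetP => S SF; rewrite inE sub ?Fa.
    by case: (F \in stars a); case: (F \subset H).
  by rewrite ler_nat cards_draws leq_bin2l // ltnW.
rewrite Ex_bigsum.
pose M : nat := #|V| ^ s.-1.
suff each a : Ex pi (fun H => 'C(D, 7)%:R^-1 * \sum_(F in stars a) (F \subset H)%:R) <=
    128 / sigma ^+ 7.
  apply: le_trans (ler_sum _ (fun a _ => each a)) _.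
  rewrite sumr_const -[leLHS]mulr_natr [X in _ * X](_ : _ = sigma ^+ 6) //.
  rewrite le_eqVlt; apply/orP; left; apply/eqP; field.
  by rewrite gt_eqF.
rewrite Ex_scale Ex_bigsum.
under eq_bigr => F _ do rewrite Ex_contains.
have le1 : \sum_(F in stars a) \prod_(S in F) pi S <= 'C(M, 7)%:R * q ^+ 7.
  apply: (@le_trans _ _ (\sum_(F : {set {set V}} | (F \subset [set S : {set V} | (#|S| == s) && (a \in S)]) && (#|F| == 7)) q ^+ 7)).
    rewrite big_mkcond [leRHS]big_mkcond; apply: ler_sum => F _.
    rewrite inE; case: (boolP (#|F| == 7)) => [/eqP F7|_]; last by rewrite andbF.
    rewrite andbT /=; case: ifP => [/forall_inP Fa|_]; last by case: ifP; rewrite ?exprn_ge0.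
    apply: le_trans (prod_pi_le _) _; rewrite F7; case: ifP => [/forall_inP Fs|_]; last by case: ifP; rewrite ?exprn_ge0.
    rewrite ifT //; apply/subsetP => S SF; by rewrite inE Fs ?Fa.
  rewrite sumr_const -[leLHS]mulr_natl ler_wpM2r ?exprn_ge0 //.
  have -> : #|[pred F : {set {set V}} | (F \subset [set S : {set V} | (#|S| == s) && (a \in S)]) && (#|F| == 7)]| =
     'C(#|[set S : {set V} | (#|S| == s) && (a \in S)]|, 7).
    by rewrite -cards_draws; apply: eq_card => F; rewrite !inE.
  rewrite ler_nat leq_bin2l //.
  apply: leq_trans (bin_leq_exp #|V| s.-1).
  rewrite -cardsT -cards_draws.
  rewrite -(card_in_imset (f := fun S => S :\ a)); last first.
    move=> S S'; rewrite !inE => /andP [_ aS] /andP [_ aS'] E.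
    by rewrite -(setD1K aS) -(setD1K aS') E.
  apply: subset_leq_card; apply/subsetP => _ /imsetP [S + ->]; rewrite !inE subsetT /=.
  by move=> /andP [/eqP Ss aS]; have := cardsD1 a S; rewrite aS Ss => ->.
rewrite mulrC ler_pdivrMr //; apply: (le_trans le1).
have f7 : 0 < (7`!)%:R :> R by rewrite ltr0n fact_gt0.
rewrite -(ler_pM2r f7) mulrAC -natrM bin_ffact.
rewrite -[leRHS]mulrA -natrM bin_ffact.
apply: (@le_trans _ _ ((M ^ 7)%:R * q ^+ 7)).
  by rewrite ler_wpM2r ?exprn_ge0 // ler_nat ffact_leq_exp.
apply: (@le_trans _ _ ((sigma ^+ 2) ^+ 7)).
  have sg0' := ltW sg0; rewrite natrX -exprMn lerXn2r ?nnegrE ?mulr_ge0 ?exprn_ge0 //; by rewrite /M natrX.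
apply: (@le_trans _ _ (128 / sigma ^+ 7 * (sigma ^+ 3 / 2) ^+ 7)).
  rewrite le_eqVlt; apply/orP; left; apply/eqP; field.
  by rewrite gt_eqF.
have sg0' := ltW sg0; rewrite ler_wpM2l ?divr_ge0 ?exprn_ge0 //.
apply: (@le_trans _ _ ((D - 7) ^ 7)%:R); last by rewrite ler_nat exp_leq_ffact.
by rewrite natrX lerXn2r ?nnegrE ?divr_ge0 ?exprn_ge0.
Qed.
End Vertices.

(** Union bound over dense subfamilies F, grouped by their span W; [nu] is n^(1/3). From 3 |W| <= d
    |F| follows q^|F| <= (q nu^d)^|F| nu^(-3 |W|) <= eta n^(-|W|), which cancels the number of
    choices of W. There are at most 2^(2^w) families on w vertices, and w <= 3 d because |F| <= 9;
    hence a constant independent of [V]. *)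
Lemma sparse_prob (d : nat) : exists2 C : R, 0 <= C &
  forall (V : finType) (pi : {set V} -> R) (q nu eta : R),
  isprob pi -> 0 <= q -> (forall S, pi S <= q) ->
  1 <= nu -> #|V|%:R = nu ^+ 3 -> q * nu ^+ d <= eta -> eta <= 1 ->
  Ex pi (fun H => (~~ sparse d H)%:R) <= C * eta.
Proof.
exists (\sum_(w < (3 * d).+1) (2 ^+ (2 ^ w))); first by rewrite sumr_ge0 // => w _; rewrite exprn_ge0 ?ler0n.
move=> V pi q nu eta piP q0 piq nu1 Vnu qnu eta1.
have nu0 : 0 < nu by apply: lt_le_trans nu1.
have nu0' := ltW nu0.
have eta0 : 0 <= eta by apply: le_trans qnu; rewrite mulr_ge0 ?exprn_ge0.
pose dense (F : {set {set V}}) := [&& (0 < #|F|)%N, (#|F| <= 9)%N & (3 * #|span F| <= d * #|F|)%N].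
apply: (@le_trans _ _ (Ex pi (fun H => \sum_(F | dense F) (F \subset H)%:R))).
  apply: le_Ex => // H; rewrite /sparse.
  case: forallP => [_|/forallP]; first by rewrite sumr_ge0.
  rewrite negb_forall => /existsP [F]; rewrite negb_imply -leqNgt => /andP [/andP [FH /andP [F0 F9]] Fd].
  by rewrite (bigD1 F) /= ?FH ?lerDl ?sumr_ge0 // /dense F0 F9 Fd.
rewrite Ex_bigsum.
under eq_bigr => F _ do rewrite Ex_contains.
apply: (@le_trans _ _ (\sum_(F | dense F) q ^+ #|F|)).
  apply: ler_sum => F _; rewrite -prodr_const; apply: ler_prod => S _.
  by case/andP: (piP S) => -> _; exact: piq.
have cov F : dense F -> exists2 W : {set V}, (#|W| < (3 * d).+1)%N & span F == W.
  move=> /and3P [_ F9 Fd]; exists (span F) => //.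
  rewrite ltnS; have := leq_mul (leqnn d) F9; lia.
apply: (le_trans (sum_le_cover _ cov)); first by move=> F; rewrite exprn_ge0.
apply: (@le_trans _ _ (\sum_(W : {set V} | (#|W| < (3 * d).+1)%N) 2 ^+ (2 ^ #|W|) * eta / nu ^+ (3 * #|W|))).
  apply: ler_sum => W _.
  apply: (@le_trans _ _ (\sum_(F | dense F && (span F == W)) eta / nu ^+ (3 * #|W|))).
    apply: ler_sum => F /andP [/and3P [F0 F9 Fd] /eqP <-].
    rewrite ler_pdivlMr ?exprn_gt0 //.
    apply: (@le_trans _ _ (q ^+ #|F| * nu ^+ (d * #|F|))).
      by rewrite ler_wpM2l ?exprn_ge0 // ler_weXn2l.
    rewrite exprM -exprMn; apply: le_trans (_ : eta ^+ #|F| <= _).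
      by rewrite lerXn2r ?nnegrE // mulr_ge0 ?exprn_ge0.
    by rewrite -[leRHS]expr1 ler_wiXn2l.
  rewrite sumr_const -[leLHS]mulr_natl -mulrA ler_wpM2r ?divr_ge0 ?exprn_ge0 ?ler0n //.
  rewrite -natrX ler_nat.
  apply: (@leq_trans #|powerset (powerset W)|); last by rewrite !card_powerset.
  apply: subset_leq_card; apply/subsetP => F /andP [_ /eqP <-].
  rewrite inE; apply/subsetP => S SF; rewrite inE; exact: bigcup_sup.
rewrite big_distrl /=.
have covw (W : {set V}) : (#|W| < (3 * d).+1)%N -> exists2 w : 'I_(3 * d).+1, true & #|W| == w.
  by move=> lt; exists (Ordinal lt).
apply: (le_trans (sum_le_cover _ covw)).
  by move=> W; rewrite !mulr_ge0 ?invr_ge0 ?exprn_ge0 ?ler0n.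
apply: ler_sum => w _.
apply: (@le_trans _ _ (\sum_(W : {set V} | #|W| == w) 2 ^+ (2 ^ w) * eta / nu ^+ (3 * w))).
  rewrite big_mkcond [leRHS]big_mkcond; apply: ler_sum => W _.
  case: (boolP (#|W| == w)) => [/eqP ->|_]; last by rewrite andbF.
  by case: ifP => // _; rewrite !mulr_ge0 ?invr_ge0 ?exprn_ge0 ?ler0n.
rewrite sumr_const -[leLHS]mulr_natl.
have -> : #|[pred W : {set V} | #|W| == w]| = 'C(#|V|, w).
  by rewrite -cardsT -cards_draws; apply: eq_card => W; rewrite !inE subsetT.
rewrite mulrCA ler_piMr ?mulr_ge0 ?exprn_ge0 //.
rewrite ler_pdivrMr ?exprn_gt0 // mul1r exprM -Vnu -natrX ler_nat.
exact: bin_leq_exp.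
Qed.
End FirstMoment.

(** * Random triples or quadruples inside a binomial random graph *)

Section Embedding.
Local Open Scope ring_scope.
Variables (R : realFieldType).

(** Good families go through the coupling; as [F] is at most 1, the others cost no more than their
    probability. The constant 2048 = 2 * 2^9 * 2 collects the cap 1/2, the nine rejections that may
    be completed, and the half lost in the union bound. *)
Lemma clique_embedding (s d : nat) : ((s == 3) && (d == 5)) || ((s == 4) && (d == 10)) ->
  exists2 C : R, 0 <= C &
  forall (V : finType) (pi pr : {set V} -> R) (F : {set {set V}} -> R)
    (q p sigma eta : R) (D : nat),
  isprob pi -> (forall S : {set V}, #|S| != s -> pi S = 0) -> (forall S, pi S <= q) ->
  isprob pr -> (forall e : {set V}, #|e| = 2 -> pr e = p) -> p <= 1 ->
  2048 * q <= p ^+ 'C(s, 2) -> 0 <= p ->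
  1 <= sigma -> #|V|%:R = sigma ^+ 6 -> q * sigma ^+ (2 * d) <= eta -> eta <= 1 ->
  sigma ^+ 3 / 2 <= (D - 7)%:R -> D%:R <= 2 * sigma ^+ 3 ->
  sigma ^+ 3 * p <= 1 / 500 ->
  (forall G, 0 <= F G <= 1) -> incr F ->
  Ex pi (fun H => F (Kcup cliq H)) <= Ex pr F + (C * eta + 128 / sigma).
Proof.
move=> sd; have [C C0 Csp] := sparse_prob R d; exists C => //.
move=> V pi pr F q p sigma eta D piP pi0 piq prP prp p1 qp p0 s1 Vs qe e1 D1 D2 sp F01 Fi.
have sg0 : 0 < sigma by apply: lt_le_trans s1.
have q0 : 0 <= q by have := piq set0; apply: le_trans; case/andP: (piP set0).
have s34 : [/\ (0 < s)%N, (s <= 4)%N & (1 < s)%N].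
  by case/orP: sd => /andP [/eqP -> _].
have err0 : 0 <= C * eta + 128 / sigma.
  rewrite addr_ge0 ?divr_ge0 ?(ltW sg0) ?mulr_ge0 //.
  by apply: le_trans qe; rewrite mulr_ge0 // exprn_ge0 // ltW.
(* The conditional bound requires [0 < p]. For [p = 0] the rate [q] vanishes too, and the random
   family is empty. *)
have [p_eq0|pn0] := eqVneq p 0.
  have pis0 S : pi S = 0.
    apply/eqP; rewrite eq_le; case/andP: (piP S) => -> _; rewrite andbT.
    apply: le_trans (piq S) _; move: qp; rewrite p_eq0 expr0n.
    have -> : ('C(s, 2) == 0)%N = false by rewrite eqn0Ngt bin_gt0; case: s34 => _ _ ->.
    by rewrite /=; lra.
  rewrite Ex_0 // /Kcup big_set0 -[leLHS]addr0 lerD // -[leLHS](Ex_const pr).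
  by apply: le_Ex => // G; apply: Fi; rewrite sub0set.
have pgt0 : 0 < p by rewrite lt_neqAle eq_sym pn0.
pose Good := @goodH V s d D.
have main : Ex pi (fun H => (Good H)%:R * F (Kcup cliq H)) <= Ex pr F.
  apply: coupling => //.
  - by move=> H H' sub; apply: goodH_down.
  - by move=> G; case/andP: (F01 G).
  move=> Y theta j jY good pij th thY th0.
  have ths i : theta i != 0 -> #|i| = s.
    by move=> ti; apply/eqP; apply: contraNT ti => /pi0 /th0 ->.
  have clos : (s = 3 /\ (#|closers (Kcup cliq Y) j| <= 3)%N) \/ closers (Kcup cliq Y) j = set0.
    move: good; rewrite /Good; case/orP: sd => /andP [/eqP -> /eqP ->] good.
      by left; split=> //; apply: closers3 good.
    by right; apply: closers4 good.
  have small : #|V|%:R * p ^+ 2 + 8 * D%:R * p <= 1 / 25.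
    rewrite Vs.
    have -> : sigma ^+ 6 * p ^+ 2 = (sigma ^+ 3 * p) * (sigma ^+ 3 * p) by ring.
    have sp0 : 0 <= sigma ^+ 3 * p by rewrite mulr_ge0 // exprn_ge0 // ltW.
    have Dp : D%:R * p <= 2 * (sigma ^+ 3 * p) by rewrite mulrA ler_wpM2r.
    have : sigma ^+ 3 * p * (sigma ^+ 3 * p) <= 1 / 500 * (1 / 500) by rewrite ler_pM.
    rewrite -[8 * D%:R * p]mulrA; lra.
  have := hist_clique_lower prP pgt0 p1 prp _ jY good clos th ths (thY j (setU11 j Y)) small.
  case: s34 => _ -> _ /(_ isT); apply: le_trans.
  apply: ler_wpM2r; first by apply: Ex_ge0 => // G; apply: hist_ge0.
  have := piq j; move: qp; rewrite -!mulrA -invfM => qp pq.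
  have -> : 2 ^+ 9 * 2 = 1024 :> R by rewrite -exprSr -natrX.
  by lra.
apply: (@le_trans _ _ (Ex pi (fun H : {set {set V}} => (Good H)%:R * F (Kcup cliq H) +
  ((\sum_(S : {set V} | #|S| != s) ([set S] \subset H)%:R) +
   ((~~ sparse d H)%:R + (~~ low_degree D H)%:R))))).
  apply: le_Ex => // H; have /andP [F0 F1] := F01 (Kcup cliq H).
  have sum0 : 0 <= \sum_(S : {set V} | #|S| != s) ([set S] \subset H)%:R :> R by rewrite sumr_ge0.
  have [g|] := boolP (Good H); first by rewrite mul1r lerDl !addr_ge0.
  rewrite mul0r add0r /Good /goodH !negb_and => /orP [|].
    rewrite negb_forall => /existsP [S]; rewrite negb_imply => /andP [SH Ss].
    apply: (@le_trans _ _ (\sum_(S : {set V} | #|S| != s) ([set S] \subset H)%:R)).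
      rewrite (bigD1 S) //= sub1set SH; apply: (le_trans F1); rewrite lerDl sumr_ge0 //.
    by rewrite lerDl addr_ge0.
  by move=> /orP [] ->; apply: (le_trans F1); rewrite ?[1 + _]addrC addrA lerDr addr_ge0.
rewrite !Ex_add Ex_bigsum lerD //.
rewrite big1 ?add0r => [|S Ss]; last by rewrite Ex_contains big_set1 pi0.
have nuE k : sigma ^+ (2 * k) = (sigma ^+ 2) ^+ k by rewrite exprM.
have nu1 : 1 <= sigma ^+ 2 by rewrite exprn_ege1.
rewrite lerD //.
  apply: (Csp _ _ q (sigma ^+ 2) eta) => //; first by rewrite Vs -exprM.
  by rewrite -nuE.
apply: (low_degree_prob piP q0 pi0 piq s1 Vs) => //; last by case: s34.
(* The mean degree n^(s-1) q is at most sigma^2 because 6 (s - 1) <= 2 d + 2: 12 <= 12 for triples,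
   18 <= 22 for quadruples. *)
apply: (@le_trans _ _ (q * sigma ^+ (2 * d) * sigma ^+ 2)).
  rewrite Vs mulrC -mulrA ler_wpM2l // -exprM -exprD ler_weXn2l //.
  by case/orP: sd => /andP [/eqP -> /eqP ->].
by rewrite ler_piMl ?exprn_ge0 ?(ltW sg0) // (le_trans qe).
Qed.
End Embedding.

(** * Poisson approximation of the multinomial law *)

Section ImageMass.
Local Open Scope ring_scope.
Variables (R : realFieldType) (T : finType).

(** Uniqueness in Möbius inversion. It allows laws of images to be compared after summation over
    subsets, where the condition on the image becomes a plain power. *)
Lemma subset_sum_inj (D : {set T}) (g h : {set T} -> R) :
  (forall U : {set T}, U \subset D -> \sum_(S : {set T} | S \subset U) g S = \sum_(S : {set T} | S \subset U) h S) ->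
  forall U : {set T}, U \subset D -> g U = h U.
Proof.
move=> gh U; have [k] := ubnP #|U|; elim: k U => [//|k IHk] U /ltnSE leU UD.
have := gh U UD; rewrite (bigD1 U) //= [in RHS](bigD1 U) //=.
rewrite (eq_bigr h); first by move=> /addIr.
move=> S /andP [SU neq]; apply: IHk (subset_trans SU UD).
by apply: leq_trans leU; apply: proper_card; rewrite properEneq neq.
Qed.

Definition ffun_image k (f : {ffun 'I_k -> T}) : {set T} := [set f w | w : 'I_k].

Variable Q : T -> R.
(** When [Q] is a probability law, this is the probability that the set of values of k independent
    draws satisfies [B]. *)
Definition ffun_mass k (B : pred {set T}) : R :=
  \sum_(f : {ffun 'I_k -> T} | B (ffun_image f)) \prod_w Q (f w).

Lemma ffun_mass_subset k (U : {set T}) :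
  ffun_mass k (fun S => S \subset U) = (\sum_(t in U) Q t) ^+ k.
Proof.
rewrite -[in RHS](card_ord k) -prodr_const bigA_distr_big.
apply: eq_bigl => f; apply/subsetP/ffun_onP => [sub w|sub _ /imsetP [w _ ->]]; last exact: sub.
by apply: sub; apply: imset_f.
Qed.

Lemma sum_ffun_mass k (h : {set T} -> {set T}) (U : {set T}) :
  \sum_(S : {set T} | S \subset U) ffun_mass k (fun S' => h S' == S) =
  ffun_mass k (fun S' => h S' \subset U).
Proof.
rewrite /ffun_mass [RHS](partition_big (fun f => h (ffun_image f)) (fun S => S \subset U)) //=.
apply: eq_bigr => S SU; apply: eq_bigl => f.
by case: eqP => [->|]; rewrite ?SU ?andbF.
Qed.

Lemma sum_image_mass k (U : {set T}) :
  \sum_(S : {set T} | S \subset U) ffun_mass k (fun S' => S' == S) = (\sum_(t in U) Q t) ^+ k.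
Proof. by rewrite (sum_ffun_mass k id) ffun_mass_subset. Qed.

(** Here k counts the draws that differ from [t0]. Summed over the subsets of [U], the identity is
    the binomial theorem for (Q t0 + sum of Q over [U])^m, so no positions have to be chosen. *)
Lemma ffun_mass_binomial t0 m (S : {set T}) : t0 \notin S ->
  ffun_mass m (fun S' => S' :\ t0 == S) =
  \sum_(k < m.+1) (Q t0 ^+ (m - k) * ffun_mass k (fun S' => S' == S)) *+ 'C(m, k).
Proof.
move=> t0S; pose g S := ffun_mass m (fun S' => S' :\ t0 == S).
pose h S := \sum_(k < m.+1) (Q t0 ^+ (m - k) * ffun_mass k (fun S' => S' == S)) *+ 'C(m, k).
apply: (@subset_sum_inj (~: [set t0]) g h); last first.
  by apply/subsetP => t tS; rewrite !inE; apply: contraNneq t0S => <-.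
move=> U UD; have t0U : t0 \notin U by apply/negP => /(subsetP UD); rewrite !inE eqxx.
rewrite /g (sum_ffun_mass m (fun S' => S' :\ t0)).
have -> : ffun_mass m (fun S' => S' :\ t0 \subset U) = ffun_mass m (fun S' => S' \subset t0 |: U).
  by apply: eq_bigl => f; rewrite subDset.
rewrite ffun_mass_subset big_setU1 //= exprDn /h exchange_big /=.
apply: eq_bigr => k _; rewrite sumrMnl -big_distrr /=.
by rewrite sum_image_mass.
Qed.

Hypothesis Q0 : forall t, 0 <= Q t.
Lemma ffun_mass_ge0 k B : 0 <= ffun_mass k B.
Proof. by apply: sumr_ge0 => f _; apply: prodr_ge0. Qed.

Lemma ffun_mass_sum (t0 : T) m (B : {set T} -> R) :
  \sum_(f : {ffun 'I_m -> T}) B (ffun_image f :\ t0) * \prod_w Q (f w) =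
  \sum_(S : {set T}) B S * ffun_mass m (fun S' => S' :\ t0 == S).
Proof.
rewrite (partition_big (fun f => ffun_image f :\ t0) xpredT) //=.
apply: eq_bigr => S _; rewrite /ffun_mass big_distrr /=.
by apply: eq_bigr => f /eqP ->.
Qed.
End ImageMass.

(** * Binomial against Poisson point probabilities *)

Section PoissonRatio.
Local Open Scope ring_scope.
Arguments exp x%_ring_scope.
(* A cast to [R] would be parsed in [R_scope]. *)
Local Notation real := (Num.RealField.sort RbaseSymbolsImpl_R__canonical__Num_RealField).

Lemma exp_add (x y : real) : exp x * exp y = exp (x + y).
Proof. exact: expRD. Qed.

Lemma exp_ge1D (x : real) : 1 + x <= exp x.
Proof. by apply/RleP; apply: exp_ineq1_le. Qed.

Lemma expR_gt0 (x : real) : 0 < exp x.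
Proof. by apply/RltP; apply: exp_pos. Qed.

(** A substitute for Stirling's formula: passing from k to k + 1 multiplies the left side by e (1 -
    1/b)^b <= 1, where b = m - k. *)
Lemma falling_le_exp (m k : nat) : (k < m)%N ->
  (m ^_ k)%:R / m%:R ^+ k * exp k%:R * ((m - k)%:R / m%:R) ^+ (m - k).+1 <= 1 :> R.
Proof.
elim: k => [|k IHk] km.
  rewrite ffactn0 expr0 divr1 subn0 mul1r (expR0 : exp 0%:R = 1) mul1r divff ?expr1n //.
  by rewrite pnatr_eq0 -lt0n.
have {}IHk := IHk (ltnW km).
have [l lE] : exists l, (m - k = l.+2)%N by exists (m - k - 2)%N; lia.
have lE' : (m - k.+1 = l.+1)%N by lia.
have m0 : 0 < m%:R :> R by rewrite ltr0n; lia.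
have eS : exp k.+1%:R = exp k%:R * exp 1 by rewrite -natr1 exp_add.
rewrite lE in IHk; rewrite lE' ffactnSr lE natrM exprSr eS.
apply: le_trans IHk.
have key : exp 1 * (l.+1%:R) ^+ l.+2 <= l.+2%:R ^+ l.+2 :> R.
  have le1 : l.+1%:R / l.+2%:R <= exp (- l.+2%:R^-1) :> R.
    apply: le_trans (exp_ge1D _); rewrite -[l.+2%:R]natr1 ler_pdivrMr ?addr_gt0 //.
    by rewrite mulrBl mul1r mulVf ?gt_eqF ?addr_gt0 // addrK.
  have := lerXn2r l.+2 _ _ le1; rewrite !nnegrE divr_ge0 // ltW ?expR_gt0 // => /(_ isT isT).
  rewrite expRX -[(- _) *+ _]mulr_natr mulNr mulVf ?pnatr_eq0 // expr_div_n.
  rewrite ler_pdivrMr ?exprn_gt0 ?ltr0n //.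
  move=> /(ler_wpM2l (ltW (expR_gt0 1))); have E1 : exp 1 * exp (- 1) = 1 by rewrite exp_add addrN expR0.
  by rewrite [X in _ <= X -> _]mulrA E1 mul1r.
have [u0 e0] : 0 <= (m ^_ k)%:R / m%:R ^+ k :> R /\ 0 < exp k%:R by rewrite divr_ge0 ?exprn_ge0 ?expR_gt0.
move: u0 e0 key; rewrite -[l.+1]/(l.+1)%N.
set u := _ / m%:R ^+ k; set e := exp k%:R; set E := exp 1; set a := l.+1%:R; set b := l.+2%:R.
set M := m%:R in m0 *.
move=> u0 e0 key.
have -> : (m ^_ k)%:R * b / (M ^+ k * M) * (e * E) * (a / M) ^+ l.+2 =
  u * e * (E * a ^+ l.+2) * b / M ^+ l.+3.
  rewrite /u expr_div_n [M ^+ l.+3]exprSr; field.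
  by rewrite !expf_neq0 ?gt_eqF.
have -> : u * e * (b / M) ^+ l.+3 = u * e * b ^+ l.+2 * b / M ^+ l.+3.
  by rewrite expr_div_n [b ^+ l.+3]exprSr !mulrA.
rewrite !ler_wpM2r ?invr_ge0 ?exprn_ge0 ?ler0n // -mulrA -[leRHS]mulrA.
by rewrite ler_wpM2l // ler_wpM2l // ltW.
Qed.

(** The probability of k under the binomial law (m, x) divided by that under the Poisson law of mean
    m x. The powers of x have cancelled, so x = 0 is allowed. *)
Definition poisson_ratio (m : nat) (x : real) k : real :=
  (m ^_ k)%:R / m%:R ^+ k * (1 - x) ^+ (m - k) * exp (m%:R * x).

(** [falling_le_exp] bounds the falling factorial, and y <= exp (y - 1) at y = (1 - x) m / (m - k)
    bounds the power of 1 - x. The exponentials cancel and one factor m / (m - k) remains. *)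
Lemma poisson_ratio_le_lt m x k : 0 <= x < 1 -> (k < m)%N ->
  poisson_ratio m x k <= m%:R / (m - k)%:R.
Proof.
move=> /andP [x0 x1] km.
have m0 : 0 < m%:R :> R by rewrite ltr0n; lia.
have l0 : 0 < (m - k)%:R :> R by rewrite ltr0n; lia.
have := falling_le_exp km.
have [l lE] : exists l, (m - k)%N = l by exists (m - k)%N.
rewrite lE in l0 *.
have mE : m%:R = k%:R + l%:R :> R by rewrite -natrD -lE subnKC // ltnW.
set u := _ / m%:R ^+ k => ule.
have yb : ((1 - x) * m%:R / l%:R) ^+ l <= exp ((1 - x) * m%:R - l%:R).
  have le1 : (1 - x) * m%:R / l%:R <= exp ((1 - x) * m%:R / l%:R - 1).
    by apply: le_trans (exp_ge1D _); rewrite subrKC.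
  have -> : (1 - x) * m%:R - l%:R = ((1 - x) * m%:R / l%:R - 1) *+ l.
    by rewrite -[RHS]mulr_natr; field; rewrite gt_eqF.
  rewrite -expRX; apply: lerXn2r le1; rewrite nnegrE; last by rewrite ltW ?expR_gt0.
  by rewrite divr_ge0 ?mulr_ge0 ?subr_ge0 // ltW.
have u0 : 0 <= u by rewrite divr_ge0 ?exprn_ge0.
pose z := l%:R / m%:R : real.
have z0 : 0 < z by rewrite divr_gt0.
have -> : poisson_ratio m x k =
    (u * exp k%:R * z ^+ l.+1) * (((1 - x) * m%:R / l%:R) ^+ l * exp (m%:R * x - k%:R)) * (m%:R / l%:R).
  rewrite /poisson_ratio -/u lE -(exp_add (m%:R * x)).
  have ek : exp k%:R * exp (- k%:R) = 1 by rewrite exp_add subrr expR0.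
  have -> : (1 - x) * m%:R / l%:R = (1 - x) / z by rewrite /z; field; rewrite !gt_eqF.
  have -> : m%:R / l%:R = z^-1 by rewrite /z invf_div.
  transitivity (u * (1 - x) ^+ l * exp (m%:R * x) * (exp k%:R * exp (- k%:R))).
    by rewrite ek mulr1.
  clearbody z u; rewrite [((1 - x) / z) ^+ l]expr_div_n [z ^+ l.+1]exprSr; field.
  by rewrite expf_neq0 ?gt_eqF.
rewrite -[leRHS]mul1r ler_wpM2r ?divr_ge0 //.
have ex0 := fun y => ltW (expR_gt0 y).
have c0 : 0 <= (1 - x) * m%:R / l%:R by rewrite divr_ge0 // mulr_ge0 // subr_ge0 ltW.
apply: mulr_ile1 => //.
- by rewrite mulr_ge0 ?exprn_ge0 ?(ltW z0) // mulr_ge0.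
- by rewrite mulr_ge0 // exprn_ge0.
apply: le_trans (ler_wpM2r (ltW (expR_gt0 _)) yb) _.
rewrite exp_add.
have -> : (1 - x) * m%:R - l%:R + (m%:R * x - k%:R) = 0 by rewrite mE; ring.
by rewrite expR0.
Qed.

(* The ratio of the two laws increases up to k = m x and decreases afterwards, so its
   maximum is reached within distance 1 of the mean. *)
Lemma poisson_ratio_le m x k : 0 <= x -> (0 < m)%N -> x + m%:R^-1 < 1 -> (k <= m)%N ->
  poisson_ratio m x k <= (1 - x - m%:R^-1)^-1.
Proof.
move=> x0 m_gt0 x1 km.
have m0 : 0 < m%:R :> R by rewrite ltr0n.
have mi0 : 0 < m%:R^-1 :> R by rewrite invr_gt0.
have x1' : x < 1 by lra.
elim: k km => [|k IHk] km.
  apply: le_trans (poisson_ratio_le_lt _ _) _; rewrite ?x0 //.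
  by rewrite subn0 divff ?gt_eqF // invf_ge1; lra.
have [near|far] := lerP (k.+1%:R : real) (m%:R * x + 1).
  have near' : k.+1%:R / m%:R <= x + m%:R^-1 :> R.
    by rewrite ler_pdivrMr // mulrDl mulVf ?gt_eqF // mulrC.
  have km' : (k.+1 < m)%N.
    rewrite -(ltr_nat R); apply: le_lt_trans near _.
    by have := ltr_pM2l m0 (x + m%:R^-1) 1; rewrite x1 mulr1 mulrDr mulfV ?gt_eqF // => ->.
  have l0 : 0 < (m - k.+1)%:R :> R by rewrite ltr0n subn_gt0.
  apply: le_trans (poisson_ratio_le_lt _ _) _; rewrite ?x0 //.
  have -> : m%:R / (m - k.+1)%:R = (1 - k.+1%:R / m%:R)^-1 :> R.
    rewrite natrB //; rewrite natrB // in l0; field.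
    by rewrite !gt_eqF //=; move: l0; lra.
  rewrite lef_pV2 ?posrE; lra.
apply: le_trans (IHk (ltnW km)).
rewrite /poisson_ratio.
have -> : (m - k = (m - k.+1).+1)%N by lia.
rewrite ffactnSr natrM exprSr [(1 - x) ^+ _.+1]exprSr.
have y0 : 0 < 1 - x by lra.
have -> : (m ^_ k)%:R * (m - k)%:R / (m%:R ^+ k * m%:R) * (1 - x) ^+ (m - k.+1) * exp (m%:R * x) =
   (m ^_ k)%:R / m%:R ^+ k * (1 - x) ^+ (m - k.+1) * exp (m%:R * x) * ((m - k)%:R / m%:R).
  by field; rewrite expf_neq0 ?gt_eqF.
have -> : (m ^_ k)%:R / m%:R ^+ k * ((1 - x) ^+ (m - k.+1) * (1 - x)) * exp (m%:R * x) =
  (m ^_ k)%:R / m%:R ^+ k * (1 - x) ^+ (m - k.+1) * exp (m%:R * x) * (1 - x).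
  by ring.
rewrite ler_wpM2l ?mulr_ge0 ?invr_ge0 ?exprn_ge0 ?(ltW (expR_gt0 _)) ?(ltW y0) //.
rewrite ler_pdivrMr // natrB ?(ltnW km) // mulrBl mul1r.
move: far; rewrite -natr1; lra.
Qed.
End PoissonRatio.

(** * Independent presence of types *)

Section PoissonDomination.
Local Open Scope ring_scope.
Arguments exp x%_ring_scope.
Local Notation real := (Num.RealField.sort RbaseSymbolsImpl_R__canonical__Num_RealField).

Lemma exp_le1 (x : real) : x <= 0 -> exp x <= 1.
Proof.
move=> x0; have := exp_ge1D (- x) => le1.
have := ler_wpM2l (ltW (expR_gt0 x)) le1; rewrite exp_add subrr expR0.
by apply: le_trans; rewrite ler_peMr ?lerDl ?oppr_ge0 // ltW ?expR_gt0.
Qed.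

Lemma Un_cv_eq (u v : nat -> R) l : u =1 v -> Un_cv u l -> Un_cv v l.
Proof.
move=> uv cu eps e0; have [N HN] := cu eps e0.
by exists N => n Nn; rewrite -uv; apply: HN.
Qed.

Lemma Un_cv_const (c : R) : Un_cv (fun=> c) c.
Proof. by move=> eps e0; exists 0%N => n _; rewrite Rdist_eq. Qed.

Lemma Un_cv_sum (I : finType) (P : pred I) (F : nat -> I -> real) (l : I -> real) :
  (forall i, P i -> Un_cv (fun K => F K i) (l i)) ->
  Un_cv (fun K => \sum_(i | P i) F K i) (\sum_(i | P i) l i).
Proof.
move=> cF; elim: (index_enum I) => [|i r IHr].
  by rewrite big_nil; apply: Un_cv_eq (Un_cv_const _) => K; rewrite big_nil.
rewrite big_cons; case: (boolP (P i)) => Pi; last first.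
  by apply: Un_cv_eq IHr => K; rewrite big_cons (negPf Pi).
by apply: Un_cv_eq (CV_plus _ _ _ _ (cF i Pi) IHr) => K; rewrite big_cons Pi.
Qed.

Lemma fact_factorial n : Factorial.fact n = n`!.
Proof. by elim: n => [//|n IHn]; rewrite factS -IHn -multE. Qed.

Lemma Un_cv_exp (x : real) : Un_cv (fun K => \sum_(k < K.+1) x ^+ k / k`!%:R) (exp x).
Proof.
have := proj2_sig (exist_exp x); rewrite -/(exp x) /exp_in /infinite_sum -/(Un_cv _ _).
apply: Un_cv_eq => K; elim: K => [|K IHK].
  by rewrite big_ord1 /= fact0 invr1 mulr1 expr0 /= Rinv_1 Rmult_1_l.
rewrite big_ord_recr /= -IHK; congr (_ + _).
by rewrite RmultE RinvE INRE RpowE -fact_factorial mulrC exprS; exact: erefl.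
Qed.

Variables (T : finType) (Q : T -> real).
Hypothesis Q0 : forall t, 0 <= Q t.

Lemma sum_subset_prod (y : T -> real) (U : {set T}) :
  \sum_(S : {set T} | S \subset U) \prod_(t in S) y t = \prod_(t in U) (1 + y t).
Proof.
pose z t : real := if t \in U then y t else 0.
have -> : \prod_(t in U) (1 + y t) = \prod_t (z t + 1).
  rewrite big_mkcond; apply: eq_bigr => t _; rewrite /z.
  by case: ifP; rewrite ?add0r // addrC.
rewrite bigA_distr big_mkcond; apply: eq_bigr => S _; rewrite -big_mkcond /=.
case: (boolP (S \subset U)) => [/subsetP SU|/subsetPn [t tS tU]].
  by apply: eq_bigr => t /SU tU; rewrite /z tU.
by rewrite (bigD1 t) //= /z (negPf tU) mul0r.
Qed.

(** Without the factor exp (- mu), the probability that a Poisson (mu) number of draws, cut off at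
    K, has [U] as its set of values. *)
Definition poisson_partial (mu : real) K (U : {set T}) : real :=
  \sum_(k < K.+1) ffun_mass Q k (fun S => S == U) * mu ^+ k / k`!%:R.

Lemma exp_sum (U : {set T}) (y : T -> real) :
  \prod_(t in U) exp (y t) = exp (\sum_(t in U) y t).
Proof.
elim/big_rec2: _ => [|t a b _ ->]; first by rewrite expR0.
by rewrite exp_add.
Qed.

(* Summing over the subsets of [U] turns the law of the set of values into a
   power series, whence the limit by induction on [U]. *)
Lemma poisson_partial_cv mu (U : {set T}) :
  Un_cv (fun K => poisson_partial mu K U) (\prod_(t in U) (exp (mu * Q t) - 1)).
Proof.
have [k] := ubnP #|U|; elim: k U => [//|k IHk] U /ltnSE leU.
pose h (S : {set T}) := \prod_(t in S) (exp (mu * Q t) - 1).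
pose e := exp (mu * \sum_(t in U) Q t).
have hU : h U = e - \sum_(S : {set T} | (S \subset U) && (S != U)) h S.
  have := sum_subset_prod (fun t => exp (mu * Q t) - 1) U.
  rewrite (bigD1 U) //= -/(h U).
  have -> : \prod_(t in U) (1 + (exp (mu * Q t) - 1)) = e.
    by rewrite /e big_distrr -exp_sum; apply: eq_bigr => t _; rewrite subrKC.
  by move=> <-; rewrite addrK.
rewrite -/(h U) hU.
have ce : Un_cv (fun K => \sum_(S : {set T} | S \subset U) poisson_partial mu K S) e.
  apply: Un_cv_eq (Un_cv_exp (mu * \sum_(t in U) Q t)) => K.
  rewrite /poisson_partial exchange_big /=; apply: eq_bigr => i _.
  by rewrite -!big_distrl /= sum_image_mass exprMn mulrC [mu ^+ _ * _]mulrC mulrC.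
have cs : Un_cv (fun K => \sum_(S : {set T} | (S \subset U) && (S != U)) poisson_partial mu K S)
    (\sum_(S : {set T} | (S \subset U) && (S != U)) h S).
  apply: Un_cv_sum => S /andP [SU neq]; apply: IHk; apply: leq_trans leU.
  by apply: proper_card; rewrite properEneq neq.
apply: Un_cv_eq (CV_minus _ _ _ _ ce cs) => K.
by rewrite RminusE (bigD1 U) //= addrK.
Qed.

Lemma poisson_partial_le mu K (U : {set T}) : 0 <= mu ->
  poisson_partial mu K U <= \prod_(t in U) (exp (mu * Q t) - 1).
Proof.
move=> mu0; apply/RleP; apply: (growing_ineq _ _ _ (poisson_partial_cv mu U)) => k.
apply/RleP; rewrite /poisson_partial [leRHS]big_ord_recr /= lerDl.
by rewrite divr_ge0 ?mulr_ge0 ?exprn_ge0 ?ffun_mass_ge0.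
Qed.

(** Given the number k of draws other than [t0], the set of values has the same law in both models;
    only the law of k differs, by a ratio bounded through [poisson_ratio_le]. With a Poisson number
    of draws the multiplicities of the types are independent, whence the product law. *)
Lemma multinomial_le_poisson (t0 : T) m (x : real) (B : {set T} -> real) :
  \sum_t Q t = 1 -> Q t0 = 1 - x -> (0 < m)%N -> x + m%:R^-1 < 1 ->
  (forall S, 0 <= B S) ->
  \sum_(f : {ffun 'I_m -> T}) B (ffun_image f :\ t0) * \prod_w Q (f w) <=
  (1 - x - m%:R^-1)^-1 *
  Ex (fun t => if t == t0 then 0 else 1 - exp (- (m%:R * Q t))) B.
Proof.
move=> Q1 Qt0 m0 xm B0.
set c := (_)^-1; set pr := (fun t => if _ then _ else _).
rewrite ffun_mass_sum /Ex big_distrr /=; apply: ler_sum => S _.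
have x0 : 0 <= x.
  have : Q t0 <= 1 by rewrite -Q1 (bigD1 t0) //= lerDl sumr_ge0.
  by rewrite Qt0; lra.
have mi0 : 0 < m%:R^-1 :> real by rewrite invr_gt0 ltr0n.
have c0 : 0 <= c by rewrite invr_ge0; lra.
rewrite [B S * _]mulrC mulrA ler_wpM2r //.
case: (boolP (t0 \in S)) => tS.
  rewrite /ffun_mass big_pred0 => [|f]; last first.
    by apply/negP => /eqP SE; have := tS; rewrite -SE !inE eqxx.
  rewrite mulr_ge0 //; apply: bern_ge0 => t; rewrite /pr.
  case: ifP => _; first by rewrite lexx ler01.
  have e0 := ltW (expR_gt0 (- (m%:R * Q t))).
  have e1 : exp (- (m%:R * Q t)) <= 1.
    by apply: exp_le1; rewrite oppr_le0 mulr_ge0.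
  by rewrite subr_ge0 e1 gerBl.
rewrite ffun_mass_binomial // Qt0.
apply: (@le_trans _ _ (c * exp (- (m%:R * x)) * poisson_partial m%:R m S)).
  rewrite /poisson_partial big_distrr /=; apply: ler_sum => k _.
  have km : (k <= m)%N by rewrite -ltnS.
  have := poisson_ratio_le x0 m0 xm km; rewrite -/c /poisson_ratio => rle.
  set a := ffun_mass _ _ _.
  have a0 : 0 <= a by apply: ffun_mass_ge0.
  have E1 : exp (m%:R * x) * exp (- (m%:R * x)) = 1 by rewrite exp_add subrr expR0.
  have M0 : m%:R != 0 :> real by rewrite pnatr_eq0 -lt0n.
  have K0 : k`!%:R != 0 :> real by rewrite pnatr_eq0 -lt0n fact_gt0.
  have -> : (1 - x) ^+ (m - k) * a *+ 'C(m, k) =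
    ((m ^_ k)%:R / m%:R ^+ k * (1 - x) ^+ (m - k) * exp (m%:R * x)) *
    (exp (- (m%:R * x)) * (a * m%:R ^+ k / k`!%:R)).
    rewrite -bin_ffact natrM -mulr_natl.
    transitivity ('C(m, k)%:R * (1 - x) ^+ (m - k) * a * (exp (m%:R * x) * exp (- (m%:R * x)))).
      by rewrite E1 mulr1 mulrA.
    move: (exp _) (exp _) => u v; field.
    by rewrite K0 expf_neq0.
  rewrite -[leRHS]mulrA; apply: ler_wpM2r rle.
  by rewrite mulr_ge0 ?(ltW (expR_gt0 _)) // divr_ge0 // mulr_ge0 // exprn_ge0.
rewrite -mulrA ler_wpM2l //.
apply: le_trans (ler_wpM2l (ltW (expR_gt0 _)) (poisson_partial_le _ _ _)) _ => //.
(* The normalising factor splits over the types and turns exp (m Q t) - 1 into the probability of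
   presence 1 - exp (- m Q t). *)
have -> : exp (- (m%:R * x)) = \prod_(t | t != t0) exp (- (m%:R * Q t)).
  have -> : x = \sum_(t in ~: [set t0]) Q t.
    have := Q1; rewrite (bigD1 t0) //= Qt0.
    rewrite (eq_bigl (fun t => t \in ~: [set t0])); last by move=> t; rewrite !inE.
    by move=> h; lra.
  rewrite big_distrr -sumrN -exp_sum; apply: eq_bigl => t; by rewrite !inE.
rewrite /bern [leRHS](bigD1 t0) //= (negPf tS) /pr eqxx subr0 mul1r.
rewrite [\prod_(t in S) _](_ : _ = \prod_(t | t != t0) (if t \in S then exp (m%:R * Q t) - 1 else 1)).
  rewrite -big_split /=; apply: ler_prod => t tt0; rewrite (negPf tt0).
  have e0 := ltW (expR_gt0 (- (m%:R * Q t))).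
  case: ifP => _; last by rewrite mulr1 subKr lexx e0.
  have -> : exp (- (m%:R * Q t)) * (exp (m%:R * Q t) - 1) = 1 - exp (- (m%:R * Q t)).
    by rewrite mulrBr mulr1 exp_add addNr expR0.
  rewrite lexx andbT subr_ge0 exp_le1 // oppr_le0 mulr_ge0 //.
rewrite -big_mkcondr /=; apply: eq_bigl => t.
by case: eqP => // ->; rewrite (negPf tS).
Qed.
End PoissonDomination.

(** * The two graph models *)

Section GraphModels.
Local Open Scope ring_scope.
Arguments exp x%_ring_scope.
Arguments clamp01 x%_ring_scope.
Local Notation real := (Num.RealField.sort RbaseSymbolsImpl_R__canonical__Num_RealField).

Lemma RsumE (T : finType) (P : pred T) (F : T -> real) : Rsum P F = \sum_(x | P x) F x.
Proof. by []. Qed.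

Lemma clamp01E (p : real) : clamp01 p = Num.max 0 (Num.min 1 p).
Proof. by rewrite /clamp01 RmaxE RminE. Qed.

Lemma clamp01_bounds (p : real) : 0 <= clamp01 p <= 1.
Proof.
rewrite clamp01E; apply/andP; split; first by rewrite le_max lexx.
by rewrite ge_max ler01 ge_min lexx.
Qed.

Lemma clamp01_id (p : real) : 0 <= p <= 1 -> clamp01 p = p.
Proof. by move=> /andP [p0 p1]; rewrite clamp01E min_r // max_r. Qed.

Lemma clamp01_union (a b : real) : 0 <= a <= 1 -> 0 <= b <= 1 ->
  1 - (1 - a) * (1 - b) <= clamp01 (a + b).
Proof.
move=> /andP [a0 a1] /andP [b0 b1]; rewrite clamp01E le_max le_min.
have h1 : 0 <= (1 - a) * (1 - b) by rewrite mulr_ge0 // subr_ge0.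
have h2 : 0 <= a * b by rewrite mulr_ge0.
apply/orP; right; apply/andP; split; first lra.
by rewrite -subr_ge0; have -> : a + b - (1 - (1 - a) * (1 - b)) = a * b by ring.
Qed.

Lemma clamp01_mono (a b : real) : a <= b -> clamp01 a <= clamp01 b.
Proof. by move=> ab; rewrite !clamp01E le_max2 // le_min2. Qed.

Lemma prod_if_const (T : finType) (p : real) (S : {set T}) :
  \prod_t (if t \in S then p else 1 - p) = p ^+ #|S| * (1 - p) ^+ (#|T| - #|S|).
Proof.
rewrite (bigID (fun t => t \in S)) /=; congr (_ * _).
  by rewrite (eq_bigr (fun=> p)) ?prodr_const // => t ->.
rewrite (eq_bigr (fun=> 1 - p)); last by move=> t /negPf ->.
rewrite prodr_const; congr (_ ^+ _); rewrite -(cardC (mem S)) addKn.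
by apply: eq_card => t; rewrite !inE.
Qed.

Section OneGraph.
Variable n : nat.
Implicit Types (G H : graph n) (A : pred (graph n)).

Definition pairs : graph n := [set e : {set 'I_n} | #|e| == 2].

Definition edge_law (p : real) (e : {set 'I_n}) : real := if #|e| == 2 then p else 0.

Lemma simpleE G : simple G = (G \subset pairs).
Proof.
apply/forall_inP/subsetP => h e eG; first by rewrite inE h.
by have := h e eG; rewrite inE.
Qed.

Lemma card_pairs : #|pairs| = 'C(n, 2).
Proof.
rewrite -[in RHS](card_ord n) -cardsT -cards_draws.
by apply: eq_card => e; rewrite !inE subsetT.
Qed.

Lemma Ex_support (T : finType) (pr : T -> real) (f g : {set T} -> real) :
  (forall H : {set T}, (forall t, t \in H -> pr t != 0) -> f H = g H) -> Ex pr f = Ex pr g.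
Proof.
move=> fg; apply: eq_bigr => H _.
have [/forallP h|] := boolP [forall t, (t \in H) ==> (pr t != 0)].
  by rewrite fg // => t tH; have := h t; rewrite tH.
rewrite negb_forall => /existsP [t]; rewrite negb_imply negbK => /andP [tH /eqP p0].
by rewrite /bern (bigD1 t) //= tH p0 !mul0r.
Qed.

(** Sets that are not pairs get probability 0, so the graph is sampled among all families of vertex
    sets. Intersecting with [pairs n] ensures that [A] is evaluated on simple graphs only, where
    monotonicity is assumed. *)
Lemma prob_GnpE p A : prob_Gnp p A = Ex (edge_law (clamp01 p)) (fun G => (A (G :&: pairs))%:R).
Proof.
rewrite /prob_Gnp RsumE; set q := clamp01 p.
rewrite /Ex big_mkcond; apply: eq_bigr => G _; rewrite simpleE.
have [sub|] := boolP (G \subset pairs); last first.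
  case/subsetPn => e eG eP; rewrite /bern (bigD1 e) //= eG /edge_law.
  by move: eP; rewrite inE => /negPf ->; rewrite !mul0r.
rewrite (setIidPl sub) /=; case: (A G); rewrite ?mulr0 ?mulr1 //.
rewrite RmultE !RpowE /bern (bigID (fun e => e \in pairs)) /= [X in _ = _ * X]big1 ?mulr1; last first.
  move=> e eP; have eG : e \notin G by apply: contra eP; apply: (subsetP sub).
  by rewrite (negPf eG) /edge_law; move: eP; rewrite inE => /negPf ->; rewrite subr0.
rewrite (eq_bigr (fun e => if e \in G then q else 1 - q)); last first.
  by move=> e; rewrite /edge_law inE => ->.
rewrite (bigID (fun e => e \in G)) /=; congr (_ * _).
  rewrite (eq_bigr (fun=> q)) => [|e /andP [_ ->] //]; rewrite prodr_const; congr (_ ^+ _).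
  by rewrite -[in LHS](setIidPl sub); apply: eq_card => e; rewrite in_setI andbC.
rewrite (eq_bigr (fun=> 1 - q)) => [|e /andP [_ /negPf ->] //]; rewrite prodr_const; congr (_ ^+ _).
rewrite -card_pairs; have <- := cardsID G pairs.
by rewrite setIC (setIidPl sub) addKn; apply: eq_card => e; rewrite in_setD andbC.
Qed.

Definition object_weight (p : real) (S : {set 'I_n}) : real :=
  p ^+ #|S| * (1 - p) ^+ (n - #|S|).

Lemma cliq_set0 : cliq (set0 : {set 'I_n}) = set0.
Proof.
apply/setP => e; rewrite in_cliq subset0 inE.
by case: eqP => [->|//]; rewrite cards0.
Qed.

Lemma Kcup_simple (H : {set {set 'I_n}}) : Kcup cliq H \subset pairs.
Proof. by apply/bigcupsP => S _; apply/subsetP => e; rewrite in_cliq inE => /andP []. Qed.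

Lemma Kcup_D0 (H : {set {set 'I_n}}) : Kcup cliq (H :\ set0) = Kcup cliq H.
Proof.
apply/setP => e; apply/KcupP/KcupP => [] [S SH eS]; exists S => //.
  by move: SH; rewrite inE => /andP [].
rewrite !inE SH andbT; apply: contraTneq eS => ->.
by rewrite cliq_set0 inE.
Qed.

(** The incidence relation is transposed: each object receives its type, and types are independent.
    The empty type spans no edge; it is removed because it serves as the reference outcome [t0] of
    the Poisson comparison. *)
Lemma prob_GnmpE m p A : prob_Gnmp m p A =
  \sum_(f : {ffun 'I_m -> {set 'I_n}})
    (A (Kcup cliq (ffun_image f :\ set0)))%:R * \prod_w object_weight p (f w).
Proof.
rewrite /prob_Gnmp RsumE.
pose tr (f : {ffun 'I_m -> {set 'I_n}}) : {ffun 'I_n -> {set 'I_m}} :=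
  [ffun v => [set w | v \in f w]].
pose tr' (W : {ffun 'I_n -> {set 'I_m}}) : {ffun 'I_m -> {set 'I_n}} :=
  [ffun w => [set v | w \in W v]].
have trK : cancel tr tr'.
  by move=> f; apply/ffunP => w; apply/setP => v; rewrite !ffunE inE ffunE inE.
have tr'K : cancel tr' tr.
  by move=> f; apply/ffunP => w; apply/setP => v; rewrite !ffunE inE ffunE inE.
rewrite (reindex tr) /=; last by exists tr' => ? _; [apply: trK|apply: tr'K].
rewrite big_mkcond; apply: eq_bigr => f _.
have -> : int_graph (tr f) = Kcup cliq (ffun_image f :\ set0).
  rewrite Kcup_D0; apply/setP => e; rewrite inE; apply/idP/KcupP.
    case/existsP => u /existsP [v /and3P [uv /set0Pn [w]]].
    rewrite !ffunE !inE => /andP [uw vw] /eqP ->.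
    by exists (f w); rewrite ?imset_f // pair_cliq // uw.
  case=> _ /imsetP [w _ ->]; rewrite in_cliq => /andP [sub /cards2P [u [v [uv eE]]]].
  apply/existsP; exists u; apply/existsP; exists v; rewrite uv eE eqxx andbT /=.
  move: sub; rewrite eE subUset !sub1set => /andP [uw vw].
  by apply/set0Pn; exists w; rewrite !ffunE !inE uw.
case: (A _); rewrite ?mul0r // mul1r.
transitivity (\prod_v \prod_w (if v \in f w then p else 1 - p)).
  apply: eq_bigr => v _; rewrite RmultE !RpowE.
  transitivity (\prod_w (if w \in tr f v then p else 1 - p)).
    by rewrite prod_if_const card_ord.
  by apply: eq_bigr => w _; rewrite ffunE inE.
rewrite exchange_big; apply: eq_bigr => w _; by rewrite prod_if_const card_ord.
Qed.

End OneGraph.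
End GraphModels.

(** * Types sorted by size *)

Section Sandwich.
Local Open Scope ring_scope.
Arguments exp x%_ring_scope.
Arguments clamp01 x%_ring_scope.
Local Notation real := (Num.RealField.sort RbaseSymbolsImpl_R__canonical__Num_RealField).

Lemma prob_Gnp_predC n p (A : pred (graph n)) : prob_Gnp p (predC A) = 1 - prob_Gnp p A.
Proof.
rewrite !prob_GnpE /=; set pr := edge_law _.
transitivity (Ex pr (fun G => 1 + -1 * (A (G :&: pairs n))%:R)).
  by apply: eq_Ex => // G; case: (A _); rewrite /= ?mulr0 ?mulr1 ?subrr ?addr0.
by rewrite Ex_add Ex_const Ex_scale mulN1r.
Qed.

Lemma object_weightE n p (S : {set 'I_n}) : object_weight p S = bern (fun=> p) S.
Proof. by rewrite /bern prod_if_const card_ord. Qed.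

Lemma object_weight_sum n p : \sum_(S : {set 'I_n}) object_weight p S = 1.
Proof.
rewrite -(Ex_const (fun _ : 'I_n => p) 1); apply: eq_bigr => S _.
by rewrite object_weightE mulr1.
Qed.

Lemma prob_Gnmp_predC n m p (A : pred (graph n)) :
  prob_Gnmp m p (predC A) = 1 - prob_Gnmp m p A.
Proof.
rewrite !prob_GnmpE; apply/eqP; rewrite eq_sym subr_eq -big_split /=; apply/eqP.
have total : 1 = \sum_(f : {ffun 'I_m -> {set 'I_n}}) \prod_w object_weight p (f w).
  transitivity ((\sum_(S : {set 'I_n}) object_weight p S) ^+ m).
    by rewrite object_weight_sum expr1n.
  by rewrite -[in LHS](card_ord m) -prodr_const bigA_distr_bigA.
rewrite [LHS]total; apply: eq_bigr => f _.
by rewrite -mulrDl /=; case: (A _); rewrite /= ?add0r ?addr0 mul1r.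
Qed.

Section PoissonLaw.
Variables (n m : nat) (p : real).
Hypothesis p01 : 0 <= p <= 1.

Definition poisson_law (S : {set 'I_n}) : real :=
  if S == set0 then 0 else 1 - exp (- (m%:R * object_weight p S)).

Definition edge_prob : real := 1 - exp (- (m%:R * (p ^+ 2 * (1 - p) ^+ (n - 2)))).

Lemma object_weight_ge0 (S : {set 'I_n}) : 0 <= object_weight p S.
Proof. by case/andP: p01 => p0 p1; rewrite mulr_ge0 // exprn_ge0 // subr_ge0. Qed.

Lemma expN_bounds (x : real) : 0 <= x -> 0 <= 1 - exp (- x) <= 1.
Proof.
move=> x0; have := exp_le1 (_ : - x <= 0); rewrite oppr_le0 => /(_ x0) e1.
by rewrite subr_ge0 e1 gerBl ltW ?expR_gt0.
Qed.

Lemma poisson_law_isprob : isprob poisson_law.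
Proof.
move=> S; rewrite /poisson_law; case: ifP => _; first by rewrite lexx ler01.
by apply: expN_bounds; rewrite mulr_ge0 ?object_weight_ge0.
Qed.

Lemma edge_prob_bounds : 0 <= edge_prob <= 1.
Proof.
case/andP: p01 => p0 p1.
by apply: expN_bounds; rewrite !mulr_ge0 // exprn_ge0 // subr_ge0.
Qed.

Lemma poisson_law_le (S : {set 'I_n}) : poisson_law S <= m%:R * p ^+ #|S|.
Proof.
case/andP: p01 => p0 p1.
rewrite /poisson_law; case: ifP => _; first by rewrite mulr_ge0 // exprn_ge0.
apply: (@le_trans _ _ (m%:R * object_weight p S)).
  by rewrite lerBlDr -lerBlDl; apply: exp_ge1D.
rewrite ler_wpM2l // /object_weight ler_piMr ?exprn_ge0 // exprn_ile1 ?subr_ge0 //.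
by rewrite gerBl.
Qed.

Lemma poisson_law_pair (S : {set 'I_n}) : #|S| = 2 -> poisson_law S = edge_prob.
Proof.
move=> S2; rewrite /poisson_law /edge_prob /object_weight S2.
by have -> : (S == set0) = false by apply/negbTE; rewrite -card_gt0 S2.
Qed.

Lemma prob_Gnmp_le (A : pred (graph n)) : (0 < m)%N -> 0 < (1 - p) ^+ n - m%:R^-1 ->
  prob_Gnmp m p A <= ((1 - p) ^+ n - m%:R^-1)^-1 *
    Ex poisson_law (fun H => (A (Kcup cliq H))%:R).
Proof.
move=> m0 c0.
have := @multinomial_le_poisson _ (object_weight p) object_weight_ge0 set0 m (1 - (1 - p) ^+ n)
  (fun H => (A (Kcup cliq H))%:R) (object_weight_sum n p).
rewrite prob_GnmpE subKr; apply=> //; last by lra.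
by rewrite /object_weight cards0 expr0 mul1r subn0.
Qed.

Definition sized_law (P : pred nat) (S : {set 'I_n}) : real :=
  if P #|S| then poisson_law S else 0.

Lemma sized_law_isprob P : isprob (sized_law P).
Proof.
by move=> S; rewrite /sized_law; case: ifP => _; rewrite ?poisson_law_isprob // lexx ler01.
Qed.

Lemma sized_law_union (P1 P2 : pred nat) (f : {set {set 'I_n}} -> real) :
  (forall j, ~~ (P1 j && P2 j)) ->
  Ex (sized_law (predU P1 P2)) f =
  Ex (sized_law P1) (fun H1 => Ex (sized_law P2) (fun H2 => f (H1 :|: H2))).
Proof.
move=> dis; rewrite Ex_union; apply: eq_Ex => // S; rewrite /sized_law /=.
have := dis #|S|; case: (P1 _); case: (P2 _) => //= _; ring.
Qed.

Variables (phi : graph n -> real).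
Hypotheses (phi01 : forall G, 0 <= phi G <= 1) (phi_incr : incr phi).

Lemma Kcup_setU (H1 H2 : {set {set 'I_n}}) :
  Kcup cliq (H1 :|: H2) = Kcup cliq H1 :|: Kcup cliq H2.
Proof. exact: bigcup_setU. Qed.

Lemma Kcup_pairs (H : {set {set 'I_n}}) : H \subset pairs n -> Kcup cliq H = H.
Proof.
move=> /subsetP Hp; apply/setP => e; apply/KcupP/idP => [[S SH]|eH].
  have := Hp S SH; rewrite in_cliq inE => /eqP S2 /andP [eS /eqP e2].
  by rewrite (_ : e = S) //; apply/eqP; rewrite eqEcard eS S2 e2.
by exists e => //; rewrite in_cliq subxx; have := Hp e eH; rewrite inE.
Qed.

Lemma sized_law_pairs (f : graph n -> real) :
  Ex (sized_law (pred1 2)) (fun H => f (Kcup cliq H)) = Ex (edge_law edge_prob) f.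
Proof.
transitivity (Ex (sized_law (pred1 2)) f).
  apply: Ex_support => H hH; rewrite Kcup_pairs //; apply/subsetP => S /hH.
  by rewrite /sized_law [S \in _]inE /=; case: (_ == 2) => //; rewrite eqxx.
apply: eq_Ex => // S; rewrite /sized_law /edge_law /=.
by case: eqP => // S2; rewrite poisson_law_pair.
Qed.

Lemma sized_law_phi01 pr G : isprob pr -> 0 <= Ex pr (fun H => phi (G :|: Kcup cliq H)) <= 1.
Proof.
move=> prP; rewrite Ex_ge0 //=; last by move=> H; case/andP: (phi01 (G :|: Kcup cliq H)).
rewrite -[leRHS](Ex_const pr); apply: le_Ex => // H.
by case/andP: (phi01 (G :|: Kcup cliq H)).
Qed.

Lemma sized_law_phi_incr pr : isprob pr -> incr (fun G => Ex pr (fun H => phi (G :|: Kcup cliq H))).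
Proof. by move=> prP G G' sub; apply: le_Ex => // H; apply: phi_incr; apply: setSU. Qed.

Lemma Kcup_incr (f : graph n -> real) : incr f -> incr (fun H => f (Kcup cliq H)).
Proof. by move=> fi H H' sub; apply: fi; rewrite -(setUidPr sub) Kcup_setU subsetUl. Qed.

Lemma edge_law_isprob q : 0 <= q <= 1 -> isprob (edge_law q : {set 'I_n} -> real).
Proof. by move=> q01 e; rewrite /edge_law; case: ifP => _ //; rewrite lexx ler01. Qed.

Lemma poisson_ge_pairs : Ex (edge_law edge_prob) phi <= Ex poisson_law (fun H => phi (Kcup cliq H)).
Proof.
rewrite -sized_law_pairs; apply: Ex_mono; last exact: Kcup_incr.
- exact: sized_law_isprob.
- exact: poisson_law_isprob.
move=> S; rewrite /sized_law; case: ifP => // _; by case/andP: (poisson_law_isprob S).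
Qed.

Lemma large_objects k :
  \sum_(S : {set 'I_n} | (k <= #|S|)%N) poisson_law S <= m%:R * (n%:R * p) ^+ k.
Proof.
case/andP: (p01) => p0 p1.
apply: (@le_trans _ _ (\sum_(S : {set 'I_n} | (k <= #|S|)%N) m%:R * object_weight p S)).
  apply: ler_sum => S _; rewrite /poisson_law; case: ifP => _.
    by rewrite mulr_ge0 ?object_weight_ge0.
  by rewrite lerBlDr -lerBlDl; apply: exp_ge1D.
rewrite -big_distrr /= ler_wpM2l //.
apply: (@le_trans _ _ (Ex (fun _ : 'I_n => p) (fun S => \sum_(F : {set 'I_n} | #|F| == k) (F \subset S)%:R))).
  rewrite /Ex big_mkcond /=; apply: ler_sum => S _; rewrite -object_weightE.
  case: ifP => kS; last by rewrite mulr_ge0 ?object_weight_ge0 // sumr_ge0.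
  rewrite ler_peMr ?object_weight_ge0 //.
  have : (0 < #|[set F : {set 'I_n} | F \subset S & #|F| == k]|)%N by rewrite cards_draws bin_gt0.
  rewrite card_gt0 => /set0Pn [F]; rewrite inE => /andP [FS Fk].
  by rewrite (bigD1 F) //= FS lerDl sumr_ge0.
rewrite Ex_bigsum; under eq_bigr => F /eqP Fk do rewrite Ex_contains prodr_const Fk.
rewrite sumr_const -[leLHS]mulr_natl exprMn ler_wpM2r ?exprn_ge0 // -natrX ler_nat.
have -> : #|[pred F : {set 'I_n} | #|F| == k]| = 'C(n, k).
  by rewrite -[in RHS](card_ord n) -cardsT -cards_draws; apply: eq_card => F; rewrite !inE subsetT.
exact: bin_leq_exp.
Qed.

Lemma cliq_small (S : {set 'I_n}) : (#|S| < 2)%N -> cliq S = set0.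
Proof.
move=> S2; apply/setP => e; rewrite in_cliq inE; apply/negP => /andP [/subset_leq_card eS /eqP e2].
by move: eS; rewrite e2 leqNgt S2.
Qed.

(** Types of size at most 1 span no edge, and the expected number of types of size at least k is at
    most m (n p)^k. *)
Lemma poisson_le_small k : (2 <= k)%N ->
  Ex poisson_law (fun H => phi (Kcup cliq H)) <=
  Ex (sized_law (fun j => 1 < j < k)%N) (fun H => phi (Kcup cliq H)) + m%:R * (n%:R * p) ^+ k.
Proof.
move=> k2; set P2 : pred nat := fun j => (1 < j < k)%N.
have -> : Ex poisson_law (fun H => phi (Kcup cliq H)) =
   Ex (sized_law (predU (predC P2) P2)) (fun H => phi (Kcup cliq H)).
  by apply: eq_Ex => // S; rewrite /sized_law /= orNb.
rewrite sized_law_union; last by move=> j /=; rewrite andNb.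
set M := Ex (sized_law P2) _.
apply: (@le_trans _ _ (Ex (sized_law (predC P2))
    (fun H => M + \sum_(S : {set 'I_n} | (1 < #|S|)%N) ([set S] \subset H)%:R))).
  apply: le_Ex => [|H1]; first exact: sized_law_isprob.
  have [/existsP [S /andP [SH S2]]|] := boolP [exists S : {set 'I_n}, (S \in H1) && (1 < #|S|)%N].
    rewrite (bigD1 S) //= sub1set SH.
    apply: (@le_trans _ _ 1); last first.
      rewrite addrCA lerDl; apply: addr_ge0; last by apply: sumr_ge0.
      apply: Ex_ge0 => [|H]; first exact: sized_law_isprob.
      by case/andP: (phi01 (Kcup cliq H)).
    rewrite -[leRHS](Ex_const (sized_law P2)); apply: le_Ex => [|H2]; first exact: sized_law_isprob.
    by case/andP: (phi01 (Kcup cliq (H1 :|: H2))).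
  rewrite negb_exists => /forallP noS.
  have -> : Ex (sized_law P2) (fun H2 => phi (Kcup cliq (H1 :|: H2))) = M.
    apply: eq_Ex => // H2; rewrite Kcup_setU [Kcup cliq H1](_ : _ = set0) ?set0U //.
    apply: big1 => S SH; apply: cliq_small; have := noS S; by rewrite SH /= -leqNgt ltnS.
  by rewrite lerDl sumr_ge0.
rewrite Ex_add Ex_const lerD2l Ex_bigsum.
apply: le_trans (large_objects k); rewrite big_mkcond [leRHS]big_mkcond /=; apply: ler_sum => S _.
have := poisson_law_isprob S => /andP [ps0 _].
case: ifP => S2; last by case: ifP.
rewrite Ex_contains big_set1 /sized_law /P2 /= S2 /= -leqNgt.
by case: ifP.
Qed.

Lemma edge_law_union (a b : real) (f : graph n -> real) : 0 <= a <= 1 -> 0 <= b <= 1 -> incr f ->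
  Ex (edge_law a) (fun G1 => Ex (edge_law b) (fun G2 => f (G1 :|: G2))) <=
  Ex (edge_law (clamp01 (a + b))) f.
Proof.
move=> a01 b01 fi; rewrite Ex_union; apply: Ex_mono => //.
- move=> e; rewrite /edge_law; case: ifP => _; last by rewrite subr0 mulr1 subrr lexx ler01.
  case/andP: a01 => a0 a1; case/andP: b01 => b0 b1.
  have h : 0 <= (1 - a) * (1 - b) by rewrite mulr_ge0 // subr_ge0.
  by rewrite gerBl h andbT subr_ge0 mulr_ile1 ?subr_ge0 // gerBl.
- by apply: edge_law_isprob; apply: clamp01_bounds.
move=> e; rewrite /edge_law; case: ifP => _; last by rewrite subr0 mulr1 subrr.
exact: clamp01_union.
Qed.
End PoissonLaw.
End Sandwich.

(** * Replacing triples and quadruples by extra edges *)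

Section UpperBound.
Local Open Scope ring_scope.
Arguments exp x%_ring_scope.
Arguments clamp01 x%_ring_scope.
Local Notation real := (Num.RealField.sort RbaseSymbolsImpl_R__canonical__Num_RealField).

Definition scale n (sigma : real) (D : nat) : Prop :=
  [/\ 1 <= sigma, n%:R = sigma ^+ 6, sigma ^+ 3 / 2 <= (D - 7)%:R & D%:R <= 2 * sigma ^+ 3].

Definition embeds (s d : nat) (q p sigma eta : real) : Prop :=
  [/\ 0 <= p, 2048 * q <= p ^+ 'C(s, 2), q * sigma ^+ (2 * d) <= eta & sigma ^+ 3 * p <= 1 / 500].

Lemma embeds_le1 s d q p sigma eta n D : scale n sigma D -> embeds s d q p sigma eta -> 0 <= p <= 1.
Proof.
move=> [s1 _ _ _] [p0 _ _ sp]; rewrite p0 /=.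
have s31 : 1 <= sigma ^+ 3 by rewrite exprn_ege1.
apply: (@le_trans _ _ (sigma ^+ 3 * p)); first by rewrite ler_peMl.
by apply: le_trans sp _; lra.
Qed.

Lemma sized_embedding (s d : nat) : ((s == 3) && (d == 5)) || ((s == 4) && (d == 10)) ->
  exists2 C : real, 0 <= C & forall n m (p p' sigma eta : real) D (phi : graph n -> real),
    0 <= p <= 1 -> (forall G, 0 <= phi G <= 1) -> incr phi -> scale n sigma D -> eta <= 1 ->
    embeds s d (m%:R * p ^+ s) p' sigma eta ->
    Ex (sized_law m p (pred1 s)) (fun H => phi (Kcup cliq H)) <=
    Ex (edge_law p') phi + (C * eta + 128 / sigma).
Proof.
move=> sd; have [C C0 emb] := clique_embedding R sd; exists C => //.
move=> n m p p' sigma eta D phi p01 phi01 phi_incr sc e1 em.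
have p'01 := embeds_le1 sc em.
case: (sc) (em) => s1 ns D1 D2 [p'0 qp qe sp].
apply: (emb _ _ _ _ (m%:R * p ^+ s) p' sigma eta D) => //.
- exact: sized_law_isprob.
- by move=> S /negPf Ss; rewrite /sized_law /= Ss.
- move=> S; rewrite /sized_law /=; case: eqP => [<-|_]; first exact: poisson_law_le.
  by case/andP: p01 => p0 _; rewrite mulr_ge0 // exprn_ge0.
- exact: edge_law_isprob.
- by move=> e e2; rewrite /edge_law e2.
- by case/andP: p'01.
- by rewrite card_ord.
Qed.

Lemma setU_incr (n : nat) (phi : graph n -> real) G : incr phi -> incr (fun H => phi (G :|: H)).
Proof. by move=> fi H H' sub; apply: fi; apply: setUS. Qed.

(** With the edges of the triples held fixed, the types of size 2 are averaged out. The average [F]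
    is again increasing with values in [0, 1], so the embedding applies to it, and the two edge laws
    are then merged. Quadruples are treated likewise, averaging out all smaller types. *)
Lemma upper_triangles : exists2 C : real, 0 <= C &
  forall n m (p p3 sigma eta : real) D (phi : graph n -> real),
    0 <= p <= 1 -> (forall G, 0 <= phi G <= 1) -> incr phi -> scale n sigma D -> eta <= 1 ->
    embeds 3 5 (m%:R * p ^+ 3) p3 sigma eta ->
    Ex (sized_law m p (fun j => 1 < j < 4)%N) (fun H => phi (Kcup cliq H)) <=
    Ex (edge_law (clamp01 (edge_prob n m p + p3))) phi + (C * eta + 128 / sigma).
Proof.
have [//|C C0 emb] := @sized_embedding 3 5; exists C => //.
move=> n m p p3 sigma eta D phi p01 phi01 phi_incr sc e1 em.
have p301 := embeds_le1 sc em; have pm01 := edge_prob_bounds n m p01.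
have law2 := @sized_law_isprob n m p p01 (pred1 2).
have -> : Ex (sized_law m p (fun j => 1 < j < 4)%N) (fun H => phi (Kcup cliq H)) =
   Ex (sized_law m p (predU (pred1 3) (pred1 2))) (fun H => phi (Kcup cliq H)).
  by apply: eq_Ex => // S; rewrite /sized_law /=; case: (#|S|) => [|[|[|[|k]]]].
rewrite sized_law_union; last by move=> j /=; case: eqP => // ->.
pose F G := Ex (sized_law m p (pred1 2)) (fun H => phi (G :|: Kcup cliq H)).
have -> : Ex (sized_law m p (pred1 3)) (fun H1 => Ex (sized_law m p (pred1 2))
     (fun H2 => phi (Kcup cliq (H1 :|: H2)))) =
   Ex (sized_law m p (pred1 3)) (fun H => F (Kcup cliq H)).
  by apply: eq_Ex => // H1; apply: eq_Ex => // H2; rewrite Kcup_setU.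
apply: le_trans (emb _ _ _ p3 sigma eta D F p01 _ _ sc e1 em) _.
- by move=> G; apply: sized_law_phi01.
- exact: sized_law_phi_incr.
rewrite lerD2r addrC; apply: le_trans (edge_law_union p301 pm01 phi_incr).
rewrite le_eqVlt; apply/orP; left; apply/eqP; apply: eq_Ex => // G.
exact: (sized_law_pairs m p (fun H => phi (G :|: H))).
Qed.

Lemma upper_K4 : exists2 C : real, 0 <= C &
  forall n m (p p3 p4 sigma eta : real) D (phi : graph n -> real),
    0 <= p <= 1 -> (forall G, 0 <= phi G <= 1) -> incr phi -> scale n sigma D -> eta <= 1 ->
    embeds 3 5 (m%:R * p ^+ 3) p3 sigma eta -> embeds 4 10 (m%:R * p ^+ 4) p4 sigma eta ->
    Ex (sized_law m p (fun j => 1 < j < 5)%N) (fun H => phi (Kcup cliq H)) <=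
    Ex (edge_law (clamp01 (edge_prob n m p + p3 + p4))) phi + (C * eta + 256 / sigma).
Proof.
have [//|C4 C40 emb] := @sized_embedding 4 10; have [C3 C30 up3] := upper_triangles.
exists (C3 + C4); first exact: addr_ge0.
move=> n m p p3 p4 sigma eta D phi p01 phi01 phi_incr sc e1 em3 em4.
have p301 := embeds_le1 sc em3; have p401 := embeds_le1 sc em4.
have pm01 := edge_prob_bounds n m p01.
have law23 := @sized_law_isprob n m p p01 (fun j => 1 < j < 4)%N.
have -> : Ex (sized_law m p (fun j => 1 < j < 5)%N) (fun H => phi (Kcup cliq H)) =
   Ex (sized_law m p (predU (pred1 4) (fun j => 1 < j < 4)%N)) (fun H => phi (Kcup cliq H)).
  by apply: eq_Ex => // S; rewrite /sized_law /=; case: (#|S|) => [|[|[|[|[|k]]]]].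
rewrite sized_law_union; last by move=> j /=; case: eqP => // ->.
pose F G := Ex (sized_law m p (fun j => 1 < j < 4)%N) (fun H => phi (G :|: Kcup cliq H)).
have -> : Ex (sized_law m p (pred1 4)) (fun H1 => Ex (sized_law m p (fun j => 1 < j < 4)%N)
     (fun H2 => phi (Kcup cliq (H1 :|: H2)))) =
   Ex (sized_law m p (pred1 4)) (fun H => F (Kcup cliq H)).
  by apply: eq_Ex => // H1; apply: eq_Ex => // H2; rewrite Kcup_setU.
apply: le_trans (emb _ _ _ p4 sigma eta D F p01 _ _ sc e1 em4) _.
- by move=> G; apply: sized_law_phi01.
- exact: sized_law_phi_incr.
pose a := clamp01 (edge_prob n m p + p3).
have a01 : 0 <= a <= 1 by apply: clamp01_bounds.
have FE G : F G <= Ex (edge_law a) (fun H => phi (G :|: H)) + (C3 * eta + 128 / sigma).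
  by apply: (up3 _ _ _ _ _ _ D (fun H => phi (G :|: H))) => //; apply: setU_incr.
apply: (@le_trans _ _ (Ex (edge_law p4) (fun G => Ex (edge_law a) (fun H => phi (G :|: H)) +
    (C3 * eta + 128 / sigma)) + (C4 * eta + 128 / sigma))).
  by rewrite lerD2r; apply: le_Ex => //; apply: edge_law_isprob.
rewrite Ex_add Ex_const.
have le1 : Ex (edge_law p4) (fun G => Ex (edge_law a) (fun H => phi (G :|: H))) <=
    Ex (edge_law (clamp01 (edge_prob n m p + p3 + p4))) phi.
  apply: le_trans (edge_law_union p401 a01 phi_incr) _.
  have le2 : clamp01 (p4 + a) <= clamp01 (edge_prob n m p + p3 + p4).
    rewrite addrC; apply: clamp01_mono; rewrite lerD2r /a clamp01E ge_max ge_min lexx orbT andbT.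
    by case/andP: pm01 => ? _; case/andP: p301 => ? _; rewrite addr_ge0.
  apply: Ex_mono => //; try by apply: edge_law_isprob; apply: clamp01_bounds.
  by move=> e; rewrite /edge_law; case: ifP.
have -> : (C3 + C4) * eta + 256 / sigma = (C3 * eta + 128 / sigma) + (C4 * eta + 128 / sigma).
  rewrite -[256]/((128 + 128)%N%:R); ring.
by rewrite -addrA lerD2r.
Qed.

Lemma property_incr n (A : pred (graph n)) : monotone_up A ->
  incr (fun G : graph n => (A (G :&: pairs n))%:R : real).
Proof.
move=> up G G' sub; rewrite ler_nat.
have := up (G :&: pairs n) (G' :&: pairs n); rewrite !simpleE !subsetIr setSI // => /(_ isT isT isT).
by case: (A (G :&: _)) => // ->.
Qed.

Lemma property01 n (A : pred (graph n)) (G : graph n) : 0 <= ((A (G :&: pairs n))%:R : real) <= 1.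
Proof. by rewrite ler0n lern1 leq_b1. Qed.

Lemma property_Kcup n (A : pred (graph n)) (H : graph n) :
  A (Kcup cliq H) = A (Kcup cliq H :&: pairs n).
Proof. by rewrite (setIidPl (Kcup_simple H)). Qed.

(** The Poisson comparison bounds from above only. It holds for any nonnegative test function, so it
    can be applied to the complement of [A], although that is decreasing. *)
Lemma gnmp_lower n m p (A : pred (graph n)) : 0 <= p <= 1 -> (0 < m)%N ->
  0 < (1 - p) ^+ n - m%:R^-1 -> monotone_up A ->
  1 - prob_Gnmp m p A <= ((1 - p) ^+ n - m%:R^-1)^-1 * (1 - prob_Gnp (edge_prob n m p) A).
Proof.
move=> p01 m0 c0 up; rewrite -prob_Gnmp_predC.
apply: le_trans (prob_Gnmp_le p01 _ m0 c0) _; rewrite ler_wpM2l ?invr_ge0 ?(ltW c0) //.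
rewrite prob_GnpE clamp01_id ?edge_prob_bounds //.
have := poisson_ge_pairs m p01 (property_incr up) => le1.
have -> : Ex (poisson_law m p) (fun H => (predC A (Kcup cliq H))%:R) =
   1 - Ex (poisson_law m p) (fun H => (A (Kcup cliq H :&: pairs n))%:R).
  transitivity (Ex (poisson_law m p) (fun H => 1 + -1 * (A (Kcup cliq H :&: pairs n))%:R)).
    apply: eq_Ex => // H; rewrite -property_Kcup /=.
    by case: (A _); rewrite /= ?mulr1 ?mulr0 ?subrr ?addr0.
  by rewrite Ex_add Ex_const Ex_scale mulN1r.
by rewrite lerB.
Qed.
End UpperBound.

(** * Explicit error bounds for fixed n *)

Section FixedSize.
Local Open Scope ring_scope.
Arguments exp x%_ring_scope.
Arguments clamp01 x%_ring_scope.
Local Notation real := (Num.RealField.sort RbaseSymbolsImpl_R__canonical__Num_RealField).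

Lemma prob_Gnp_bounds n p (A : pred (graph n)) : 0 <= (prob_Gnp p A : real) <= 1.
Proof.
have h B : 0 <= (prob_Gnp p B : real).
  rewrite prob_GnpE; apply: Ex_ge0 => // e; rewrite /edge_law.
  by case: ifP => _; rewrite ?clamp01_bounds // lexx ler01.
by rewrite h /= -subr_ge0 -prob_Gnp_predC.
Qed.

Lemma prob_Gnmp_le1 n m (p : real) (A : pred (graph n)) : 0 <= p <= 1 -> (prob_Gnmp m p A : real) <= 1.
Proof.
move=> p01; rewrite -subr_ge0 -prob_Gnmp_predC prob_GnmpE; apply: sumr_ge0 => f _.
by rewrite mulr_ge0 // prodr_ge0 // => w _; apply: object_weight_ge0.
Qed.

Lemma bernoulli_ineq (p : real) n : 0 <= p <= 1 -> 1 - n%:R * p <= (1 - p) ^+ n.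
Proof.
move=> /andP [p0 p1]; elim: n => [|n IHn]; first by rewrite mul0r subr0.
have q0 : 0 <= 1 - p by rewrite subr_ge0.
rewrite exprS; apply: le_trans (ler_wpM2l q0 IHn).
rewrite -subr_ge0 -natr1.
have -> : (1 - p) * (1 - n%:R * p) - (1 - (n%:R + 1) * p) = n%:R * p ^+ 2 by ring.
by rewrite mulr_ge0 // exprn_ge0.
Qed.

(** An increasing property that fails on the complete graph never holds. Otherwise G(n, p_-) has it
    whenever complete, and each of its at most n^2 pairs is absent with probability 1 - p_-. *)
Lemma gnmp_complete n m (p : real) (A : pred (graph n)) : 0 <= p <= 1 -> monotone_up A ->
  (prob_Gnmp m p A : real) <= prob_Gnp (edge_prob n m p) A + n%:R ^+ 2 * (1 - edge_prob n m p).
Proof.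
move=> p01 up; have pm01 := edge_prob_bounds n m p01.
have pm1 : 0 <= 1 - edge_prob n m p by rewrite subr_ge0; case/andP: pm01.
have rhs0 : 0 <= prob_Gnp (edge_prob n m p) A + n%:R ^+ 2 * (1 - edge_prob n m p).
  by rewrite addr_ge0 ?mulr_ge0 ?exprn_ge0 //; case/andP: (prob_Gnp_bounds (edge_prob n m p) A).
have [Apairs|nA] := boolP (A (pairs n)); last first.
  rewrite prob_GnmpE big1 // => f _; set H := Kcup _ _.
  rewrite (_ : A H = false) ?mul0r //; apply: contraNF nA; apply: up; rewrite ?simpleE ?subxx //;
  exact: Kcup_simple.
apply: (le_trans (prob_Gnmp_le1 m A p01)).
rewrite -lerBlDl -prob_Gnp_predC prob_GnpE clamp01_id //.
have law := @edge_law_isprob n _ pm01.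
apply: (@le_trans _ _ (Ex (edge_law (edge_prob n m p))
    (fun G => \sum_(e in pairs n) (1 + -1 * ([set e] \subset G)%:R)))).
  apply: le_Ex => // G /=.
  have t0 (e : {set 'I_n}) : 0 <= 1 + -1 * ([set e] \subset G)%:R :> real.
    by case: (_ \subset _); rewrite /= ?mulr1 ?mulr0 ?subrr ?addr0.
  have [sub|] := boolP (pairs n \subset G).
    by rewrite (setIidPr sub) Apairs; apply: sumr_ge0 => e _; apply: t0.
  case/subsetPn => e eP eG; rewrite (bigD1 e) //= sub1set (negPf eG) mulr0 addr0.
  apply: (@le_trans _ _ 1); first by rewrite lern1 leq_b1.
  by rewrite lerDl; apply: sumr_ge0 => e' _; apply: t0.
rewrite Ex_bigsum (eq_bigr (fun=> 1 - edge_prob n m p)); last first.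
  move=> e; rewrite inE => e2.
  by rewrite Ex_add Ex_const Ex_scale Ex_contains big_set1 /edge_law e2 mulN1r.
rewrite sumr_const -[leLHS]mulr_natl ler_wpM2r // -natrX ler_nat card_pairs.
exact: bin_leq_exp.
Qed.

Lemma capacity_le n m (p delta : real) : 0 <= p <= 1 -> 0 < delta <= 1 / 8 ->
  n%:R * p <= delta -> m%:R^-1 <= delta ->
  0 < (1 - p) ^+ n - m%:R^-1 /\ ((1 - p) ^+ n - m%:R^-1)^-1 <= 1 + 4 * delta.
Proof.
move=> p01 /andP [d0 d1] np m1.
have le1 : 1 - 2 * delta <= (1 - p) ^+ n - m%:R^-1.
  by have := bernoulli_ineq n p01; lra.
have pos : 0 < (1 - p) ^+ n - m%:R^-1 by lra.
split=> //; rewrite -div1r ler_pdivrMr //.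
apply: (@le_trans _ _ ((1 + 4 * delta) * (1 - 2 * delta))); first by nra.
by rewrite ler_wpM2l //; lra.
Qed.

Lemma gnmp_lower_delta n m (p delta : real) (A : pred (graph n)) :
  0 <= p <= 1 -> 0 < delta <= 1 / 8 -> (0 < m)%N ->
  n%:R * p <= delta -> m%:R^-1 <= delta -> monotone_up A ->
  (prob_Gnp (edge_prob n m p) A : real) - 4 * delta <= prob_Gnmp m p A.
Proof.
move=> p01 d01 m0 np m1 up; have [c0 c1] := capacity_le p01 d01 np m1.
have le1 := gnmp_lower p01 m0 c0 up.
have /andP [g0 g1] := prob_Gnp_bounds (edge_prob n m p) A.
have h : 0 <= 1 - prob_Gnp (edge_prob n m p) A :> real by rewrite subr_ge0.
have /andP [d0 d1] := d01.
move: (le_trans le1 (ler_wpM2r h c1)).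
move: (prob_Gnp _ _) (prob_Gnmp _ _ _) g0 g1 {h le1} => x y g0 g1 h.
have := mulr_ge0 (ltW d0) g0; lra.
Qed.

Lemma gnmp_upper_delta n m (p delta err P : real) k (A : pred (graph n)) :
  0 <= p <= 1 -> 0 < delta <= 1 / 8 -> (0 < m)%N -> (1 < k)%N ->
  n%:R * p <= delta -> m%:R^-1 <= delta -> monotone_up A -> 0 <= err ->
  Ex (sized_law m p (fun j => 1 < j < k)%N) (fun H => (A (Kcup cliq H :&: pairs n))%:R) <=
    prob_Gnp P A + err ->
  m%:R * (n%:R * p) ^+ k <= delta ->
  (prob_Gnmp m p A : real) <= prob_Gnp P A + (6 * delta + 2 * err).
Proof.
move=> p01 d01 m0 k1 np m1 up err0 le1 tail; have [c0 c1] := capacity_le p01 d01 np m1.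
have /andP [g0 g1] := prob_Gnp_bounds P A.
have /andP [d0 d1] := d01.
apply: (le_trans (prob_Gnmp_le p01 A m0 c0)).
set E := Ex _ _.
have E_le : E <= prob_Gnp P A + err + delta.
  have -> : E = Ex (poisson_law m p) (fun H => (A (Kcup cliq H :&: pairs n))%:R).
    by apply: eq_Ex => // H; rewrite -property_Kcup.
  apply: le_trans (poisson_le_small m p01 (property01 A) k1) _.
  by rewrite lerD.
have E0 : 0 <= E by apply: Ex_ge0 => //; apply: poisson_law_isprob.
apply: (le_trans (ler_wpM2r E0 c1)).
apply: (@le_trans _ _ ((1 + 4 * delta) * (prob_Gnp P A + err + delta))).
  by rewrite ler_wpM2l //; lra.
move: (prob_Gnp P A) g0 g1 => x g0 g1.
have := ler_wpM2l (ltW d0) g1; have := mulr_ge0 (ltW d0) g0.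
have := ler_wpM2r err0 d1; have := ler_wpM2r (ltW d0) d1.
have -> : (1 + 4 * delta) * (x + err + delta) =
  x + err + delta + 4 * (delta * x) + 4 * (delta * err) + 4 * (delta * delta) by ring.
lra.
Qed.
End FixedSize.

(** * Asymptotics *)

Section Scaling.
Local Open Scope ring_scope.
Arguments exp x%_ring_scope.
Arguments ln x%_ring_scope.
Local Notation real := (Num.RealField.sort RbaseSymbolsImpl_R__canonical__Num_RealField).

Lemma le_of_pow (k : nat) (x y : real) : (0 < k)%N -> 0 <= y -> x ^+ k <= y ^+ k -> x <= y.
Proof.
move=> k0 y0; case: (lerP x y) => // yx le.
have := ltr_pXn2r k0 y0 (le_trans y0 (ltW yx)); rewrite yx => /lt_geF.
by rewrite le.
Qed.

(** All quantities are controlled by m p^2 and [tau] = n^(10/3) / m: (n p)^2 <= (m p^2) tau, (m p^3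
    sigma^10)^2 = (m p^2)^3 tau, m p^4 sigma^20 = (m p^2)^2 tau, and (m (n p)^5)^2 = (m p^2)^5
    tau^3. This is where the exponent 10/3 enters. *)
Lemma scaling_bounds (n m : nat) (p sigma Lam delta : real) :
  1 <= sigma -> n%:R = sigma ^+ 6 -> (0 < m)%N -> 0 <= p -> 1 <= Lam ->
  m%:R * p ^+ 2 <= Lam -> Lam ^+ 5 * (sigma ^+ 20 / m%:R) <= delta ^+ 2 -> 0 < delta <= 1 ->
  [/\ m%:R^-1 <= delta, n%:R * p <= delta, m%:R * p ^+ 3 * sigma ^+ 10 <= delta,
     m%:R * p ^+ 4 * sigma ^+ 20 <= delta & m%:R * (n%:R * p) ^+ 5 <= delta].
Proof.
move=> s1 ns m0 p0 L1 mp tl /andP [d0 d1].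
have M0 : 0 < m%:R :> real by rewrite ltr0n.
set M := m%:R in M0 mp tl *; set tau := sigma ^+ 20 / M in tl.
have s0 : 0 < sigma by apply: lt_le_trans s1.
have d0' := ltW d0.
have mp0 : 0 <= M * p ^+ 2 by rewrite mulr_ge0 ?exprn_ge0 // ltW.
have tau0 : 0 <= tau by rewrite divr_ge0 ?exprn_ge0 // ltW.
have dd : delta ^+ 2 <= delta by rewrite -[leRHS]expr1 ler_wiXn2l.
have key k : (k <= 5)%N -> (M * p ^+ 2) ^+ k * tau <= delta ^+ 2.
  move=> k5; apply: le_trans tl; rewrite ler_wpM2r //.
  apply: (@le_trans _ _ (Lam ^+ k)); last exact: ler_weXn2l.
  by apply: lerXn2r => //; rewrite nnegrE // (le_trans ler01).
have sE : sigma ^+ 20 = M * tau by rewrite /tau; field; rewrite gt_eqF.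
have tau1 : tau <= delta ^+ 2 by have := key 0%N isT; rewrite expr0 mul1r.
split.
- apply: le_trans dd; apply: le_trans tau1; rewrite /tau.
  by rewrite ler_peMl ?invr_ge0 ?(ltW M0) // exprn_ege1.
- apply: (@le_of_pow 2) => //; rewrite ns.
  apply: le_trans (key 1%N isT); rewrite expr1.
  have -> : M * p ^+ 2 * tau = p ^+ 2 * sigma ^+ 20 by rewrite sE; ring.
  rewrite exprMn -exprM mulrC ler_wpM2l ?exprn_ge0 //.
  by rewrite ler_weXn2l.
- apply: (@le_of_pow 2) => //; apply: le_trans (key 3%N isT).
  have -> : (M * p ^+ 3 * sigma ^+ 10) ^+ 2 = M ^+ 2 * p ^+ 6 * sigma ^+ 20 by ring.
  by rewrite sE le_eqVlt; apply/orP; left; apply/eqP; ring.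
- apply: le_trans dd; apply: le_trans (key 2%N isT).
  by rewrite sE le_eqVlt; apply/orP; left; apply/eqP; ring.
apply: (@le_of_pow 2) => //; rewrite ns.
have -> : (M * (sigma ^+ 6 * p) ^+ 5) ^+ 2 = (M ^+ 2 * p ^+ 10) * (sigma ^+ 20) ^+ 3 by ring.
rewrite sE.
have -> : M ^+ 2 * p ^+ 10 * (M * tau) ^+ 3 = ((M * p ^+ 2) ^+ 5 * tau) * tau ^+ 2 by ring.
rewrite -[leRHS]mulr1; apply: ler_pM; [|exact: exprn_ge0|exact: key|].
  by apply: mulr_ge0 => //; apply: exprn_ge0.
by apply: exprn_ile1 => //; apply: le_trans tau1 _; apply: le_trans dd d1.
Qed.

(** 30^3 is above 2048, and (sigma^3 * 30 r)^3 = 30^3 q sigma^9 <= 30^3 / sigma, which is at most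
    500^(-3) for the sigma allowed. *)
Lemma embeds_triangle (q r sigma delta : real) :
  1 <= sigma -> (500 * 30) ^+ 3 <= sigma -> 0 <= q -> q * sigma ^+ 10 <= delta -> delta <= 1 ->
  0 <= r -> r ^+ 3 = q -> embeds 3 5 q (30 * r) sigma delta.
Proof.
move=> s1 sbig q0 qs d1 r0 rq.
have s0 : 0 < sigma by apply: lt_le_trans s1.
have r3 : (30 * r) ^+ 'C(3, 2) = 30 ^+ 3 * q by rewrite exprMn; congr (_ * _); exact: rq.
split=> //; first by rewrite mulr_ge0.
  by rewrite r3 ler_wpM2r // -natrX ler_nat.
apply: (@le_of_pow 3) => //; first lra.
have -> : (sigma ^+ 3 * (30 * r)) ^+ 3 = sigma ^+ 9 * 30 ^+ 3 * r ^+ 3 by ring.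
rewrite rq -(ler_pM2r s0).
have -> : sigma ^+ 9 * 30 ^+ 3 * q * sigma = 30 ^+ 3 * (q * sigma ^+ 10) by ring.
apply: (@le_trans _ _ (30 ^+ 3)); first by rewrite ler_piMr ?exprn_ge0 // (le_trans qs).
apply: (@le_trans _ _ ((1 / 500) ^+ 3 * (500 * 30) ^+ 3)); last by rewrite ler_wpM2l // exprn_ge0 //; lra.
by rewrite -exprMn le_eqVlt; apply/orP; left; apply/eqP; congr (_ ^+ _); field.
Qed.

Lemma embeds_K4 (q r sigma delta : real) :
  1 <= sigma -> (500 * 157) ^+ 6 <= sigma -> 0 <= q -> q * sigma ^+ 20 <= delta -> delta <= 1 ->
  0 <= r -> r ^+ 6 = q -> embeds 4 10 q (157 * r) sigma delta.
Proof.
move=> s1 sbig q0 qs d1 r0 rq.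
have s0 : 0 < sigma by apply: lt_le_trans s1.
have r3 : (157 * r) ^+ 'C(4, 2) = 157 ^+ 6 * q by rewrite exprMn; congr (_ * _); exact: rq.
split=> //; first by rewrite mulr_ge0.
  rewrite r3 ler_wpM2r // (@le_trans _ _ (157 ^+ 2)) //; first by rewrite -natrX ler_nat.
  by rewrite ler_weXn2l // ler1n.
apply: (@le_of_pow 6) => //; first lra.
have -> : (sigma ^+ 3 * (157 * r)) ^+ 6 = sigma ^+ 18 * 157 ^+ 6 * r ^+ 6.
  by rewrite [LHS]exprMn [(157 * r) ^+ 6]exprMn -[(sigma ^+ 3) ^+ 6]exprM mulrA.
rewrite rq -(ler_pM2r s0).
apply: (@le_trans _ _ (157 ^+ 6)).
  have -> : sigma ^+ 18 * 157 ^+ 6 * q * sigma = 157 ^+ 6 * (q * sigma ^+ 19).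
    by rewrite [sigma ^+ 19]exprSr; move: (sigma ^+ 18) (157 ^+ 6) => a b; ring.
  rewrite ler_piMr ?exprn_ge0 // (le_trans _ (le_trans qs d1)) // ler_wpM2l //.
  by rewrite ler_weXn2l.
apply: (@le_trans _ _ ((1 / 500) ^+ 6 * (500 * 157) ^+ 6)); last by rewrite ler_wpM2l // exprn_ge0 //; lra.
rewrite -exprMn le_eqVlt; apply/orP; left; apply/eqP; congr (_ ^+ _).
by lra.
Qed.

Lemma scale_exists n (sigma : real) : 2 <= sigma -> n%:R = sigma ^+ 6 -> exists D, scale n sigma D.
Proof.
move=> s2 ns; have s30 : 0 <= sigma ^+ 3 / 2 by rewrite divr_ge0 ?exprn_ge0 //; lra.
have /andP [t1 t2] := Num.Theory.truncn_itv s30.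
exists (7 + (Num.truncn (sigma ^+ 3 / 2)).+1)%N; split=> //; first lra.
  by rewrite addKn ltW.
have : 2 ^+ 3 <= sigma ^+ 3 by apply: lerXn2r => //; rewrite nnegrE; lra.
have -> : 2 ^+ 3 = 8 :> real by ring.
rewrite natrD -natr1; lra.
Qed.

Lemma rt_ge0 (k x : real) : 0 <= rt k x.
Proof.
rewrite /rt; case: Rlt_dec => [?|?]; last by [].
exact: ltW (expR_gt0 _).
Qed.

Lemma rt_pow (k : nat) (x : real) : (0 < k)%N -> 0 <= x -> rt (INR k) x ^+ k = x.
Proof.
move=> k0 x0; rewrite /rt; case: Rlt_dec => [xp|xn].
  rewrite /Rpower expRX RmultE RinvE INRE -[X in exp X]mulr_natr mulrAC mulVf ?pnatr_eq0 -?lt0n // mul1r.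
  exact: exp_ln.
rewrite /=; have -> : x = 0 by apply/eqP; rewrite eq_le x0 andbT leNgt; apply/negP => /RltP.
by rewrite expr0n eqn0Ngt k0.
Qed.

Lemma ln_eventually (X : real) : exists N, forall n, (N <= n)%N ->
  X <= ln (INR n) /\ (n%:R = exp (ln (INR n)) :> real).
Proof.
have e0 := expR_gt0 X.
have /andP [t1 t2] := Num.Theory.truncn_itv (ltW e0).
exists (Num.truncn (exp X)).+1 => n Nn.
have lt1 : exp X < n%:R by apply: lt_le_trans t2 _; rewrite ler_nat.
have n0 : 0 < n%:R :> real by apply: lt_trans lt1.
split; last by rewrite exp_ln ?INRE //; apply/RltP.
rewrite -[X]ln_exp INRE; apply/RleP; left; apply: ln_increasing; apply/RltP => //.
Qed.

(** With [y] = n^(beta/10) one has n^alpha = y^10 sigma^20. Half of y^10 pays for the fifth power of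
    K ln n <= B y, the other half brings what remains below delta^2. [X] is chosen so that 1 + u <=
    exp u yields sigma >= S and y >= Y + 2. *)
Lemma small_p_bounds (alpha K delta : real) : 10 / 3 < alpha -> 1 <= K -> 0 < delta <= 1 ->
  exists N, forall n, (N <= n)%N -> forall (m : nat) (p : real),
    Rpower (INR n) alpha < m%:R + 1 -> 0 <= p -> m%:R * p ^+ 2 <= K * ln (INR n) ->
  exists (sigma : real) D, [/\ scale n sigma D, sigma^-1 <= delta,
    (500 * 30) ^+ 3 <= sigma & (500 * 157) ^+ 6 <= sigma] /\
  [/\ (0 < m)%N & [/\ m%:R^-1 <= delta, n%:R * p <= delta, m%:R * p ^+ 3 * sigma ^+ 10 <= delta,
     m%:R * p ^+ 4 * sigma ^+ 20 <= delta & m%:R * (n%:R * p) ^+ 5 <= delta]].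
Proof.
move=> a103 K1 d01; have /andP [d0 d1] := d01.
pose beta := alpha - 10 / 3.
have b0 : 0 < beta by rewrite /beta; lra.
pose B := 10 * K / beta.
have B0 : 0 < B by rewrite divr_gt0 // mulr_gt0 //; lra.
pose Y := 2 * B ^+ 5 / delta ^+ 2.
have Y0 : 0 < Y by rewrite divr_gt0 ?exprn_gt0 // mulr_gt0 // exprn_gt0.
have [c1 c2] : 0 <= (500 * 30) ^+ 3 :> real /\ 0 <= (500 * 157) ^+ 6 :> real.
  by split; rewrite exprn_ge0 // mulr_ge0.
have di0 : 0 < delta^-1 by rewrite invr_gt0.
move: ((500 * 30) ^+ 3 : real) ((500 * 157) ^+ 6 : real) c1 c2 => b3 b4 c1 c2.
pose S := 2 + delta^-1 + b3 + b4 : real.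
have S0 : 0 < S by rewrite /S; lra.
have Sbounds x : S <= x -> [/\ 2 <= x, 1 <= x, delta^-1 <= x, b3 <= x & b4 <= x].
  by rewrite /S => Sx; split; lra.
pose X := 1 + 6 * S + 10 * (Y + 2) / beta.
have [N HN] := ln_eventually X; exists N => n Nn m p mlt p0 mp.
have [LX nE] := HN n Nn; set L := ln (INR n) in LX nE mp *.
have Yb0 : 0 < 10 * (Y + 2) / beta by rewrite divr_gt0 // mulr_gt0 //; lra.
have L1 : 1 <= L by move: LX; rewrite /X; lra.
pose sigma := exp (6^-1 * L); pose y := exp (beta / 10 * L).
have sS : S <= sigma.
  apply: le_trans (exp_ge1D _); move: LX; rewrite /X; lra.
have yY : Y + 2 <= y.
  apply: le_trans (exp_ge1D _).
  have : 10 * (Y + 2) / beta <= L by move: LX; rewrite /X; lra.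
  rewrite ler_pdivrMr // => h.
  have -> : beta / 10 * L = L * beta / 10 by ring.
  lra.
have y0 : 0 < y by apply: expR_gt0.
have ns : n%:R = sigma ^+ 6.
  by rewrite nE /sigma expRX -[_ *+ 6]mulr_natr mulrAC mulVf ?mul1r // pnatr_eq0.
have [s2 s1 sd s3 s4] := Sbounds _ sS.
have [D sc] := scale_exists s2 ns.
have s0 : 0 < sigma by apply: expR_gt0.
have powE : y ^+ 10 * sigma ^+ 20 = Rpower (INR n) alpha.
  rewrite /y /sigma !expRX exp_add /Rpower RmultE -/L; congr (exp _).
  rewrite -[_ *+ 10]mulr_natr -[_ *+ 20]mulr_natr /beta; by field.
have big2 : 2 <= y ^+ 10 * sigma ^+ 20.
  have y1 : 1 <= y by lra.
  apply: (@le_trans _ _ (y ^+ 10)); last by rewrite ler_peMr ?exprn_ege1 // exprn_ge0 // ltW.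
  apply: (@le_trans _ _ y); first lra.
  by rewrite -[leLHS]expr1 ler_weXn2l.
(* The integer part costs a factor 2: m > n^alpha - 1 >= n^alpha / 2, because n^alpha >= 2. *)
have mge : y ^+ 10 * sigma ^+ 20 <= 2 * m%:R by rewrite -powE in mlt; lra.
have M0 : 0 < m%:R :> real by lra.
have m0 : (0 < m)%N by rewrite -(ltr_nat real).
have Lam : K * L <= B * y.
  have -> : K * L = B * (beta / 10 * L) by rewrite /B; field; rewrite gt_eqF.
  rewrite ler_wpM2l ?(ltW B0) //; have := exp_ge1D (beta / 10 * L); rewrite -/y; lra.
have KL1 : 1 <= K * L by have := ler_wpM2l (le_trans ler01 K1) L1; lra.
exists sigma, D; split.
  by split=> //; rewrite -[leRHS]invrK lef_pV2 ?posrE.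
split=> //.
apply: (scaling_bounds s1 ns m0 p0 KL1 mp _ d01).
rewrite mulrA ler_pdivrMr //.
have d20 : 0 < delta ^+ 2 by rewrite exprn_gt0.
have le1 : (K * L) ^+ 5 <= B ^+ 5 * y ^+ 5.
  rewrite -exprMn; apply: lerXn2r => //; rewrite nnegrE; first exact: le_trans ler01 KL1.
  by rewrite mulr_ge0 ?(ltW B0) ?(ltW y0).
have le2 : 2 * B ^+ 5 <= delta ^+ 2 * y ^+ 5.
  have : Y <= y ^+ 5.
    have y1 : 1 <= y by lra.
    apply: (@le_trans _ _ y); first lra.
    by rewrite -[leLHS]expr1 ler_weXn2l.
  by rewrite /Y ler_pdivrMr // [y ^+ 5 * _]mulrC.
have s20 : 0 <= sigma ^+ 20 by rewrite exprn_ge0 // ltW.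
have y50 : 0 <= y ^+ 5 by rewrite exprn_ge0 // ltW.
apply: (le_trans (ler_wpM2r s20 le1)).
have h1 := ler_wpM2r s20 (ler_wpM2r y50 le2).
have h2 := ler_wpM2l (ltW d20) mge.
have e1 : delta ^+ 2 * y ^+ 5 * y ^+ 5 * sigma ^+ 20 = delta ^+ 2 * (y ^+ 10 * sigma ^+ 20).
  by rewrite -!mulrA; congr (_ * _); rewrite mulrA -exprD.
rewrite e1 in h1; lra.
Qed.
End Scaling.

(** * Passage to the limit *)

Section Limits.
Local Open Scope ring_scope.
Arguments exp x%_ring_scope.
Arguments ln x%_ring_scope.
Arguments rt (k x)%_ring_scope.
Arguments prob_Gnp [n] p%_ring_scope A.
Local Notation real := (Num.RealField.sort RbaseSymbolsImpl_R__canonical__Num_RealField).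

(** The alternative may depend on n: where m p^2 exceeds 4 ln n, the upper bound comes from p_-
    itself. *)
Lemma squeeze_cv (P Pm Pp : nat -> real) (a : real) :
  Un_cv Pm a -> Un_cv Pp a ->
  (forall eps : real, 0 < eps <= 1 -> exists N, forall n, (N <= n)%N ->
    Pm n - eps <= P n /\ (P n <= Pp n + eps \/ P n <= Pm n + eps)) ->
  Un_cv P a.
Proof.
move=> cm cp sq e /RltP e0.
have e30 : 0 < e / 3 by rewrite divr_gt0.
have /RltP e30' := e30.
have [N1 H1] := cm _ e30'.
have [N2 H2] := cp _ e30'.
have [|N3 H3] := sq (Num.min (e / 3) 1); first by rewrite lt_min e30 ltr01 ge_min lexx orbT.
exists (maxn N1 (maxn N2 N3)) => n /ssrnat.leP; rewrite !geq_max => /and3P [/ssrnat.leP n1 /ssrnat.leP n2 n3].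
have := H1 n n1; have := H2 n n2; have [lo hi] := H3 n n3.
have me : Num.min (e / 3) 1 <= e / 3 by rewrite ge_min lexx.
move: (Num.min _ _) me lo hi => d me lo hi.
rewrite !RdistE => /RltP; rewrite ltr_distl => /andP [p1 p2] /RltP; rewrite ltr_distl => /andP [q1 q2].
apply/RltP; rewrite ltr_distl; apply/andP; split; first lra.
by case: hi => hi; lra.
Qed.

Lemma small_p_sandwich (alpha K eps : real) : 10 / 3 < alpha -> 1 <= K -> 0 < eps <= 1 ->
  exists delta : real, 0 < delta /\ exists N, forall n, (N <= n)%N ->
  forall m (p : real) (A : pred (graph n)),
    Rpower (INR n) alpha < m%:R + 1 -> 0 <= p <= 1 -> m%:R * p ^+ 2 <= K * ln (INR n) ->
    monotone_up A ->
  [/\ (prob_Gnp (edge_prob n m p) A : real) - eps <= prob_Gnmp m p A,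
     (prob_Gnmp m p A : real) <=
       prob_Gnp (edge_prob n m p + 30 * rt (INR 3) (m%:R * p ^+ 3)
                                 + 157 * rt (INR 6) (m%:R * p ^+ 4)) A + eps &
     m%:R * (n%:R * p) ^+ 4 <= delta ->
     (prob_Gnmp m p A : real) <=
       prob_Gnp (edge_prob n m p + 30 * rt (INR 3) (m%:R * p ^+ 3)) A + eps].
Proof.
move=> a103 K1 /andP [e0 e1].
have [C3 C30 up3] := upper_triangles; have [C4 C40 up4] := upper_K4.
(* 518 = 6 + 2 * 256: six delta from the Poisson comparison, and twice the clique error, whose 256 /
   sigma is at most 256 delta. *)
pose Z := 518 + 2 * C3 + 2 * C4 : real.
have Z0 : 518 <= Z by rewrite /Z; lra.
have Zp : 0 < Z by lra.
pose delta := eps / Z.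
have d0 : 0 < delta by rewrite divr_gt0.
have dZ : 518 * delta + 2 * (C3 * delta) + 2 * (C4 * delta) = eps.
  by rewrite -[RHS](divfK (lt0r_neq0 Zp)) -/delta /Z; ring.
have C3d : 0 <= C3 * delta by rewrite mulr_ge0 // ltW.
have C4d : 0 <= C4 * delta by rewrite mulr_ge0 // ltW.
have d8 : delta <= 1 / 8 by lra.
have budget0 : 4 * delta <= eps by lra.
have budget C c si : C = C3 \/ C = C4 -> 0 <= c <= 256 -> 0 <= si <= delta ->
    0 <= C * delta + c * si /\ 6 * delta + 2 * (C * delta + c * si) <= eps.
  move=> CE /andP [c0 c1] /andP [si0 si1].
  have cs0 := mulr_ge0 c0 si0.
  have cs1 : c * si <= 256 * delta by rewrite ler_pM.
  by case: CE => ->; split; move: C3d C4d d0 dZ cs0 cs1; clear; lra.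
have d1 : delta <= 1 by lra.
have d01 : 0 < delta <= 1 by rewrite d0.
have d08 : 0 < delta <= 1 / 8 by rewrite d0.
have c128 : 0 <= (128 : real) <= 256 by rewrite ler0n ler_nat.
have c256 : 0 <= (256 : real) <= 256 by rewrite ler0n lexx.
exists delta; split=> //.
have [N HN] := small_p_bounds a103 K1 d01; exists N => n Nn m p A mlt p01 mp up.
have /andP [p0 p1] := p01.
have [sigma [D [[sc si s3 s4] [m0 [mi np q3 q4 t5]]]]] := HN n Nn m p mlt p0 mp.
have q30 : 0 <= m%:R * p ^+ 3 by rewrite mulr_ge0 // exprn_ge0.
have q40 : 0 <= m%:R * p ^+ 4 by rewrite mulr_ge0 // exprn_ge0.
have s1 : 1 <= sigma by case: sc.
have si01 : 0 <= sigma^-1 <= delta by rewrite si invr_ge0 (le_trans ler01).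
have em3 := embeds_triangle s1 s3 q30 q3 d1 (rt_ge0 _ _) (@rt_pow 3 _ isT q30).
have em4 := embeds_K4 s1 s4 q40 q4 d1 (rt_ge0 _ _) (@rt_pow 6 _ isT q40).
have [err3 bud3] := budget C3 128 sigma^-1 (or_introl erefl) c128 si01.
have [err4 bud4] := budget C4 256 sigma^-1 (or_intror erefl) c256 si01.
split.
- by apply: le_trans (gnmp_lower_delta p01 d08 m0 np mi up); rewrite lerD2l lerN2.
- have le1 := up4 n m p _ _ sigma delta D _ p01 (property01 A) (property_incr up) sc d1 em3 em4.
  rewrite -prob_GnpE in le1.
  apply: (le_trans (gnmp_upper_delta p01 d08 m0 _ np mi up err4 le1 t5)) => //.
  by rewrite lerD2l.
move=> t4; have le1 := up3 n m p _ sigma delta D _ p01 (property01 A) (property_incr up) sc d1 em3.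
rewrite -prob_GnpE in le1.
apply: (le_trans (gnmp_upper_delta p01 d08 m0 _ np mi up err3 le1 t4)) => //.
by rewrite lerD2l.
Qed.

(** Since n p <= 1/8, the factor (1 - p)^(n - 2) is at least 3/4. Hence 1 - p_- <= n^(-3), and the
    n^2 pairs cost at most 1/n in [gnmp_complete]. *)
Lemma large_p_sandwich (alpha eps : real) : 10 / 3 < alpha -> 0 < eps <= 1 ->
  exists N, forall n, (N <= n)%N -> forall m (p : real) (A : pred (graph n)),
    Rpower (INR n) alpha < m%:R + 1 -> 0 <= p <= 1 -> 4 * ln (INR n) <= m%:R * p ^+ 2 ->
    n%:R * p <= eps / 8 -> monotone_up A ->
  (prob_Gnp (edge_prob n m p) A : real) - eps <= prob_Gnmp m p A /\
  (prob_Gnmp m p A : real) <= prob_Gnp (edge_prob n m p) A + eps.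
Proof.
move=> a103 /andP [e0 e1]; pose delta := eps / 8.
have d0 : 0 < delta by rewrite divr_gt0.
have dE : eps = 8 * delta by rewrite /delta; field.
have d01 : 0 < delta <= 1 by rewrite d0 /=; lra.
have d08 : 0 < delta <= 1 / 8 by rewrite d0 /=; lra.
have [N1 H1] := small_p_bounds a103 (lexx 1) d01.
have [N2 H2] := ln_eventually eps^-1.
exists (maxn N1 N2) => n; rewrite geq_max => /andP [n1 n2] m p A mlt p01 mp np up.
have [LX nE] := H2 n n2; set L := ln (INR n) in LX nE mp.
have L0 : 0 < L by apply: lt_le_trans LX; rewrite invr_gt0.
(* [small_p_bounds] is taken at p = 0, for its bounds on m alone; the actual p violates its
   assumption on m p^2. *)
have [sigma [D [_ [m0 [mi _ _ _ _]]]]] : exists (sigma : real) D, [/\ scale n sigma D, sigma^-1 <= delta,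
    (500 * 30) ^+ 3 <= sigma & (500 * 157) ^+ 6 <= sigma] /\
  [/\ (0 < m)%N & [/\ m%:R^-1 <= delta, n%:R * 0 <= delta, m%:R * 0 ^+ 3 * sigma ^+ 10 <= delta,
     m%:R * 0 ^+ 4 * sigma ^+ 20 <= delta & m%:R * (n%:R * 0) ^+ 5 <= delta]].
  by apply: (H1 n n1 m 0) => //; rewrite expr0n mulr0 mul1r ltW.
split; first by apply: le_trans (gnmp_lower_delta p01 d08 m0 np mi up); lra.
apply: le_trans (gnmp_complete m p01 up) _; rewrite lerD2l.
have /andP [p0 p1] := p01.
have q1 : 3 / 4 <= (1 - p) ^+ (n - 2).
  apply: (@le_trans _ _ ((1 - p) ^+ n)); first by have := bernoulli_ineq n p01; lra.
  by rewrite ler_wiXn2l ?leq_subr //; lra.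
have expo : 3 * L <= m%:R * (p ^+ 2 * (1 - p) ^+ (n - 2)).
  rewrite mulrA; apply: (@le_trans _ _ (4 * L * (3 / 4))); first lra.
  by apply: ler_pM => //; lra.
have e_le : exp (- (m%:R * (p ^+ 2 * (1 - p) ^+ (n - 2)))) <= exp (- (3 * L)).
  set a := m%:R * _ in expo *.
  have -> : exp (- a) = exp (- (3 * L)) * exp (3 * L - a) by rewrite exp_add; congr exp; lra.
  by rewrite ler_piMr ?(ltW (expR_gt0 _)) // exp_le1 // subr_le0.
have -> : 1 - edge_prob n m p = exp (- (m%:R * (p ^+ 2 * (1 - p) ^+ (n - 2)))) by rewrite /edge_prob subKr.
apply: (le_trans (ler_wpM2l _ e_le)); first by rewrite exprn_ge0.
rewrite nE expRX exp_add -[L *+ 2]mulr_natl.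
have -> : 2 * L - 3 * L = - L by ring.
have eL : exp L * exp (- L) = 1 by rewrite exp_add subrr expR0.
have h1 : eps^-1 <= exp L by apply: le_trans (exp_ge1D _); lra.
have h2 := ler_wpM2r (ltW (expR_gt0 (- L))) h1.
rewrite eL mulrC ler_pdivrMr // mul1r in h2.
exact: h2.
Qed.

Lemma IZRE k : IZR (Z.of_nat k) = k%:R.
Proof. by rewrite -INRE INR_IZR_INZ. Qed.

Lemma pminusE (m : nat -> nat) (p : nat -> R) n : pminus m p n = edge_prob n (m n) (p n).
Proof. by rewrite /pminus /mR INRE !RpowE /edge_prob mulrA. Qed.

Lemma monotone_downC n (A : pred (graph n)) : monotone_down A -> monotone_up (predC A).
Proof. by move=> dn g h sg sh gh; apply: contra; apply: dn. Qed.

(** The threshold [N] precedes the property, so that one bound serves a sequence of properties as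
    well as their complements. *)
Lemma uniform_sandwich (alpha : real) (m : nat -> nat) (p pplus : nat -> R) (eps : real) :
  10 / 3 < alpha -> (forall n, Rpower (INR n) alpha < (m n)%:R + 1) ->
  (forall n, 0 <= (p n : real) <= 1) ->
  (regime1 m p /\ pplus = pplus1 m p) \/ (regime2 m p /\ pplus = pplus2 m p) ->
  0 < eps <= 1 ->
  exists N, forall n, (N <= n)%N -> forall A : pred (graph n), monotone_up A ->
    (prob_Gnp (pminus m p n) A : real) - eps <= prob_Gnmp (m n) (p n) A /\
    ((prob_Gnmp (m n) (p n) A : real) <= prob_Gnp (pplus n) A + eps \/
     (prob_Gnmp (m n) (p n) A : real) <= prob_Gnp (pminus m p n) A + eps).
Proof.
move=> a103 mlt p01 reg e01; have /andP [e0 e1] := e01.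
case: reg => [[[_ small] ->]|[[_ [C [N0 HC]]] ->]].
  have K4 : 1 <= 4 :> real by rewrite ler1n.
  have [delta [d0 [N1 H1]]] := small_p_sandwich a103 K4 e01.
  have [N2 H2] := large_p_sandwich a103 e01.
  (* The regime gives n p m^(1/4) <= th. Its fourth power bounds m (n p)^4 by th^4 <= delta, which
     removes the quadruples; as m >= 1, also n p <= eps / 8, as the dense case requires. *)
  pose th := Num.min 1 (Num.min delta (eps / 8)).
  have th0 : 0 < th by rewrite !lt_min ltr01 d0 divr_gt0.
  have /RltP th0' := th0; have [N3 H3] := small th th0'.
  have [N4 H4] := ln_eventually 1.
  exists (maxn (maxn N1 N2) (maxn N3 N4)) => n; rewrite !geq_max => /andP [/andP [n1 n2] /andP [n3 n4]] A up.
  have /andP [p0 p1] := p01 n.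
  rewrite pminusE.
  have [L1 nE] := H4 n n4.
  have n0 : 0 < n%:R :> real by rewrite nE expR_gt0.
  have M1 : 1 <= (m n)%:R :> real.
    have : 1 < Rpower (INR n) alpha.
      apply: lt_le_trans (exp_ge1D _); rewrite ltrDl mulr_gt0 //; first lra.
      exact: lt_le_trans L1.
    by move=> h; have := lt_trans h (mlt n); rewrite ltrDr ltr0n ler1n.
  have npth : (n%:R * p n) ^+ 4 * (m n)%:R <= th ^+ 4 /\ n%:R * p n <= th.
    have M0 : 0 < (m n)%:R :> real by apply: lt_le_trans M1.
    pose r : real := rt (INR 4) (m n)%:R.
    have r4 : r ^+ 4 = (m n)%:R by apply: rt_pow => //; apply: ltW.
    have r0 : 0 <= r by apply: rt_ge0.
    have r1 : 1 <= r by apply: (@le_of_pow 4) => //; rewrite r4 expr1n.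
    have rp : 0 < r by apply: lt_le_trans r1.
    have := H3 n n3 => /RleP; rewrite RabsE ger0_norm // RmultE RinvE RmultE /mR !INRE.
    have -> : rt (IZR 4) (m n)%:R = r by rewrite /r INR_IZR_INZ.
    rewrite -/(_ / _) ler_pdivlMr ?mulr_gt0 // => h.
    have h' : n%:R * p n * r <= th by rewrite mulrAC mulrC.
    split; last by apply: le_trans h'; rewrite ler_peMr // mulr_ge0 // ltW.
    by rewrite -r4 -exprMn; apply: lerXn2r => //; rewrite nnegrE ?(ltW th0) // !mulr_ge0 // ltW.
  case: npth => t4 npth.
  have [small_p|large_p] := lerP ((m n)%:R * (p n : real) ^+ 2) (4 * ln (INR n)).
    have [lo _ hi] := H1 n n1 (m n) (p n) A (mlt n) (p01 n) small_p up.
    split=> //; left; rewrite /pplus1 pminusE /mR INRE RpowE.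
    rewrite (IZRE 3) (IZRE 30) -(INRE 3).
    apply: hi; rewrite mulrC; apply: (le_trans t4).
    apply: (@le_trans _ _ th); last by rewrite /th !ge_min lexx orbT.
    by rewrite -[leRHS]expr1 ler_wiXn2l ?(ltW th0) // /th ge_min lexx.
  have npe : n%:R * (p n : real) <= eps / 8.
    by apply: (le_trans npth); rewrite /th !ge_min lexx !orbT.
  have [lo hi] := H2 n n2 (m n) (p n) A (mlt n) (p01 n) (ltW large_p) npe up.
  by split=> //; right.
(* Squaring p <= C sqrt (ln n / m) gives m p^2 <= C^2 ln n; the summand 1 ensures [1 <= K]. *)
pose K := 1 + (C : real) ^+ 2.
have K1 : 1 <= K by rewrite lerDl exprn_even_ge0.
have [delta [d0 [N1 H1]]] := small_p_sandwich a103 K1 e01.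
have [N4 H4] := ln_eventually 1.
exists (maxn N0 (maxn N1 N4)) => n; rewrite !geq_max => /and3P [n0 n1 n4] A up.
have /andP [p0 p1] := p01 n.
have [L1 nE] := H4 n n4.
have small_p : (m n)%:R * (p n : real) ^+ 2 <= K * ln (INR n).
  have [M0|M0] := eqVneq ((m n)%:R : real) 0.
    by rewrite M0 mul0r mulr_ge0 ?(le_trans ler01 K1) // (le_trans ler01).
  have M0' : 0 < (m n)%:R :> real by rewrite lt_neqAle eq_sym M0 ler0n.
  have := HC n n0 => /RleP; rewrite RabsE ger0_norm // !RmultE RinvE !RsqrtE /mR [X in Num.sqrt X]INRE.
  set s := Num.sqrt (m n)%:R; set t := Num.sqrt (ln _).
  have s2 : s ^+ 2 = (m n)%:R by rewrite sqr_sqrtr.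
  have t2 : t ^+ 2 = ln (INR n) by rewrite sqr_sqrtr // (le_trans ler01).
  have s0 : 0 < s by rewrite sqrtr_gt0.
  move=> h.
  have h' : s * p n <= C * t.
    have := ler_wpM2l (ltW s0) h; have -> : s * (C * (s^-1 * t)) = C * t by field; rewrite gt_eqF.
    by [].
  have h2 : (s * p n) ^+ 2 <= (C * t) ^+ 2.
    apply: lerXn2r => //; rewrite nnegrE; first by rewrite mulr_ge0 // ltW.
    by apply: le_trans h'; rewrite mulr_ge0 // ltW.
  rewrite !exprMn s2 t2 in h2; apply: (le_trans h2); rewrite /K mulrDl mul1r lerDr.
  exact: le_trans ler01 L1.
have [lo hi _] := H1 n n1 (m n) (p n) A (mlt n) (p01 n) small_p up.
rewrite pminusE; split=> //; left; rewrite /pplus2 pminusE /mR INRE !RpowE.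
rewrite (IZRE 3) (IZRE 30) (IZRE 6) (IZRE 157) -(INRE 3) -(INRE 6).
exact: hi.
Qed.
End Limits.

Lemma Un_cv_compl (u v : nat -> R) a : (forall n, v n = 1 - u n)%R -> Un_cv u a -> Un_cv v (1 - a)%R.
Proof.
move=> vu cu; apply: Un_cv_eq (CV_minus _ _ _ _ (Un_cv_const 1%R) cu) => n.
by rewrite vu.
Qed.

Local Open Scope R_scope.

Theorem theorem4 (a alpha : R) (m : nat -> nat) (p : nat -> R)
  (A : forall n : nat, pred (graph n)) (pplus : nat -> R) :
  0 <= a <= 1 ->
  10 / 3 < alpha ->
  (forall n : nat, INR (m n) <= Rpower (INR n) alpha < INR (m n) + 1) ->
  (forall n : nat, 0 <= p n <= 1) ->
  (forall n : nat, graph_property (A n)) ->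
  ((forall n : nat, monotone_up (A n)) \/ (forall n : nat, monotone_down (A n))) ->
  ((regime1 m p /\ pplus = pplus1 m p) \/ (regime2 m p /\ pplus = pplus2 m p)) ->
  Un_cv (fun n => @prob_Gnp n (pminus m p n) (A n)) a ->
  Un_cv (fun n => @prob_Gnp n (pplus n) (A n)) a ->
  Un_cv (fun n => @prob_Gnmp n (m n) (p n) (A n)) a.
Proof.
move=> _ a103 hm hp _ mono reg cm cp.
have a103' : ((10%:R : R) / 3%:R < alpha)%R by apply/RltP; rewrite -(IZRE 10) -(IZRE 3).
have mlt n : (Rpower (INR n) alpha < (m n)%:R + 1)%R.
  by apply/RltP; rewrite -INRE; case: (hm n).
have p01 n : (0 <= (p n : R) <= 1)%R.
  by case: (hp n) => p0 p1; apply/andP; split; apply/RleP.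
have sq := uniform_sandwich a103' mlt p01 reg.
case: mono => mono.
  apply: (squeeze_cv cm cp) => eps e01; have [N HN] := sq eps e01.
  by exists N => n Nn; apply: HN.
have compl n (B : pred (graph n)) q : prob_Gnp q (predC B) = 1 - prob_Gnp q B by exact: prob_Gnp_predC.
have cm' := Un_cv_compl (fun n => compl n (A n) _) cm.
have cp' := Un_cv_compl (fun n => compl n (A n) _) cp.
have -> : a = 1 - (1 - a) by exact: (esym (subKr (1 : R) a)).
apply: (@Un_cv_compl (fun n => prob_Gnmp (m n) (p n) (predC (A n)))) => [n|].
  by rewrite [in RHS]prob_Gnmp_predC; apply: esym; apply: subKr.
apply: (squeeze_cv cm' cp') => eps e01; have [N HN] := sq eps e01.
by exists N => n Nn; apply: HN => //; apply: monotone_downC.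
Qed.
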